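(* There exists a constant $C>0$ such that for every $\varepsilon\in(0,\tfrac12)$ and every measurable set $E\subset[0,1]^2$ of Lebesgue measure at least $\varepsilon$ there exist $x,y,t\in\mathbb{R}$ with $$(x,y),\ (x+t,y),\ (x,y+t^2)\in E$$ and $t>\exp(-\exp(\varepsilon^{-C}))$.
   Context: The constant $C$ does not depend on $E$ or $\varepsilon$. *)

(* Defs.v *)
From HB Require Import structures.
From mathcomp Require Import all_boot all_order all_algebra.
From mathcomp Require Import all_classical all_reals all_analysis.

Set Implicit Arguments.
Unset Strict Implicit.
Unset Printing Implicit Defensive.

Import Order.TTheory GRing.Theory Num.Theory.
Import numFieldNormedType.Exports.

Local Open Scope classical_set_scope.
Local Open Scope ring_scope.

Definition borel_plane_measure (R : realType) :
    {measure set (measurableTypeR R * measurableTypeR R) -> \bar R} :=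
  (lebesgue_measure \x lebesgue_measure)%E.

(* The product sigma-algebra on the plane is only the Borel one; as with
   [completed_lebesgue_measure] on the line, the Lebesgue measure and its
   complete sigma-algebra come from the Caratheodory extension. *)
Definition plane_lebesgue_measurable {R : realType} (E : set (R * R)) : Prop :=
  ((borel_plane_measure R)^*%mu).-cara.-measurable E.

Definition plane_lebesgue_measure {R : realType} (E : set (R * R)) : \bar R :=
  @completed_measure_extension _ _ _ (borel_plane_measure R) E.

Definition unit_square {R : realType} : set (R * R) := `[0, 1] `*` `[0, 1].

(* Main.v *)
(* By inner regularity and an averaged choice of offset, it suffices to find a
   corner in a subset F of a fine grid [0, A) x [0, A^2), A = 2^n, whose columns
   are L^1-close to unions of dyadic intervals of length 2^-j. Here n may be
   taken large in terms of j, but the lower bound for t must not depend on j.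

   Let the corner form count the P and t, N <= t < 2N, with weights
   f1(P + t e1) f3(P) g(P + t^2 e2). If g varies slowly at a scale slightly
   below N^2 in the direction e2 while its sums over e2-intervals are small
   compared to N^2, the form is small. Indeed, three applications of
   Cauchy-Schwarz eliminate f1 and f3 and leave sums of correlations of g over
   paths of three steps, with signs +, -, +, on the parabola. For a fixed total
   horizontal displacement X these are parametrised by two differences p, q, and
   the height and the lag of the correlation depend on p q and p q / t only.
   Along a hyperbola p q = z, over short windows of p, the height is almost
   constant while the lag is almost linear and non-constant, so that the sums
   over intervals of g produce cancellation.

   Telescoping this over the scales between 2^-j and N^2 replaces the third
   copy of f by its vertical average at scale N^2. The remaining two copies and
   this average change little when passing to averages at coarser scales,
   provided that N is chosen, by pigeonholing the energy of f, among poly(1/eps)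
   scales of ratio poly(eps). The resulting main term is at least of order
   eps^3, as f is rarely supported where its averages are small. *)

(* The number of telescoping steps grows with j and is not controlled by eps. This costs nothing,
   because the gain improves on the way: the step from the scale N^2 / 2^(480 (e + i)) to the next
   one is made with q = 2^(e + i) and costs O(|V| N / q), so that the costs form a geometric series
   with sum O(|V| N / 2^e). Only the condition N >= q^512 involves j, and it is met by refining the
   grid, which does not affect the lower bound for t / A.

   The exponents come from the square roots and from the windows. Three applications of
   Cauchy-Schwarz reduce a gain 1 / Q for the paths to 1 / q for the form, where Q = q^8. The
   differencing range is H = N / Q^32 and g lives at the scale N^2 / Q^60, whence 480 = 8 * 60. This
   scale is above H^2, so that a shift of the lag by h^2 is not felt by g, and far below N H, the
   size of the lags. Along a window of length Q^12 H the linear part of the lag sweeps many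
   multiples of this scale, while its second order part stays below it. *)
From HB Require Import structures.
From mathcomp Require Import all_boot all_order all_algebra.
From mathcomp Require Import zify ring lra.

Set Implicit Arguments.
Unset Strict Implicit.
Unset Printing Implicit Defensive.

Import Order.TTheory GRing.Theory Num.Theory.
Local Open Scope ring_scope.

(** * Finite sums *)

Section SumTools.
Context {R : realFieldType}.

Lemma ler_norm_sum_seq (I : eqType) (r : seq I) (F G : I -> R) :
  (forall i, i \in r -> `|F i| <= G i) ->
  `|\sum_(i <- r) F i| <= \sum_(i <- r) G i.
Proof.
move=> h; apply: le_trans (ler_norm_sum _ _ _) _.
by rewrite !big_seq; apply: ler_sum => i /h.
Qed.

Lemma sumr_const_seq (I : Type) (r : seq I) (c : R) :
  \sum_(i <- r) c = (size r)%:R * c.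
Proof. by rewrite big_const_seq count_predT iter_addr_0 mulr_natl. Qed.

Lemma ler_sum_const (I : eqType) (r : seq I) (F : I -> R) c :
  (forall i, i \in r -> F i <= c) -> \sum_(i <- r) F i <= (size r)%:R * c.
Proof.
move=> h; rewrite -sumr_const_seq !big_seq.
by apply: ler_sum => i /h.
Qed.

Lemma ler_norm_sum_const (I : eqType) (r : seq I) (F : I -> R) c :
  (forall i, i \in r -> `|F i| <= c) ->
  `|\sum_(i <- r) F i| <= (size r)%:R * c.
Proof. by move=> h; rewrite -sumr_const_seq; apply: ler_norm_sum_seq. Qed.

Lemma ler_dist_sum_const (I : eqType) (r : seq I) (F G : I -> R) c :
  (forall i, i \in r -> `|F i - G i| <= c) ->
  `|\sum_(i <- r) F i - \sum_(i <- r) G i| <= (size r)%:R * c.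
Proof. by move=> h; rewrite -sumrB; apply: ler_norm_sum_const. Qed.

Lemma sqr_sum_le (I : eqType) (r : seq I) (F : I -> R) :
  (\sum_(i <- r) F i) ^+ 2 <= (size r)%:R * \sum_(i <- r) F i ^+ 2.
Proof.
case: r => [|i0 r]; first by rewrite !big_nil expr0n mulr0.
set s := i0 :: r; set S := \sum_(i <- s) _; set n : R := (size s)%:R.
have n0 : 0 < n by rewrite ltr0n.
have : 0 <= \sum_(i <- s) (n * F i - S) ^+ 2.
  by apply: sumr_ge0 => i _; rewrite sqr_ge0.
have -> : \sum_(i <- s) (n * F i - S) ^+ 2 =
    n * (n * \sum_(i <- s) F i ^+ 2 - S ^+ 2).
  rewrite (eq_bigr (fun i => n ^+ 2 * F i ^+ 2 + (- 2 * n * S) * F i + S ^+ 2));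
    last by move=> i _; ring.
  rewrite !big_split /= -!mulr_sumr sumr_const_seq -/S -/n; ring.
by rewrite pmulr_rge0 // subr_ge0.
Qed.

Lemma sum_shift_le (phi : nat -> R) (N s : nat) :
  (forall t, `|phi t| <= 1) ->
  `|\sum_(N <= t < 2 * N) phi (t + s)%N - \sum_(N <= t < 2 * N) phi t|
    <= 2 * s%:R.
Proof.
move=> h; elim: s => [|s ih].
  by under eq_bigr do rewrite addn0; rewrite subrr normr0 mulr0.
have e : \sum_(N <= t < 2 * N) phi (t + s.+1)%N -
    \sum_(N <= t < 2 * N) phi (t + s)%N = phi (2 * N + s)%N - phi (N + s)%N.
  rewrite -sumrB -(GRing.telescope_sumr (fun t => phi (t + s)%N)); last by lia.
  by apply: eq_bigr => t _; rewrite addSnnS.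
rewrite -(subrKA (\sum_(N <= t < 2 * N) phi (t + s)%N)) e.
apply: le_trans (ler_normD _ _) _.
apply: le_trans (lerD (ler_normB _ _) ih) _.
by have := h (2 * N + s)%N; have := h (N + s)%N; rewrite -natr1; lra.
Qed.

Lemma big_nat_mulr (a b : nat) (F : nat -> R) :
  \sum_(0 <= k < a * b) F k = \sum_(0 <= i < a) \sum_(0 <= s < b) F (i * b + s)%N.
Proof.
elim: a => [|a ih]; first by rewrite mul0n !big_geq.
rewrite big_nat_recr //= -ih mulSn addnC (big_cat_nat (leq0n _) (leq_addr b (a * b))) /=.
congr (_ + _); rewrite -{1}(add0n (a * b)%N) big_addn addKn.
by apply: eq_bigr => s _; rewrite addnC.
Qed.

(** The vanishing hypothesis lets the same range [K] serve for all block lengths [m]; it is applied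
    with m = 2 t, where t varies. *)
Lemma sum_divn_block (K n m : nat) (psi : nat -> R) : (n * m <= K)%N ->
  (forall k, (n * m <= k)%N -> psi k = 0) ->
  \sum_(0 <= k < K) psi k = \sum_(0 <= h < n) \sum_(0 <= s < m) psi (h * m + s)%N.
Proof.
move=> le z; rewrite -big_nat_mulr (big_cat_nat (leq0n _) le) /=.
rewrite [X in _ + X]big1_seq ?addr0 // => k.
by rewrite mem_index_iota => /andP[_ /andP[/z]].
Qed.

Lemma size_irange (N : nat) : size (index_iota N (2 * N)) = N.
Proof. rewrite size_iota; lia. Qed.

Lemma size_index_enum (V : finType) : size (index_enum V) = #|V|.
Proof. by rewrite cardT enumT. Qed.

Lemma sum_translate (V : finZmodType) (a : V) (F : V -> R) :
  \sum_(P : V) F (P + a) = \sum_(P : V) F P.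
Proof. by rewrite [RHS](reindex_inj (addIr a)). Qed.

End SumTools.

(** * Three applications of Cauchy-Schwarz *)

Section CauchySchwarz.
Context {R : realFieldType} {V : finZmodType}.
Variables (e1 e2 : V) (f1 f3 g : V -> R) (lam : R) (N H : nat).
Hypotheses (hf1 : forall P, `|f1 P| <= 1) (hf3 : forall P, `|f3 P| <= 1).
Hypotheses (hg : forall P, `|g P| <= 1)
  (hlip : forall P, `|g (P + e2) - g P| <= lam).

Definition pt (a b : int) : V := e1 *~ a + e2 *~ b.

Lemma ptD a b c d : pt a b + pt c d = pt (a + c) (b + d).
Proof. by rewrite /pt addrACA -!mulrzDr. Qed.

Lemma addptA P a b c d : P + pt a b + pt c d = P + pt (a + c) (b + d).
Proof. by rewrite -addrA ptD. Qed.

(** The vector from the horizontal vertex P + t e1 of a corner to its vertical vertex P + t^2 e2. *)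
Definition pvec (t : nat) : V := pt (- t%:Z) (t%:Z ^+ 2).
Definition corr (P : V) (k : nat) : R := g P * g (P + pt 0 k).

Lemma lip_ge0 : 0 <= lam.
Proof. exact: le_trans (normr_ge0 _) (hlip 0). Qed.

Lemma lip_iter P (j : nat) : `|g (P + pt 0 j) - g P| <= lam * j%:R.
Proof.
rewrite /pt mulr0z add0r; elim: j => [|j ih].
  by rewrite mulr0z addr0 subrr normr0 mulr0.
rewrite -addn1 PoszD mulrzDr addrA mulr1z natrD.
apply: le_trans (ler_distD (g (P + e2 *~ j)) _ _) _.
by have := hlip (P + e2 *~ j); move: ih; rewrite mulrDr; lra.
Qed.

Lemma norm_mul_le1 (a b : R) : `|a| <= 1 -> `|b| <= 1 -> `|a * b| <= 1.
Proof.
move=> ha hb; rewrite normrM -[1]mulr1; apply: ler_pM => //; exact: normr_ge0.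
Qed.

(* The trilinear form counting corners [P], [P + t e1], [P + t^2 e2]. *)
Definition cform : R := \sum_(P : V) \sum_(N <= t < 2 * N)
  f3 P * f1 (P + pt t 0) * g (P + pt 0 (t%:Z ^+ 2)).

Let aa s P t := f1 (P + pt (t + s)%N 0) * g (P + pt 0 ((t + s)%N%:Z ^+ 2)).
(** Van der Corput differencing: the variable t is shifted by all s < H, but [f3], which does not
    see t, stays outside the sum over s. *)
Definition cform_avg : R := \sum_(P : V) \sum_(N <= t < 2 * N)
  f3 P * \sum_(0 <= s < H) aa s P t.

Lemma cform_avg_close : `|H%:R * cform - cform_avg| <= #|V|%:R * (H%:R * (2 * H%:R)).
Proof.
rewrite /cform mulr_sumr -size_index_enum; apply: ler_dist_sum_const => P _.
have -> : \sum_(N <= t < 2 * N) f3 P * \sum_(0 <= s < H) aa s P t =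
    \sum_(0 <= s < H) \sum_(N <= t < 2 * N) f3 P * aa s P t.
  by rewrite exchange_big /=; apply: eq_bigr => t _; rewrite mulr_sumr.
have hs : size (index_iota 0 H) = H by rewrite size_iota subn0.
have -> : H%:R * (\sum_(N <= t < 2 * N)
      f3 P * f1 (P + pt t 0) * g (P + pt 0 (t%:Z ^+ 2))) =
    \sum_(0 <= s < H) \sum_(N <= t < 2 * N)
      f3 P * f1 (P + pt t 0) * g (P + pt 0 (t%:Z ^+ 2)).
  by rewrite sumr_const_seq hs.
rewrite -[X in _ <= X%:R * _]hs; apply: ler_dist_sum_const => s.
rewrite mem_index_iota => /andP[_ sH].
pose phi (t : nat) := f3 P * f1 (P + pt t 0) * g (P + pt 0 (t%:Z ^+ 2)).
rewrite distrC; under eq_bigr do rewrite /aa mulrA -/(phi _).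
apply: le_trans (sum_shift_le _ _ _) _.
  by move=> t; rewrite /phi; do 2!apply: norm_mul_le1 => //.
by rewrite ler_pM2l // ler_nat ltnW.
Qed.

Let C s s' := \sum_(P : V) \sum_(N <= t < 2 * N) aa s P t * aa s' P t.

(** First Cauchy-Schwarz, over (P, t): it removes [f3]. *)
Lemma cform_avg_sqr : cform_avg ^+ 2 <=
  (#|V| * N)%:R * \sum_(0 <= s < H) \sum_(0 <= s' < H) C s s'.
Proof.
have -> : \sum_(0 <= s < H) \sum_(0 <= s' < H) C s s' =
   \sum_(P : V) \sum_(N <= t < 2 * N) (\sum_(0 <= s < H) aa s P t) ^+ 2.
  rewrite /C; under eq_bigr do rewrite exchange_big /=.
  rewrite exchange_big /=; apply: eq_bigr => P _.
  under eq_bigr do rewrite exchange_big /=.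
  rewrite exchange_big /=; apply: eq_bigr => t _.
  by rewrite expr2 mulr_suml; apply: eq_bigr => s _; rewrite mulr_sumr.
apply: le_trans (sqr_sum_le _ _) _.
rewrite size_index_enum natrM -mulrA ler_wpM2l ?ler0n // mulr_sumr.
apply: ler_sum => P _; apply: le_trans (sqr_sum_le _ _) _.
rewrite size_irange ler_wpM2l ?ler0n //; apply: ler_sum => t _.
rewrite exprMn -[leRHS]mul1r ler_wpM2r ?sqr_ge0 //.
by rewrite -[_ ^+ 2]ger0_norm ?sqr_ge0 // normrX exprn_ile1.
Qed.

Definition vdc_bound (h : nat) : R :=
  \sum_(L : V) `|\sum_(N <= t < 2 * N) corr (L + pvec t) (2 * t * h)%N| +
  #|V|%:R * (2 * H%:R + N%:R * (lam * H%:R ^+ 2)).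

(** With the horizontal vertex P + (t + s) e1 as new base point, both copies of [f1] are independent
    of t and are bounded by 1. The two copies of [g] are then at distance 2 (t + s) h + h^2:
    removing the shift by s costs boundary terms, and removing h^2 costs a Lipschitz term. *)
Lemma vdc_corr_le s h : (s + h < H)%N -> C s (s + h)%N <= vdc_bound h.
Proof.
move=> shH; rewrite /C exchange_big /=.
pose psi (P : V) t := g (P + pvec t) * g (P + pvec t + pt 0 (2 * t * h + h ^ 2)%N).
have -> : \sum_(N <= t < 2 * N) \sum_(P : V) aa s P t * aa (s + h) P t =
  \sum_(P : V) f1 P * f1 (P + pt h 0) * \sum_(N <= t < 2 * N) psi P (t + s)%N.
  rewrite [RHS](eq_bigr _ (fun P _ => mulr_sumr _ _ _ _)).
  rewrite [RHS]exchange_big /=; apply: eq_bigr => t _.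
  rewrite -[RHS](sum_translate (pt (t + s)%N 0)); apply: eq_bigr => P _.
  rewrite /aa /psi /pvec !addptA mulrACA.
  by congr (_ * f1 (_ + pt _ _) * (g (_ + pt _ _) * g (_ + pt _ _))); lia.
rewrite /vdc_bound -{1}size_index_enum -sumr_const_seq -big_split /=.
apply: ler_sum => P _.
set S := \sum_(_ <= t < _) corr (P + pvec t) (2 * t * h)%N.
apply: le_trans (ler_norm _) _; rewrite normrM.
have hn : `|f1 P * f1 (P + pt h 0)| <= 1 by apply: norm_mul_le1.
apply: le_trans (ler_wpM2r (normr_ge0 _) hn) _; rewrite mul1r.
set U1 := \sum_(_ <= t < _) psi P (t + s)%N.
have h1 : `|U1 - \sum_(N <= t < 2 * N) psi P t| <= 2 * s%:R.
  have hp t : `|psi P t| <= 1 by apply: norm_mul_le1.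
  exact: sum_shift_le hp.
have h2 : `|\sum_(N <= t < 2 * N) psi P t - S| <= N%:R * (lam * H%:R ^+ 2).
  rewrite -[X in X%:R * (lam * _)](size_irange N).
  apply: ler_dist_sum_const => t _.
  rewrite /psi /corr -mulrBr normrM.
  apply: le_trans (ler_wpM2r (normr_ge0 _) (hg _)) _; rewrite mul1r PoszD.
  rewrite -[0 in X in g (_ + X) - _](addr0 0) -ptD addrA.
  apply: le_trans (lip_iter _ _) _; rewrite ler_wpM2l ?lip_ge0 //.
  by rewrite -natrX ler_nat leq_sqr; lia.
have h3 : 2 * s%:R <= 2 * H%:R :> R by rewrite ler_pM2l // ler_nat; lia.
move: h1 h2; set U2 := \sum_(_ <= _ < _) _ => h1 h2.
have := ler_normD (U1 - U2) (U2 - S); rewrite subrKA => h4.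
have := ler_normD (U1 - S) S; rewrite subrK => h5.
lra.
Qed.

Lemma vdc_bound_ge0 h : 0 <= vdc_bound h.
Proof.
rewrite /vdc_bound addr_ge0 //; first by apply: sumr_ge0.
by rewrite mulr_ge0 // addr_ge0 // mulr_ge0 // mulr_ge0 ?lip_ge0 // exprn_ge0.
Qed.

(** For fixed s the distance |s' - s| takes each value h < H at most twice. *)
Lemma cform_avg_le : cform_avg ^+ 2 <=
  (#|V| * N)%:R * (2 * H%:R * \sum_(0 <= h < H) vdc_bound h).
Proof.
apply: le_trans cform_avg_sqr _; rewrite ler_wpM2l ?ler0n //.
have hs : size (index_iota 0 H) = H by rewrite size_iota subn0.
rewrite mulrAC -mulrA [X in _ <= X]mulrC -mulrA [X in _ <= X]mulrC.
apply: le_trans (ler_sum_const (c := 2 * \sum_(0 <= h < H) vdc_bound h) _) _; last first.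
  by rewrite hs; lra.
move=> s; rewrite mem_index_iota => /andP[_ sH].
have symC s1 s2 : C s1 s2 = C s2 s1.
  by apply: eq_bigr => P _; apply: eq_bigr => t _; rewrite mulrC.
rewrite (big_cat_nat (leq0n s) (ltnW sH)) /=.
have -> : 2 * \sum_(0 <= h < H) vdc_bound h =
   \sum_(0 <= h < H) vdc_bound h + \sum_(0 <= h < H) vdc_bound h by ring.
apply: lerD.
  rewrite big_nat_rev /=.
  apply: (@le_trans _ _ (\sum_(0 <= h < s) vdc_bound h.+1)).
    apply: ler_sum_nat => h /andP[_ hs'].
    rewrite symC; have -> : C (0 + s - h.+1) s = C (s - h.+1) (s - h.+1 + h.+1).
      by congr (C _ _); lia.
    by apply: vdc_corr_le; lia.
  rewrite -(big_add1 _ _ 0 s.+1 xpredT vdc_bound) /=.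
  rewrite [leRHS](big_cat_nat (n := 1)) //=; last by lia.
  rewrite [X in _ <= _ + X](big_cat_nat (n := s.+1)) //=.
  rewrite addrCA lerDl addr_ge0 //; apply: sumr_ge0 => *; exact: vdc_bound_ge0.
rewrite -{1}(add0n s) big_addn.
apply: (@le_trans _ _ (\sum_(0 <= h < H - s) vdc_bound h)).
  apply: ler_sum_nat => h /andP[_ hs'].
  by rewrite addnC; apply: vdc_corr_le; lia.
rewrite [leRHS](big_cat_nat (n := H - s)%N) //=; last by lia.
by rewrite lerDl; apply: sumr_ge0 => *; exact: vdc_bound_ge0.
Qed.

(** With a cutoff the correlations vanish at large lags, so that sums over h and over lags k = 2 t h
    can be exchanged without end effects, although the range of k would otherwise depend on t. Being
    Lipschitz, it does not spoil the regularity in k. *)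
Definition cutoff (u : R) : R :=
  if u <= 1 then 1 else if 2 <= u then 0 else 2 - u.

Lemma cutoff_ge0 u : 0 <= cutoff u.
Proof. by rewrite /cutoff; case: (lerP u 1) => ?; case: (lerP 2 u) => ?; lra. Qed.

Lemma cutoff_le1 u : cutoff u <= 1.
Proof. by rewrite /cutoff; case: (lerP u 1) => ?; case: (lerP 2 u) => ?; lra. Qed.

Lemma cutoff_lip u v : `|cutoff u - cutoff v| <= `|u - v|.
Proof.
rewrite /cutoff ler_norml; case: (lerP u 1) => ?; case: (lerP 2 u) => ?;
 case: (lerP v 1) => ?; case: (lerP 2 v) => ?; case: (ger0P (u - v)) => ?; lra.
Qed.

Hypotheses (N0 : (0 < N)%N) (H0 : (0 < H)%N).

Definition cut_scale : R := (4 * N * H)%:R.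

Lemma cut_scale_gt0 : 0 < cut_scale.
Proof. rewrite ltr0n; lia. Qed.

Definition cut_corr (P : V) (k : nat) : R := cutoff (k%:R / cut_scale) * corr P k.

Lemma corr_le1 P k : `|corr P k| <= 1.
Proof. exact: norm_mul_le1. Qed.

Lemma cut_corr_le1 P k : `|cut_corr P k| <= 1.
Proof. by apply: norm_mul_le1 (corr_le1 _ _); rewrite ger0_norm ?cutoff_ge0 // cutoff_le1. Qed.

Lemma cut_corrE P k : (k <= 4 * N * H)%N -> cut_corr P k = corr P k.
Proof.
move=> h; rewrite /cut_corr (_ : cutoff _ = 1) ?mul1r //.
have : k%:R / cut_scale <= 1 by rewrite ler_pdivrMr ?cut_scale_gt0 // mul1r ler_nat.
by rewrite /cutoff => ->.
Qed.

Lemma cut_corr_eq0 P k : (8 * N * H <= k)%N -> cut_corr P k = 0.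
Proof.
move=> h; rewrite /cut_corr (_ : cutoff _ = 0) ?mul0r //.
have : 2 <= k%:R / cut_scale.
  by rewrite ler_pdivlMr ?cut_scale_gt0 // -natrM ler_nat; lia.
by rewrite /cutoff => h1; rewrite h1; case: lerP => //; lra.
Qed.

Definition cut_lip : R := lam + cut_scale^-1.

Lemma cut_lip_ge0 : 0 <= cut_lip.
Proof. by rewrite addr_ge0 ?lip_ge0 // invr_ge0 ltW // cut_scale_gt0. Qed.

Lemma corr_lip P k j : `|corr P k - corr P j| <= lam * `|k%:R - j%:R|.
Proof.
wlog kj : k j / (j <= k)%N.
  move=> W; case: (leqP j k) => h; first exact: W.
  by rewrite distrC (distrC k%:R); apply: W; apply: ltnW.
rewrite /corr -mulrBr normrM.
apply: le_trans (ler_wpM2r (normr_ge0 _) (hg _)) _; rewrite mul1r.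
rewrite -(subnKC kj) PoszD.
have -> : P + pt 0 (j%:Z + (k - j)%N%:Z) = P + pt 0 j + pt 0 (k - j)%N.
  by rewrite addptA addr0.
apply: le_trans (lip_iter _ _) _; rewrite ler_wpM2l ?lip_ge0 //.
by rewrite natrD addrAC subrr add0r ger0_norm.
Qed.

Lemma cut_corr_lip P k j : `|cut_corr P k - cut_corr P j| <= cut_lip * `|k%:R - j%:R|.
Proof.
have -> : cut_corr P k - cut_corr P j = cutoff (k%:R / cut_scale) * (corr P k - corr P j) +
   (cutoff (k%:R / cut_scale) - cutoff (j%:R / cut_scale)) * corr P j.
  by rewrite /cut_corr; ring.
apply: le_trans (ler_normD _ _) _; rewrite /cut_lip [leRHS]mulrDl; apply: lerD.
  rewrite normrM -[leRHS]mul1r; apply: ler_pM => //; last exact: corr_lip.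
  by rewrite ger0_norm ?cutoff_ge0 // cutoff_le1.
rewrite normrM -[leRHS]mulr1; apply: ler_pM => //; last exact: corr_le1.
apply: le_trans (cutoff_lip _ _) _.
by rewrite -mulrBl normrM mulrC ger0_norm // invr_ge0 ltW // cut_scale_gt0.
Qed.

Definition corr_sum : R := \sum_(0 <= h < H) \sum_(L : V)
  `|\sum_(N <= t < 2 * N) corr (L + pvec t) (2 * t * h)%N|.
Definition cut_corr_energy : R := \sum_(0 <= h < 4 * H) \sum_(L : V)
  (\sum_(N <= t < 2 * N) cut_corr (L + pvec t) (2 * t * h)%N) ^+ 2.

(** Second Cauchy-Schwarz, over (h, L): it removes the signs left behind by [f1]. For h < H the
    cutoff equals 1, and the further h up to 4 H only add squares. *)
Lemma corr_sum_le : corr_sum ^+ 2 <= (H * #|V|)%:R * cut_corr_energy.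
Proof.
apply: le_trans (sqr_sum_le _ _) _.
rewrite size_iota subn0 natrM -mulrA ler_wpM2l // mulr_sumr.
apply: (@le_trans _ _ (\sum_(0 <= h < H) #|V|%:R * \sum_(L : V)
  (\sum_(N <= t < 2 * N) cut_corr (L + pvec t) (2 * t * h)%N) ^+ 2)).
  apply: ler_sum_nat => h /andP[_ hH].
  apply: le_trans (sqr_sum_le _ _) _; rewrite size_index_enum ler_wpM2l //.
  apply: ler_sum => L _; rewrite real_normK ?num_real //.
  rewrite le_eqVlt; apply/orP; left; apply/eqP; congr (_ ^+ 2).
  by apply: eq_big_nat => t /andP[_ t2]; rewrite cut_corrE //; nia.
rewrite [leRHS](big_cat_nat (n := H)) //=; last by lia.
rewrite lerDl; apply: sumr_ge0 => h _; rewrite mulr_ge0 //.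
by apply: sumr_ge0 => L _; rewrite sqr_ge0.
Qed.

(** This is [pvec t' - pvec t]. *)
Definition pdiff (t t' : nat) : V := pt (t%:Z - t'%:Z) (t'%:Z ^+ 2 - t%:Z ^+ 2).
(** Here k is the lag of a correlation at [P] that was reached with the step t; the difference h is
    recovered as k %/ (2 t). *)
Definition fiber_sum (t : nat) P k := \sum_(N <= t' < 2 * N)
  cut_corr (P + pdiff t t') (2 * t' * (k %/ (2 * t)))%N.
Definition fiber_avg P k := \sum_(N <= t < 2 * N) (2 * t%:R)^-1 * fiber_sum t P k.
Definition fiber_energy : R := \sum_(P : V) \sum_(0 <= k < 16 * N * H) fiber_avg P k ^+ 2.

Lemma fiber_sum_le t P k : `|fiber_sum t P k| <= N%:R.
Proof.
rewrite -[leRHS]mulr1 -[X in X%:R * _](size_irange N).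
by apply: ler_norm_sum_const => t' _; apply: cut_corr_le1.
Qed.

(** The square is opened with the first correlation based at [P], and h is spread over the 2 t
    integers k with k %/ (2 t) = h; hence the weight. *)
Lemma cut_corr_energyE : cut_corr_energy = \sum_(N <= t < 2 * N) \sum_(P : V)
  \sum_(0 <= k < 16 * N * H) (2 * t%:R)^-1 *
    (cut_corr P (2 * t * (k %/ (2 * t)))%N * fiber_sum t P k).
Proof.
have -> : cut_corr_energy = \sum_(N <= t < 2 * N) \sum_(P : V) \sum_(0 <= h < 4 * H)
   cut_corr P (2 * t * h)%N * \sum_(N <= t' < 2 * N) cut_corr (P + pdiff t t') (2 * t' * h)%N.
  rewrite /cut_corr_energy.
  under eq_bigr => h _ do under eq_bigr => L _ do
    rewrite expr2 mulr_suml.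
  under eq_bigr => h _ do rewrite exchange_big /=.
  rewrite exchange_big /=; apply: eq_bigr => t _.
  rewrite [RHS]exchange_big /=; apply: eq_bigr => h _.
  rewrite -[RHS](sum_translate (pvec t)); apply: eq_bigr => L _; congr (_ * _).
  apply: eq_bigr => t' _; rewrite /pvec /pdiff addptA.
  by congr (cut_corr (_ + pt _ _)); ring.
apply: eq_big_nat => t /andP[tN tN2]; apply: eq_bigr => P _.
have t0 : (0 < 2 * t)%N by lia.
rewrite -mulr_sumr (@sum_divn_block _ (16 * N * H) (4 * H) (2 * t)); last 2 first.
- nia.
- move=> k hk; rewrite cut_corr_eq0 ?mul0r //.
  have := leq_div2r (2 * t) hk; rewrite mulnK // => hk'; nia.
rewrite mulr_sumr; apply: eq_bigr => h _.
rewrite [X in _ = _ * X](eq_big_nat _ _ (F2 := fun=> cut_corr P (2 * t * h)%N *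
    \sum_(N <= t' < 2 * N) cut_corr (P + pdiff t t') (2 * t' * h)%N)).
  rewrite [in RHS]sumr_const_seq size_iota subn0 natrM [RHS]mulrA mulVf ?mul1r //.
  by rewrite -natrM pnatr_eq0; lia.
move=> s /andP[_ hs]; rewrite /fiber_sum divnMDl // divn_small // addn0 //.
Qed.

(** Rounding k to a multiple of 2 t costs a Lipschitz term. Without the rounding the first
    correlation depends on (P, k) only, and the sum over t passes to the other factor. *)
Lemma cut_corr_energy_le : cut_corr_energy <= \sum_(P : V) \sum_(0 <= k < 16 * N * H) `|fiber_avg P k| +
  16 * #|V|%:R * N%:R ^+ 3 * H%:R * cut_lip.
Proof.
rewrite cut_corr_energyE.
have h1 : forall t, (N <= t < 2 * N)%N ->
   \sum_(P : V) \sum_(0 <= k < 16 * N * H) (2 * t%:R)^-1 *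
    (cut_corr P (2 * t * (k %/ (2 * t)))%N * fiber_sum t P k) <=
   \sum_(P : V) \sum_(0 <= k < 16 * N * H) (2 * t%:R)^-1 *
    (cut_corr P k * fiber_sum t P k) + #|V|%:R * ((16 * N * H)%:R * (cut_lip * N%:R)).
  move=> t /andP[tN _].
  have t0 : 0 < 2 * t%:R :> R by rewrite -natrM ltr0n; lia.
  rewrite -[X in _ + X%:R * _]size_index_enum -sumr_const_seq -big_split /=.
  apply: ler_sum => P _.
  have hs : size (index_iota 0 (16 * N * H)) = (16 * N * H)%N.
    by rewrite size_iota subn0.
  rewrite -[X in _ + X%:R * _]hs -sumr_const_seq -big_split /=.
  apply: ler_sum => k _; rewrite -lerBlDl -mulrBr -mulrBl.
  apply: le_trans (ler_norm _) _; rewrite !normrM [X in X * _]ger0_norm; last first.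
    by rewrite invr_ge0 ltW.
  rewrite mulrCA mulrA; apply: ler_pM => //; last exact: fiber_sum_le.
    by rewrite mulr_ge0 // invr_ge0 ltW.
  rewrite ler_pdivrMr //; apply: le_trans (cut_corr_lip _ _ _) _.
  rewrite ler_wpM2l ?cut_lip_ge0 //.
  rewrite -natrM {2}(divn_eq k (2 * t)) natrD mulnC opprD addrA subrr add0r normrN.
  by rewrite ger0_norm // ler_nat ltnW // ltn_mod; lia.
apply: le_trans (ler_sum_nat h1) _.
rewrite big_split /= sumr_const_seq size_irange; apply: lerD; last first.
  by rewrite !natrM le_eqVlt; apply/orP; left; apply/eqP; ring.
rewrite exchange_big /=; apply: ler_sum => P _.
rewrite exchange_big /=; apply: ler_sum => k _.
rewrite (eq_bigr (fun t => cut_corr P k * ((2 * t%:R)^-1 * fiber_sum t P k))); last first.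
  by move=> t _; rewrite mulrCA.
rewrite -mulr_sumr -/(fiber_avg P k); apply: le_trans (ler_norm _) _; rewrite normrM.
by apply: le_trans (ler_wpM2r (normr_ge0 _) (cut_corr_le1 _ _)) _; rewrite mul1r.
Qed.

(** Third Cauchy-Schwarz, over (P, k). In the resulting square one of the two fibres contributes its
    step tau and the other its steps t and t'; together these form the path of three steps. *)
Lemma fiber_avg_sum_le : (\sum_(P : V) \sum_(0 <= k < 16 * N * H) `|fiber_avg P k|) ^+ 2 <=
  (#|V| * (16 * N * H))%:R * fiber_energy.
Proof.
apply: le_trans (sqr_sum_le _ _) _.
rewrite size_index_enum natrM -mulrA ler_wpM2l // mulr_sumr.
apply: ler_sum => P _; apply: le_trans (sqr_sum_le _ _) _.
rewrite size_iota subn0 ler_wpM2l //; apply: ler_sum => k _.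
by rewrite real_normK ?num_real.
Qed.

(** The lag arises as follows: k = 2 eta tau means h = k / (2 t) = eta tau / t for the step t, and
    this h gives the lag 2 t' h for the step t'. *)
Definition path_avg (tau : nat) P (eta : nat) := \sum_(N <= t < 2 * N) (2 * t%:R)^-1 *
  \sum_(N <= t' < 2 * N)
     cut_corr (P + (pvec tau + pdiff t t')) ((2 * eta * tau * t') %/ t)%N.
Definition path_sum P eta := \sum_(N <= tau < 2 * N) path_avg tau P eta.

(** Without rounding, the first number exceeds the second by t' s / t < 8 N. The inner rounding
    lowers the first by less than 2 t' < 4 N, the outer one lowers the second by less than 1. *)
Lemma floor_close (tau eta s t t' : nat) : (N <= t < 2 * N)%N ->
  (N <= t' < 2 * N)%N -> (N <= tau < 2 * N)%N -> (s < 2 * tau)%N ->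
  `|(2 * t' * ((eta * (2 * tau) + s) %/ (2 * t)))%N%:R -
    ((2 * eta * tau * t') %/ t)%N%:R| <= 9 * N%:R :> R.
Proof.
move=> /andP[tN tN2] /andP[tN' tN2'] /andP[uN uN2] su.
have t0 : (0 < t)%N by lia. have t20 : (0 < 2 * t)%N by lia.
have e1' := divn_eq (eta * (2 * tau) + s) (2 * t).
have e2' := divn_eq (2 * eta * tau * t') t.
have m1 := ltn_pmod (eta * (2 * tau) + s) t20.
have m2 := ltn_pmod (2 * eta * tau * t') t0.
move: e1' e2' m1 m2.
set b := (_ %/ _)%N; set r := (_ %% _)%N; set c := (_ %/ _)%N; set r2 := (_ %% _)%N.
move=> E1 E2 m1 m2.
have E3 : (2 * t' * b * t + t' * r + r2 = c * t + r2 + r2 + t' * s)%N by nia.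
have k1 : (2 * t' * b <= c + 9 * N)%N.
  have : (2 * t' * b * t <= (c + 9 * N) * t)%N by nia.
  by rewrite leq_mul2r; lia.
have k2 : (c <= 2 * t' * b + 9 * N)%N.
  have : (c * t <= (2 * t' * b + 9 * N) * t)%N by nia.
  by rewrite leq_mul2r; lia.
move: k1; rewrite -(ler_nat R) natrD (natrM _ 9) => k1.
move: k2; rewrite -(ler_nat R) natrD (natrM _ 9) => k2.
by rewrite ler_norml; lra.
Qed.

Lemma fiber_avg_close tau P eta s : (N <= tau < 2 * N)%N -> (s < 2 * tau)%N ->
  `|fiber_avg (P + pvec tau) (eta * (2 * tau) + s)%N - path_avg tau P eta| <=
   9 / 2 * N%:R ^+ 2 * cut_lip.
Proof.
move=> ht hs; have n0 : 0 < N%:R :> R by rewrite ltr0n.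
have -> : 9 / 2 * N%:R ^+ 2 * cut_lip =
    N%:R * ((2 * N%:R)^-1 * (N%:R * (cut_lip * (9 * N%:R)))) :> R.
  by field; rewrite gt_eqF.
rewrite -[X in X%:R * _](size_irange N); apply: ler_dist_sum_const => t.
rewrite mem_index_iota => ht'.
have t0 : 0 < t%:R :> R by rewrite ltr0n; lia.
rewrite -mulrBr normrM ger0_norm ?invr_ge0 ?mulr_ge0 //; apply: ler_pM => //.
- by rewrite invr_ge0 mulr_ge0.
- rewrite lef_pV2 ?posrE ?mulr_gt0 // ler_pM2l // ler_nat; lia.
rewrite -[X in X%:R * _](size_irange N); apply: ler_dist_sum_const => t'.
rewrite mem_index_iota => ht''; rewrite -addrA.
apply: le_trans (cut_corr_lip _ _ _) _; rewrite ler_wpM2l ?cut_lip_ge0 //.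
exact: floor_close.
Qed.

(** After the translation by [pvec tau], the correlation of the first fibre sits at [P + pvec tau']
    with lag 2 tau' eta, free of tau. It stands outside the sum over tau and is bounded by 1. *)
Lemma fiber_energy_le : fiber_energy <= N%:R * \sum_(P : V) \sum_(0 <= eta < 4 * H) `|path_sum P eta| +
   18 * #|V|%:R * N%:R ^+ 4 * H%:R * cut_lip.
Proof.
have -> : fiber_energy = \sum_(N <= tau < 2 * N) \sum_(P : V) \sum_(N <= tau' < 2 * N)
   \sum_(0 <= k < 16 * N * H) (2 * tau%:R)^-1 *
    (cut_corr (P + pvec tau') (2 * tau' * (k %/ (2 * tau)))%N * fiber_avg (P + pvec tau) k).
  rewrite /fiber_energy.
  under eq_bigr => P _ do under eq_bigr => k _ do
    rewrite expr2 {1}/fiber_avg mulr_suml.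
  under eq_bigr => P _ do rewrite exchange_big /=.
  rewrite exchange_big /=; apply: eq_bigr => tau _.
  rewrite -[LHS](sum_translate (pvec tau)); apply: eq_bigr => P _.
  rewrite [RHS]exchange_big /=; apply: eq_bigr => k _.
  rewrite -mulr_sumr -mulrA -mulr_suml; congr (_ * (_ * _)).
  apply: eq_bigr => tau' _; congr (cut_corr (_) _).
  by rewrite /pvec /pdiff addptA; congr (_ + pt _ _); ring.
have -> : N%:R * (\sum_(P : V) \sum_(0 <= eta < 4 * H) `|path_sum P eta|) +
   18 * #|V|%:R * N%:R ^+ 4 * H%:R * cut_lip =
   \sum_(N <= tau' < 2 * N) ((\sum_(P : V) \sum_(0 <= eta < 4 * H) `|path_sum P eta|) +
     #|V|%:R * ((4 * H)%:R * (N%:R * (9 / 2 * N%:R ^+ 2 * cut_lip)))).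
  by rewrite sumr_const_seq size_irange natrM; field.
rewrite [leLHS](eq_bigr _ (fun tau _ => exchange_big _ _ _ _ _ _)) /=.
rewrite exchange_big /=; apply: ler_sum_nat => tau' ht'.
rewrite exchange_big /= -size_index_enum -sumr_const_seq -big_split /=.
apply: ler_sum => P _.
have hs : size (index_iota 0 (4 * H)) = (4 * H)%N by rewrite size_iota subn0.
rewrite -[X in _ + X%:R * _]hs -sumr_const_seq -big_split /=.
rewrite (eq_big_nat _ _ (F2 := fun tau => \sum_(0 <= eta < 4 * H)
    \sum_(0 <= s < 2 * tau) (2 * tau%:R)^-1 * (cut_corr (P + pvec tau') (2 * tau' * eta)%N *
      fiber_avg (P + pvec tau) (eta * (2 * tau) + s)%N))); last first.
  move=> tau htau; have t0 : (0 < 2 * tau)%N by lia.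
  rewrite (@sum_divn_block _ (16 * N * H) (4 * H) (2 * tau)); last 2 first.
  - nia.
  - move=> k hk; rewrite cut_corr_eq0 ?mul0r ?mulr0 //.
    have := leq_div2r (2 * tau) hk; rewrite mulnK // => hk'; nia.
  apply: eq_bigr => eta _; apply: eq_big_nat => s /andP[_ hs'].
  by rewrite divnMDl // divn_small // addn0.
rewrite exchange_big /=; apply: ler_sum => eta _.
have h1 : forall tau, (N <= tau < 2 * N)%N ->
  \sum_(0 <= s < 2 * tau) (2 * tau%:R)^-1 * (cut_corr (P + pvec tau') (2 * tau' * eta)%N *
      fiber_avg (P + pvec tau) (eta * (2 * tau) + s)%N) <=
   cut_corr (P + pvec tau') (2 * tau' * eta)%N * path_avg tau P eta + 9 / 2 * N%:R ^+ 2 * cut_lip.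
  move=> tau htau; have t0 : 0 < 2 * tau%:R :> R by rewrite -natrM ltr0n; lia.
  rewrite -mulr_sumr mulrC ler_pdivrMr //.
  have -> : 2 * tau%:R = (size (index_iota 0 (2 * tau)))%:R :> R.
    by rewrite size_iota subn0 natrM.
  rewrite [leRHS]mulrC; apply: ler_sum_const => s; rewrite mem_index_iota => /andP[_ hs'].
  rewrite -lerBlDl -mulrBr; apply: le_trans (ler_norm _) _; rewrite normrM.
  apply: le_trans (ler_wpM2r (normr_ge0 _) (cut_corr_le1 _ _)) _; rewrite mul1r.
  exact: fiber_avg_close.
apply: le_trans (ler_sum_nat h1) _.
rewrite big_split /= sumr_const_seq size_irange lerD2r -mulr_sumr -/(path_sum P eta).
apply: le_trans (ler_norm _) _; rewrite normrM.
by apply: le_trans (ler_wpM2r (normr_ge0 _) (cut_corr_le1 _ _)) _; rewrite mul1r.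
Qed.

End CauchySchwarz.

(** * Cancellation along hyperbolas *)

Section IntSums.
Context {R : realFieldType}.

Definition zrange (a : int) (n : nat) : seq int := [seq a + i%:Z | i <- iota 0 n].

Lemma mem_zrange a n x : (x \in zrange a n) = (a <= x < a + n%:Z).
Proof.
apply/mapP/idP => [[i]|/andP[h1 h2]].
  by rewrite mem_iota => ? ->; lia.
by exists `|x - a|%N; [rewrite mem_iota; lia | lia].
Qed.

Lemma zrange_uniq a n : uniq (zrange a n).
Proof. by rewrite map_inj_uniq ?iota_uniq // => i j /addrI[]. Qed.

Lemma size_zrange a n : size (zrange a n) = n.
Proof. by rewrite size_map size_iota. Qed.

Lemma sum_zrangeE a n (F : int -> R) :
  \sum_(x <- zrange a n) F x = \sum_(0 <= i < n) F (a + i%:Z).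
Proof. by rewrite big_map /index_iota subn0. Qed.

Lemma sum_support (T : eqType) (r1 r2 : seq T) (F : T -> R) :
  uniq r1 -> uniq r2 ->
  (forall x, x \in r1 -> F x != 0 -> x \in r2) ->
  (forall x, x \in r2 -> F x != 0 -> x \in r1) ->
  \sum_(x <- r1) F x = \sum_(x <- r2) F x.
Proof.
move=> u1 u2 h12 h21.
rewrite (bigID (fun x => F x != 0)) [RHS](bigID (fun x => F x != 0)) /=.
rewrite [X in _ + X]big1 ?[X in _ = _ + X]big1 ?addr0; try by move=> x /negbNE /eqP.
rewrite -big_filter -[RHS]big_filter; apply: perm_big.
apply: uniq_perm; rewrite ?filter_uniq // => x; rewrite !mem_filter.
by case e : (F x != 0) => //=; apply/idP/idP => h; [apply: h12|apply: h21].
Qed.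

Lemma sum_reindex_int (T : eqType) (r1 : seq T) (r2 : seq int) (h : T -> int)
    (F : int -> R) : uniq r1 -> uniq r2 -> injective h ->
  (forall x, x \in r1 -> F (h x) != 0 -> h x \in r2) ->
  (forall y, y \in r2 -> F y != 0 -> exists2 x, x \in r1 & y = h x) ->
  \sum_(x <- r1) F (h x) = \sum_(y <- r2) F y.
Proof.
move=> u1 u2 ih h12 h21; rewrite -(big_map h xpredT F); apply: sum_support => //.
- by rewrite map_inj_uniq.
- by move=> y /mapP[x xr ->] /h12; apply.
- by move=> y yr /(h21 _ yr)[x xr ->]; apply: map_f.
Qed.

Lemma count_int_le (r : seq int) (a : int) (b : nat) : uniq r ->
  \sum_(z <- r) (`|z - a| <= b%:Z)%R%:R <= (2 * b + 1)%:R :> R.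
Proof.
move=> ur.
have -> : \sum_(z <- r) (`|z - a| <= b%:Z)%R%:R =
    \sum_(z <- [seq z <- r | `|z - a| <= b%:Z]) (1 : R).
  rewrite big_filter [RHS]big_mkcond /=; apply: eq_bigr => z _; by case: ifP.
rewrite sumr_const_seq mulr1 ler_nat -(size_zrange (a - b%:Z) (2 * b + 1)).
apply: uniq_leq_size; first by rewrite filter_uniq.
by move=> z; rewrite mem_filter mem_zrange => /andP[h _]; lia.
Qed.

(** Every q is the quotient by p of exactly |p| integers z. Trading q for z, which is close to p q,
    allows p to vary while z is fixed, that is, along a hyperbola. *)
Lemma sum_divz (N : nat) (p : int) (psi : int -> R) : p != 0 -> `|p| <= N%:Z ->
  (forall q : int, psi q != 0 -> `|q| < N%:Z) ->
  `|p|%:~R * \sum_(q <- zrange (- N%:Z) (2 * N)) psi q =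
  \sum_(z <- zrange (- (N ^ 2)%N%:Z) (2 * N ^ 2)) psi (z %/ p)%Z.
Proof.
move=> p0 pN hpsi.
rewrite [RHS](eq_bigr (fun z => \sum_(q <- zrange (- N%:Z) (2 * N))
   ((z %/ p)%Z == q)%R%:R * psi q)); last first.
  move=> z _; case e : (psi (z %/ p)%Z == 0).
    rewrite big1 ?(eqP e) // => q _; case: eqP => [<-|_]; last by rewrite mul0r.
    by rewrite (eqP e) mulr0.
  have hin : (z %/ p)%Z \in zrange (- N%:Z) (2 * N).
    by have := hpsi _ (negbT e); rewrite mem_zrange; lia.
  rewrite (bigD1_seq _ hin (zrange_uniq _ _)) /= eqxx mul1r big1 ?addr0 // => q.
  by rewrite eq_sym => /negbTE ->; rewrite mul0r.
rewrite exchange_big /= mulr_sumr; apply: eq_bigr => q _.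
rewrite -mulr_suml; case: (eqVneq (psi q) 0) => [->|nz]; first by rewrite !mulr0.
congr (_ * _); have qN := hpsi _ nz.
have -> : `|p|%:~R = \sum_(z <- zrange (q * p) `|p|%N) ((z %/ p)%Z == q)%R%:R :> R.
  rewrite sum_zrangeE (eq_big_nat _ _ (F2 := fun=> 1)).
    rewrite sumr_const_seq size_iota subn0 mulr1 -abszE; by rewrite pmulrn.
  move=> i /andP[_ hi]; rewrite divzMDl // divz_small ?addr0 ?eqxx //; lia.
apply: sum_support; rewrite ?zrange_uniq // => z; rewrite !mem_zrange.
  by move=> hz _; nia.
move=> hz; case: (eqVneq (z %/ p)%Z q) => [e _|_]; last by rewrite eqxx.
have := divz_eq z p; rewrite e; have := modz_ge0 z p0; have := ltz_mod z p0; lia.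
Qed.

End IntSums.

(** * Linearisation of the lag along a hyperbola *)

Section RealEstimates.
Context {R : realFieldType}.
Implicit Types (x y z u p q t : R).

Lemma norm_div_le x y b : 0 < y -> `|x| <= b * y -> `|x / y| <= b.
Proof. by move=> y0 h; rewrite normf_div (gtr0_norm y0) ler_pdivrMr. Qed.

Lemma sqr_ge4 x : 2 <= x -> 4 <= x ^+ 2.
Proof. by move=> h; rewrite expr2; nra. Qed.

Lemma sqr_ge1D x : 2 <= x -> 1 + x <= x ^+ 2.
Proof. by move=> h; rewrite expr2; nra. Qed.

Lemma cube_ge8 x : 2 <= x -> 8 <= x ^+ 3.
Proof. by move=> h; have := sqr_ge4 h; rewrite [x ^+ 3]exprS; move: (x ^+ 2) => y; nra. Qed.

(** The letters n, m, d, h stand for the N, M, D, H of the sections below. For fixed z, the point p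
    = p0 + i runs through a window of length m; u = z / p is its real partner on the hyperbola, and
    q an integer within 1 of u. The middle step of the path is t, and [tr] is the same step computed
    with u in place of q. *)
Variables (n m d h Q eta X p0 z : R).
Hypotheses (Q2 : 2 <= Q) (m1 : 1 <= m) (nQd : n = Q * d) (mQd : m * Q ^+ 3 <= d).
Hypotheses (eta0 : 0 <= eta) (etah : eta <= 4 * h).
Hypotheses (p0d : 2 * d <= `|p0|) (p0n : `|p0| <= n).
Let u0 := z / p0.
Let t0 := X + p0 - u0.
Hypotheses (u0n : `|u0| <= n) (t0n : n <= t0 <= 2 * n).
Variables (i : R).
Hypotheses (i0 : 0 <= i) (im : i <= m).
Let p := p0 + i.
Let u := z / p.
Let tr := X + p - u.
Variables (q : R).
Hypothesis (uq : `|u - q| <= 1).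
Let t := X + p - q.
Hypothesis (tn : n <= t <= 2 * n).
Hypothesis (pn : `|p| <= n).

Hypothesis (d16 : 16 <= d).

Local Ltac slra :=
  move: Q2 m1 mQd eta0 etah p0d p0n u0n t0n i0 im uq tn pn d16;
  do 15!(move=> ?); lra.

Let Q0 : 0 < Q. Proof. slra. Qed.
Let m0 : 0 < m. Proof. slra. Qed.
Let d0 : 0 < d. Proof. slra. Qed.
Let h0 : 0 <= h. Proof. slra. Qed.
Let n0 : 0 < n. Proof. by rewrite nQd mulr_gt0. Qed.
Let Qn : 0 <= Q := ltW Q0.
Let mn : 0 <= m := ltW m0.
Let dn : 0 <= d := ltW d0.
Let nn : 0 <= n := ltW n0.
Local Hint Resolve Q0 m0 d0 h0 n0 Qn mn dn nn : core.

Lemma est_md : m <= d / 8.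
Proof.
rewrite ler_pdivlMr //; apply: le_trans mQd; rewrite ler_wpM2l //.
exact: cube_ge8.
Qed.

Lemma est_pd : d <= `|p|.
Proof.
have := est_md; have := ler_normB p i; rewrite /p addrK (ger0_norm i0); slra.
Qed.

Lemma p0_neq0 : p0 != 0.
Proof. by rewrite -normr_gt0; slra. Qed.

Lemma p_neq0 : p != 0.
Proof. by rewrite -normr_gt0; have := est_pd; slra. Qed.

Lemma est_a : `| `|p0| / `|p| - 1| <= m / d.
Proof.
have pp : 0 < `|p| by rewrite normr_gt0 p_neq0.
have -> : `|p0| / `|p| - 1 = (`|p0| - `|p|) / `|p| by field; rewrite gt_eqF.
apply: norm_div_le => //.
have : `| `|p0| - `|p| | <= m.
  apply: le_trans (ler_dist_dist _ _) _.
  by rewrite /p opprD addrA subrr add0r normrN ger0_norm.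
move=> hm; apply: le_trans hm _; rewrite mulrAC ler_pdivlMr; last slra.
by rewrite ler_wpM2l ?est_pd //; slra.
Qed.

Lemma est_u : `|u - u0| <= m * Q.
Proof.
have -> : u - u0 = u0 * (- i) / p.
  rewrite /u /u0 /p; field; rewrite -/p p_neq0 p0_neq0 //.
rewrite normrM normfV ler_pdivrMr ?normr_gt0 ?p_neq0 // normrM normrN (ger0_norm i0).
apply: (@le_trans _ _ (n * m)); first by apply: ler_pM.
rewrite nQd (_ : Q * d * m = m * Q * d); last by ring.
by rewrite ler_wpM2l ?est_pd // mulr_ge0 //; slra.
Qed.

Lemma est_b : `|t0 / t - 1| <= 3 * (m * Q) / n.
Proof.
have t00 : 0 < t by slra.
have -> : t0 / t - 1 = (t0 - t) / t by field; rewrite gt_eqF.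
apply: norm_div_le => //.
have : `|t0 - t| <= 3 * (m * Q).
  have -> : t0 - t = - i + ((u - u0) - (u - q)) by rewrite /t0 /t /p; ring.
  apply: le_trans (ler_normD _ _) _; rewrite normrN (ger0_norm i0).
  have := ler_normB (u - u0) (u - q); have := est_u; have : m * 2 <= m * Q by rewrite ler_wpM2l //; slra.
  slra.
move=> hm; apply: le_trans hm _; rewrite mulrAC ler_pdivlMr //.
by rewrite ler_wpM2l ?mulr_ge0 //; slra.
Qed.

Lemma est_z : `|z| <= n ^+ 2.
Proof.
have -> : z = p0 * u0 by rewrite /u0 mulrC divfK // p0_neq0.
by rewrite normrM expr2; apply: ler_pM.
Qed.

Lemma est_tr : n / 2 <= tr.
Proof.
have -> : tr = t - (u - q) by rewrite /tr /t; ring.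
have := ler_norm (u - q); have : 2 * 16 <= n by rewrite nQd; apply: ler_pM; slra.
slra.
Qed.

Lemma est_L1 : `|z / tr - p * q / t| <= 3.
Proof.
have htr := est_tr.
have t00 : 0 < t by slra. have tr0 : 0 < tr by slra.
have -> : z / tr - p * q / t = (z - p * q) / t + z * (u - q) / (tr * t).
  have -> : u - q = t - tr by rewrite /tr /t; ring.
  by field; rewrite !gt_eqF.
have -> : z - p * q = p * (u - q) by rewrite mulrBr /u mulrCA divff ?mulr1 // p_neq0.
apply: le_trans (ler_normD _ _) _.
have a1 : `|p * (u - q) / t| <= 1.
  apply: norm_div_le => //; rewrite normrM mul1r -[leRHS]mulr1.
  by apply: ler_pM => //; slra.
have a2 : `|z * (u - q) / (tr * t)| <= 2.
  apply: norm_div_le; first exact: mulr_gt0.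
  apply: (@le_trans _ _ (n ^+ 2 * 1)).
    by rewrite normrM; apply: ler_pM => //; exact: est_z.
  rewrite mulr1; have -> : n ^+ 2 = 2 * (n / 2 * n) by field.
  by rewrite ler_wpM2l //; apply: ler_pM => //; slra.
slra.
Qed.

Lemma est_tt0 : `|tr - t0| <= m * Q ^+ 2.
Proof.
have -> : tr - t0 = i - (u - u0) by rewrite /tr /t0 /p; ring.
apply: le_trans (ler_normB _ _) _; rewrite (ger0_norm i0).
have := est_u; have : m + m * Q <= m * Q ^+ 2.
  rewrite -{1}(mulr1 m) -mulrDr; apply: ler_wpM2l; [slra|exact: (sqr_ge1D Q2)].
slra.
Qed.

(** [L] is the lag at p computed with the real partner, [L0] its value at p0, and [cr] its
    derivative in p at p0, since X + p - z / p has derivative 1 + z / p^2. *)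
Let L := 2 * eta * X - 2 * eta * z / tr.
Let L0 := 2 * eta * X - 2 * eta * z / t0.
Let cr := 2 * eta * z * (1 + z / p0 ^+ 2) / t0 ^+ 2.

Lemma est_mu : `|(2 * eta * X - 2 * eta * (p * q / t)) - L| <= 24 * h.
Proof.
have -> : (2 * eta * X - 2 * eta * (p * q / t)) - L =
   2 * eta * (z / tr - p * q / t) by rewrite /L; ring.
rewrite normrM ger0_norm; last slra.
have -> : 24 * h = 8 * h * 3 by ring.
by apply: ler_pM; rewrite ?est_L1 //; slra.
Qed.

Lemma est_LL0 : `|L - L0| <= 16 * h * (m * Q ^+ 2).
Proof.
have htr := est_tr.
have t00 : 0 < t0 by slra. have tr0 : 0 < tr by slra.
have -> : L - L0 = (2 * eta) * (z * (tr - t0) / (t0 * tr)).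
  by rewrite /L /L0; field; rewrite !gt_eqF.
rewrite normrM ger0_norm; last slra.
have a2 : `|z * (tr - t0) / (t0 * tr)| <= 2 * (m * Q ^+ 2).
  apply: norm_div_le; first exact: mulr_gt0.
  apply: (@le_trans _ _ (n ^+ 2 * (m * Q ^+ 2))).
    rewrite normrM; apply: ler_pM => //; [exact: est_z | exact: est_tt0].
  have k1 : 0 <= m * Q ^+ 2 by apply: le_trans est_tt0.
  rewrite [leRHS]mulrAC; apply: ler_wpM2r => //.
  have -> : n ^+ 2 = 2 * (n * (n / 2)) by field.
  by rewrite ler_wpM2l //; apply: ler_pM => //; slra.
have -> : 16 * h * (m * Q ^+ 2) = 8 * h * (2 * (m * Q ^+ 2)) by ring.
by apply: ler_pM => //; slra.
Qed.

(** The difference quotient of [L] between p0 and p is compared with [cr] by exact identities: in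
    the proof [A] accounts for one factor t0 in place of tr, and [B] for one factor p0 in place of
    p. *)
Lemma est_L2 : `|L - L0 - i * cr| <= 24 * h * m ^+ 2 * Q ^+ 4 / n.
Proof.
have htr := est_tr.
have t00 : 0 < t0 by slra. have tr0 : 0 < tr by slra.
have p00 := p0_neq0; have pp := p_neq0.
pose A := (1 + z / (p * p0)) * (t0 - tr) / (t0 * tr).
pose B := z / (p * p0) - z / p0 ^+ 2.
have e1 : tr - t0 = i * (1 + z / (p * p0)).
  rewrite /tr /t0 /u /u0 /p; field; rewrite -/p pp p00 //.
have -> : L - L0 - i * cr = 2 * eta * (z * (i * ((A + B / t0) / t0))).
  rewrite /L /L0 /cr /A /B.
  have -> : 2 * eta * X - 2 * eta * z / tr - (2 * eta * X - 2 * eta * z / t0) =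
     2 * eta * z * (tr - t0) / (t0 * tr) by field; rewrite !gt_eqF.
  rewrite {1}e1; field; rewrite pp p00 !gt_eqF //.
have hQ : `|1 + z / (p * p0)| <= Q ^+ 2.
  apply: le_trans (ler_normD _ _) _; rewrite normr1.
  have : `|z / (p * p0)| <= Q ^+ 2 / 2.
    rewrite normrM normfV normrM ler_pdivrMr; last by rewrite mulr_gt0 ?normr_gt0.
    apply: le_trans est_z _; rewrite nQd.
    have -> : (Q * d) ^+ 2 = Q ^+ 2 / 2 * (d * (2 * d)) by field.
    rewrite ler_wpM2l //; first by rewrite divr_ge0 // exprn_ge0; slra.
    by apply: ler_pM => //; [slra | exact: est_pd].
  have := sqr_ge4 Q2; slra.
have hA : `|A| <= 2 * (m * Q ^+ 4) / n ^+ 2.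
  rewrite /A; apply: norm_div_le; first exact: mulr_gt0.
  rewrite normrM distrC.
  apply: (@le_trans _ _ (Q ^+ 2 * (m * Q ^+ 2))).
    by apply: ler_pM => //; exact: est_tt0.
  rewrite [leRHS]mulrAC ler_pdivlMr ?exprn_gt0 //.
  have -> : Q ^+ 2 * (m * Q ^+ 2) * n ^+ 2 = m * Q ^+ 4 * n ^+ 2 by ring.
  have -> : 2 * (m * Q ^+ 4) * (t0 * tr) = m * Q ^+ 4 * (2 * (t0 * tr)) by ring.
  rewrite ler_wpM2l //.
    by rewrite mulr_ge0 ?exprn_ge0.
  have -> : n ^+ 2 = 2 * (n * (n / 2)) by field.
  by rewrite ler_wpM2l //; apply: ler_pM => //; slra.
have hB : `|B| <= m * Q ^+ 3 / n.
  have -> : B = - (z * i) / (p * p0 ^+ 2) by rewrite /B /p; field; rewrite -/p pp p00.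
  rewrite normrM normfV normrM normrX normrN normrM (ger0_norm i0).
  have dp : d ^+ 3 <= `|p| * `|p0| ^+ 2.
    rewrite exprS; apply: ler_pM; rewrite ?exprn_ge0 ?est_pd //.
    by rewrite lerXn2r ?nnegrE // (le_trans _ p0d) // mulr_natl mulr2n lerDl.
  have d30 : 0 < d ^+ 3 by rewrite exprn_gt0.
  rewrite ler_pdivrMr; last slra.
  apply: (@le_trans _ _ (n ^+ 2 * m)); first by apply: ler_pM => //; exact: est_z.
  apply: (@le_trans _ _ (m * Q ^+ 3 / n * d ^+ 3)).
    rewrite le_eqVlt; apply/orP; left; apply/eqP; rewrite nQd; field.
    by rewrite !gt_eqF.
  by rewrite ler_wpM2l // divr_ge0 ?mulr_ge0 ?exprn_ge0.
have hAB : `|(A + B / t0) / t0| <= 3 * (m * Q ^+ 4) / n ^+ 3.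
  apply: norm_div_le => //; apply: le_trans (ler_normD _ _) _.
  have h4 : `|B / t0| <= m * Q ^+ 4 / n ^+ 2.
    apply: norm_div_le => //; apply: le_trans hB _.
    have -> : m * Q ^+ 3 / n = m * Q ^+ 3 / n ^+ 2 * n by field; rewrite gt_eqF.
    apply: ler_pM => //; last slra.
      by rewrite !(divr_ge0, mulr_ge0, exprn_ge0).
    rewrite ler_wpM2r ?invr_ge0 ?exprn_ge0 //.
    rewrite ler_wpM2l //.
    by rewrite [leRHS]exprS ler_peMl ?exprn_ge0 // (le_trans _ Q2) ?ler1n.
  apply: (@le_trans _ _ (3 * (m * Q ^+ 4) / n ^+ 3 * n)).
    have -> : 3 * (m * Q ^+ 4) / n ^+ 3 * n =
      2 * (m * Q ^+ 4) / n ^+ 2 + m * Q ^+ 4 / n ^+ 2 by field; rewrite gt_eqF.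
    exact: lerD.
  rewrite ler_wpM2l //; last by have /andP[] := t0n.
  by rewrite !(divr_ge0, mulr_ge0, exprn_ge0).
rewrite normrM (ger0_norm (_ : 0 <= 2 * eta)) ?mulr_ge0 // normrM.
rewrite (normrM i) (ger0_norm i0).
have -> : 24 * h * m ^+ 2 * Q ^+ 4 / n =
   (2 * (4 * h)) * (n ^+ 2 * (m * (3 * (m * Q ^+ 4) / n ^+ 3))).
  by field; rewrite gt_eqF.
apply: ler_pM; rewrite ?mulr_ge0 //; first by rewrite ler_pM2l.
apply: ler_pM; rewrite ?mulr_ge0 ?est_z //.
by apply: ler_pM; rewrite ?mulr_ge0.
Qed.

Hypotheses (h1 : 1 <= h) (nQ2 : Q ^+ 2 <= n).

Lemma est_rho : m / d <= Q ^- 2 / 2 /\ m * Q ^+ 2 / n <= Q ^- 2.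
Proof.
have hm := mQd.
split.
  rewrite ler_pdivrMr // (_ : Q ^- 2 / 2 * d = d / (2 * Q ^+ 2)); last by field; rewrite gt_eqF.
  rewrite ler_pdivlMr; last by rewrite mulr_gt0 // exprn_gt0.
  apply: le_trans hm; rewrite ler_wpM2l //.
  by rewrite [leRHS]exprS ler_wpM2r ?exprn_ge0 //; have := Q2; lra.
rewrite ler_pdivrMr // nQd (_ : Q ^- 2 * (Q * d) = d / Q); last by field; rewrite gt_eqF.
rewrite ler_pdivlMr // -mulrA -exprSr; exact: hm.
Qed.

Lemma est_ab : `| `|p0| / `|p| - 1| <= Q ^- 2 /\ `|t0 / t - 1| <= 2 * Q ^- 2.
Proof.
have [r1 r2] := est_rho.
have r0 : 0 <= Q ^- 2 by rewrite invr_ge0 exprn_ge0; slra.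
split; first by apply: le_trans est_a _; lra.
apply: le_trans est_b _.
have -> : 3 * (m * Q) / n = 3 * (m / d).
  by rewrite nQd; field; apply/andP; split; rewrite gt_eqF; slra.
lra.
Qed.

(** Two precisions are needed. The cutoff varies at the scale 4 n h only, so that the lag may be
    frozen at [L0]; the correlated function varies at a much smaller scale and requires the linear
    approximation. *)
Lemma est_lag (lag : R) : `|lag - (2 * eta * X - 2 * eta * (p * q / t))| <= 1 ->
  `|cutoff (lag / (4 * n * h)) - cutoff (L0 / (4 * n * h))| <= 11 * Q ^- 2 /\
  `|lag - (L0 + i * cr)| <= 1 + 24 * h + 24 * h * m ^+ 2 * Q ^+ 4 / n.
Proof.
move=> hm; have e1 := est_mu; have [r1 r2] := est_rho.
have h0' : 0 < h by have := h1; lra.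
move: hm e1; set mu := (_ - _ * (p * q / t)) => hm e1.
split; last first.
  have -> : lag - (L0 + i * cr) = (lag - mu) + (mu - L) + (L - L0 - i * cr) by ring.
  apply: le_trans (ler_normD _ _) _; apply: lerD est_L2.
  by apply: le_trans (ler_normD _ _) _; apply: lerD.
apply: le_trans (cutoff_lip _ _) _; rewrite -mulrBl.
apply: norm_div_le; first by rewrite !mulr_gt0.
have -> : lag - L0 = (lag - mu) + (mu - L) + (L - L0) by ring.
apply: (@le_trans _ _ (1 + 24 * h + 16 * h * (m * Q ^+ 2))).
  apply: le_trans (ler_normD _ _) _; apply: lerD est_LL0.
  by apply: le_trans (ler_normD _ _) _; apply: lerD.
have k1 : 1 <= Q ^- 2 * n.
  by rewrite mulrC ler_pdivlMr ?mul1r //; rewrite exprn_gt0.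
have k2 : m * Q ^+ 2 <= Q ^- 2 * n by move: r2; rewrite ler_pdivrMr.
have -> : 11 * Q ^- 2 * (4 * n * h) = h * (44 * (Q ^- 2 * n)) by ring.
have -> : 1 + 24 * h + 16 * h * (m * Q ^+ 2) = 1 + h * (24 + 16 * (m * Q ^+ 2)) by ring.
apply: (@le_trans _ _ (h + h * (24 + 16 * (m * Q ^+ 2)))).
  by rewrite lerD2r.
rewrite -{1}(mulr1 h) -mulrDr ler_wpM2l //.
lra.
Qed.

End RealEstimates.

(** * The sum over a single window *)

Section Window.
Context {R : archiRealFieldType}.
Variables (gam : int -> R) (lam W c : R) (N M D H Q eta : nat) (X : int).
Hypothesis gam1 : forall y, `|gam y| <= 1.
Hypothesis gamL : forall y, `|gam (y + 1) - gam y| <= lam.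
Hypothesis gamW : forall y (S : nat), `|\sum_(0 <= s < S) gam (y + s%:Z)| <= W.

Lemma gam_lip y (j : nat) : `|gam (y + j%:Z) - gam y| <= lam * j%:R.
Proof.
elim: j => [|j ih]; first by rewrite addr0 subrr normr0 mulr0.
rewrite -addn1 PoszD addrA natrD mulrDr mulr1.
apply: le_trans (ler_distD (gam (y + j%:Z)) _ _) _.
by have := gamL (y + j%:Z); move: ih; lra.
Qed.

Lemma gam_lipZ y y' : `|gam y - gam y'| <= lam * `|y%:~R - y'%:~R|.
Proof.
wlog yy : y y' / y' <= y.
  move=> W'; case: (lerP y' y) => h; first exact: W'.
  by rewrite distrC (distrC y%:~R); apply: W'; apply: ltW.
have -> : y = y' + `|y - y'|%N%:Z by lia.
rewrite intrD addrAC subrr add0r.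
by apply: le_trans (gam_lip _ _) _; rewrite ger0_norm.
Qed.

Lemma lam0 : 0 <= lam.
Proof. exact: le_trans (normr_ge0 _) (gamL 0). Qed.

(** Each term of the progression, taken b times, is replaced by the sum over the b integers up to
    the next term, at a cost of b lam per integer. Together these integers fill an interval. *)
Lemma ap_sum_pos y (b : nat) (L : nat) : (0 < b)%N ->
  b%:R * `|\sum_(0 <= i < L) gam (y + (i * b)%N%:Z)| <=
  W + L%:R * b%:R * (b%:R * lam).
Proof.
move=> b0; rewrite -{1}(normr_nat R b) -normrM mulr_sumr.
have e : `|\sum_(0 <= i < L) b%:R * gam (y + (i * b)%N%:Z) -
   \sum_(0 <= j < L * b) gam (y + j%:Z)| <= L%:R * b%:R * (b%:R * lam).
  rewrite big_nat_mulr -mulrA.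
  have hs k : size (index_iota 0 k) = k by rewrite size_iota subn0.
  rewrite -{3}(hs L); apply: ler_dist_sum_const => i _.
  have -> : b%:R * gam (y + (i * b)%N%:Z) = \sum_(0 <= s < b) gam (y + (i * b)%N%:Z).
    by rewrite sumr_const_seq hs.
  rewrite -[X in X%:R * (_ * _)]hs; apply: ler_dist_sum_const => s.
  rewrite mem_index_iota => /andP[_ sb].
  rewrite distrC PoszD addrA; apply: le_trans (gam_lip _ _) _.
  by rewrite mulrC ler_wpM2r ?lam0 // ler_nat ltnW.
move: e; set A := \sum_(_ <= _ < L) _; set B := \sum_(_ <= _ < _) _ => e.
have := gamW y (L * b); rewrite -/B => w.
have := ler_normD (A - B) B; rewrite subrK; lra.
Qed.

Lemma ap_sum y (k : int) (L : nat) : k != 0 ->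
  `|k|%:~R * `|\sum_(0 <= i < L) gam (y + i%:Z * k)| <=
  W + L%:R * `|k|%:~R * (`|k|%:~R * lam).
Proof.
case: k => [b|b] k0.
  have b0 : (0 < b)%N by lia.
  have A := ap_sum_pos y L b0; rewrite (_ : `|Posz b| = b%:Z) //.
(* A progression with negative step is read backwards from its last term. *)
have A := ap_sum_pos (y + (L.-1)%:Z * Negz b) L (ltn0Sn b).
rewrite (_ : `|Negz b| = b.+1%:Z) //; move: A; rewrite big_nat_rev /=.
rewrite (eq_big_nat _ _ (F2 := fun i : nat => gam (y + i%:Z * Negz b))).
  by move=> A; exact: A.
move=> i /andP[_ iL]; congr gam; rewrite NegzE -addrA; congr (_ + _).
have -> : (0 + L - i.+1)%N = (L.-1 - i)%N by lia.
have : L.-1%:Z = i%:Z + (L.-1 - i)%N%:Z by lia.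
by move=> ->; rewrite PoszM; ring.
Qed.

Lemma divz_close (z p : int) : p != 0 ->
  `|z%:~R / p%:~R - (z %/ p)%Z%:~R| <= 1 :> R.
Proof.
move=> p0; have pR : (p%:~R : R) != 0 by rewrite intr_eq0.
have -> : z%:~R / p%:~R - (z %/ p)%Z%:~R = (z %% p)%Z%:~R / p%:~R :> R.
  by rewrite {1}(divz_eq z p) intrD intrM; field.
rewrite normrM normfV ler_pdivrMr ?normr_gt0 // mul1r -!intr_norm ler_int.
by have := modz_ge0 z p0; have := ltz_mod z p0; lia.
Qed.

(** The factors are exchanged one at a time. In the application [a] and [b] compare the weights 1 /
    |p| and 1 / t with their values at p0, [c'] is the cutoff, and [d] and [e] are the two values of
    the correlated function. *)
Lemma prod5 (a b c' d e c0 d0 E : R) : `|b| <= 2 -> `|c'| <= 1 -> `|d| <= 1 ->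
  `|e| <= 1 -> `|c0| <= 1 -> `|d0| <= 1 ->
  `|a * b * (c' * (d * e)) - c0 * (d0 * E)| <=
  2 * `|a - 1| + `|b - 1| + `|c' - c0| + `|d - d0| + `|e - E|.
Proof.
move=> hb hc hd he hc0 hd0.
have -> : a * b * (c' * (d * e)) - c0 * (d0 * E) =
   (a - 1) * b * (c' * (d * e)) + (b - 1) * (c' * (d * e)) + (c' - c0) * (d * e) +
   (d - d0) * (c0 * e) + (e - E) * (c0 * d0) by ring.
have B (x y k : R) : `|y| <= k -> `|x * y| <= `|x| * k.
  by move=> h; rewrite normrM ler_wpM2l.
have h1 : `|d * e| <= 1 by apply: norm_mul_le1.
have h2 : `|c' * (d * e)| <= 1 by apply: norm_mul_le1.
have k1 : `|(a - 1) * b * (c' * (d * e))| <= 2 * `|a - 1|.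
  rewrite -mulrA mulrC; rewrite -(mulrC `|a - 1|) mulrC; apply: B.
  by rewrite normrM -[2]mulr1; apply: ler_pM.
have k2 := B (b - 1) _ _ h2.
have k3 := B (c' - c0) _ _ h1.
have k4 : `|(d - d0) * (c0 * e)| <= `|d - d0| * 1 by apply: B; apply: norm_mul_le1.
have k5 : `|(e - E) * (c0 * d0)| <= `|e - E| * 1 by apply: B; apply: norm_mul_le1.
have tri (x1 x2 x3 x4 x5 : R) : `|x1 + x2 + x3 + x4 + x5| <=
    `|x1| + `|x2| + `|x3| + `|x4| + `|x5|.
  by do 3!(apply: le_trans (ler_normD _ _) _; rewrite lerD2r); apply: ler_normD.
apply: le_trans (tri _ _ _ _ _) _; move: k2 k3 k4 k5; rewrite !mulr1 => *.
by do !apply: lerD.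
Qed.

Lemma ratio_error (b r : R) : b <= 2 * r -> r <= 1 / 4 -> b + 1 <= 2.
Proof. by move=> h k; lra. Qed.

Lemma lag_error_sum (n h T : R) : h <= n -> 2 <= n ->
  2 * n + (1 + 24 * h + T) + 1 + n <= 28 * n + T.
Proof. by move=> h1 h2; lra. Qed.

Lemma term_error_sum (a b c' d e r s : R) : a <= r -> b <= 2 * r -> c' <= 11 * r ->
  d <= 2 * s -> e <= 52 * s -> r <= s -> 2 * a + b + c' + d + e <= 69 * s.
Proof. by move=> h1 h2 h3 h4 h5 h6; lra. Qed.

Definition in_win (x : int) : bool := (N%:Z <= x) && (x < (2 * N)%N%:Z).
(* Since [(X + p) (X - q) = X (X + p - q) - p q], the lag is [2 eta (X - p q / t)]
   up to rounding; along [p q = z] it is almost linear in [p] on short windows. *)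
Definition lag (p q : int) : int :=
  ((2 * eta%:Z * (X + p) * (X - q)) %/ (X + p - q))%Z.
(** The steps of the path are X + p, X + p - q and X - q, and [gam] is the restriction of g to the
    vertical line through its end point. *)
Definition path_term (p q : int) : R :=
  if [&& in_win (X + p), in_win (X + p - q) & in_win (X - q)] then
    (2 * (X + p - q)%:~R)^-1 *
      (cutoff ((lag p q)%:~R / cut_scale N H) * (gam (2 * p * q) * gam (2 * p * q + lag p q)))
  else 0.

Hypotheses (Q2 : (2 <= Q)%N) (M1 : (0 < M)%N) (NQ : N = (Q * D)%N).
Hypotheses (MQ : (M * Q ^ 3 <= D)%N) (D16 : (16 <= D)%N) (HN : (H <= N)%N).
Hypotheses (eta4 : (eta <= 4 * H)%N) (etaQ : (H <= Q * eta)%N).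
Hypotheses (HQ : (8 * Q ^ 3 <= H)%N) (QN : (Q ^ 2 <= N)%N).
Let rho : R := Q%:R ^- 2.
Hypotheses (c1 : 1 <= c) (lamN : lam * N%:R <= c * rho).
Hypotheses (lamH : lam * (H%:R * M%:R ^+ 2 * Q%:R ^+ 4) <= c * rho * N%:R).
Hypotheses (WQ : W * (4 * Q%:R ^+ 3) <= c * rho * (M%:R * H%:R)).

Lemma lag_close (p q : int) : (0 < X + p - q) ->
  `|(lag p q)%:~R - (2 * eta%:R * X%:~R - 2 * eta%:R * (p%:~R * q%:~R /
     (X%:~R + p%:~R - q%:~R)))| <= 1 :> R.
Proof.
move=> t0; have tn : X + p - q != 0 by clear -t0; lia.
have := divz_close (2 * eta%:Z * (X + p) * (X - q)) tn; rewrite distrC /lag.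
have tR : ((X + p - q)%:~R : R) != 0 by rewrite intr_eq0.
suff -> : (2 * eta%:Z * (X + p) * (X - q))%:~R / (X + p - q)%:~R =
  2 * eta%:R * X%:~R - 2 * eta%:R * (p%:~R * q%:~R /
     (X%:~R + p%:~R - q%:~R)) :> R by [].
move: tR; rewrite !(intrM, intrB, intrD) => tR.
by rewrite -[(eta%:Z)%:~R]/(eta%:R); field.
Qed.

Variables (p0 z : int).
Hypotheses (p0D : (2 * D)%N%:Z <= `|p0|) (p0N : - N%:Z <= p0) (p0N2 : p0 + M%:Z <= N%:Z).
Let u0 : R := z%:~R / p0%:~R.
Let t0 : R := X%:~R + p0%:~R - u0.
Hypotheses (u0D : D%:R <= `|u0|) (u0p : D%:R <= `|u0 + p0%:~R|).
Hypotheses (u0N : `|u0| <= N%:R) (t0N : N%:R <= t0 <= 2 * N%:R).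
Hypothesis allIN : forall i : nat, (i < M)%N ->
  [&& in_win (X + (p0 + i%:Z)), in_win (X + (p0 + i%:Z) - (z %/ (p0 + i%:Z))%Z) &
      in_win (X - (z %/ (p0 + i%:Z))%Z)].
Let n : R := N%:R.
Let h : R := H%:R.
Let L0 : R := 2 * eta%:R * X%:~R - 2 * eta%:R * z%:~R / t0.
Let cr : R := 2 * eta%:R * z%:~R * (1 + z%:~R / p0%:~R ^+ 2) / t0 ^+ 2.

Let Q0n : (0 < Q)%N := leq_trans (isT : (0 < 2)%N) Q2.
Let MD : (M <= D)%N.
Proof. by apply: leq_trans MQ; rewrite leq_pmulr // expn_gt0 Q0n. Qed.
Let p0nz : p0 != 0. Proof. by clear -p0D D16; lia. Qed.
Let Qr : 2 <= Q%:R :> R. Proof. by rewrite ler_nat. Qed.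
Let Mr : 1 <= M%:R :> R. Proof. by rewrite ler1n. Qed.
Let nr : n = Q%:R * D%:R. Proof. by rewrite /n NQ natrM. Qed.
Let MQr : M%:R * Q%:R ^+ 3 <= D%:R :> R. Proof. by rewrite -natrX -natrM ler_nat. Qed.
Let hr : eta%:R <= 4 * h. Proof. by rewrite /h -natrM ler_nat. Qed.
Let p0Dr : 2 * D%:R <= `|p0%:~R| :> R.
Proof. by rewrite -intr_norm -natrM pmulrn ler_int. Qed.
Let p0nr : `|p0%:~R| <= n.
Proof. by rewrite -intr_norm /n pmulrn ler_int; clear -p0N p0N2 M1; lia. Qed.
Let D16r : 16 <= D%:R :> R. Proof. by rewrite ler_nat. Qed.
Let h1r : 1 <= h.
Proof. by rewrite ler1n (leq_trans _ HQ) // muln_gt0 expn_gt0 Q0n. Qed.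
Let QNr : Q%:R ^+ 2 <= n. Proof. by rewrite -natrX ler_nat. Qed.
Let n0 : 0 < n. Proof. by rewrite ltr0n (leq_trans _ QN) // expn_gt0 Q0n. Qed.
Let rho0 : 0 <= rho. Proof. by rewrite invr_ge0 exprn_ge0. Qed.

(** In this form the zeros of the slope are visible: u0 = 0 and u0 = - p0. The hypotheses [u0D] and
    [u0p] keep away from them. *)
Lemma cr_eq : cr = 2 * eta%:R * (u0 * (u0 + p0%:~R)) / t0 ^+ 2.
Proof.
have pn : (p0%:~R : R) != 0 by rewrite intr_eq0 p0nz.
have tn : t0 != 0 by have /andP[hh _] := t0N; rewrite gt_eqF // (lt_le_trans n0).
by rewrite /cr /u0; field; rewrite pn tn.
Qed.

Lemma cr_low : h / (2 * Q%:R ^+ 3) <= `|cr|.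
Proof.
have /andP[ta tb] := t0N; have Q0 : 0 < Q%:R :> R by rewrite ltr0n.
have t00 : 0 < t0 by apply: lt_le_trans ta.
rewrite cr_eq normrM normfV normrX (gtr0_norm t00) normrM [X in X * _ / _]ger0_norm ?mulr_ge0 //.
rewrite normrM ler_pdivlMr ?exprn_gt0 //.
have e1 : h / Q%:R <= eta%:R.
  by rewrite ler_pdivrMr // -natrM ler_nat mulnC.
have d0 : 0 <= D%:R :> R by [].
apply: (@le_trans _ _ (2 * (h / Q%:R) * (D%:R * D%:R))).
  apply: (@le_trans _ _ ((h / (2 * Q%:R ^+ 3)) * (2 * n) ^+ 2)).
    rewrite ler_wpM2l ?divr_ge0 ?mulr_ge0 ?exprn_ge0 ?(ltW Q0) //.
    by rewrite lerXn2r ?nnegrE ?mulr_ge0 ?(ltW t00) // ltW.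
  by rewrite nr le_eqVlt; apply/orP; left; apply/eqP; field; rewrite gt_eqF.
apply: ler_pM.
- by rewrite !mulr_ge0 // invr_ge0 ltW.
- by rewrite mulr_ge0.
- by rewrite ler_pM2l.
by apply: ler_pM.
Qed.

Lemma cr_high : `|cr| <= 16 * h.
Proof.
have /andP[ta tb] := t0N; have Q0 : 0 < Q%:R :> R by rewrite ltr0n.
have t00 : 0 < t0 by apply: lt_le_trans ta.
rewrite cr_eq; apply: norm_div_le; first by rewrite exprn_gt0.
rewrite normrM [X in X * _]ger0_norm ?mulr_ge0 // [X in _ * X]normrM.
apply: (@le_trans _ _ (8 * h * (n * (2 * n)))).
  apply: ler_pM; rewrite ?mulr_ge0 //; first by have := hr; lra.
  apply: ler_pM => //; apply: le_trans (ler_normD _ _) _.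
  have := u0N; have := p0nr; rewrite -/n; lra.
rewrite (_ : 8 * h * (n * (2 * n)) = 16 * h * n ^+ 2); last by ring.
rewrite ler_wpM2l ?mulr_ge0 // lerXn2r ?nnegrE; lra.
Qed.

(** An integer slope makes the approximate lags an arithmetic progression of integers. Over a window
    this rounding moves the lag by at most M, hence by at most N, which [lamN] tolerates. *)
Let cz : int := Num.floor cr.
Let B : int := Num.floor L0.

Lemma floor_close1 (x : R) : `|x - (Num.floor x)%:~R| <= 1.
Proof.
have := floor_itv x; rewrite intrD => /andP[a b]; rewrite ger0_norm ?subr_ge0 //; lra.
Qed.

Lemma cz_low : h <= `|cz|%:~R * (4 * Q%:R ^+ 3).
Proof.
have := floor_close1 cr; rewrite -/cz intr_norm => e.
have k := cr_low; have Q0 : 0 < Q%:R :> R by rewrite ltr0n.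
have Q3 : 0 < Q%:R ^+ 3 :> R by rewrite exprn_gt0 // ltr0n.
have := ler_normD (cr - cz%:~R) (cz%:~R); rewrite subrK => e2.
have e3 : h / (2 * Q%:R ^+ 3) - 1 <= `|cz%:~R| by lra.
have e4 : 2 <= h / (4 * Q%:R ^+ 3).
  rewrite ler_pdivlMr; last by rewrite mulr_gt0.
  by rewrite mulrA /h -natrX -!natrM ler_nat.
rewrite -ler_pdivrMr; last by rewrite mulr_gt0.
apply: le_trans e3.
have -> : h / (2 * Q%:R ^+ 3) = 2 * (h / (4 * Q%:R ^+ 3)) by field; rewrite gt_eqF.
lra.
Qed.

Lemma cz_high : `|cz|%:~R <= 17 * h.
Proof.
have := floor_close1 cr; rewrite -/cz intr_norm => e; have k := cr_high.
have := ler_normD cr (cz%:~R - cr); rewrite addrC subrK distrC addrC.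
have := h1r; lra.
Qed.

Lemma cz_neq0 : cz != 0.
Proof.
apply/eqP => e; have := cz_low; rewrite e normr0 mul0r.
have := h1r; lra.
Qed.

(** All factors are constant on the window up to O(c rho), except the second copy of [gam], whose
    argument follows a progression. In the order of the factors in [prod5], 69 = 2 + 2 + 11 + 2 +
    52. *)
Lemma term_close (i : nat) : (i < M)%N ->
  `| `|p0 + i%:Z|%:~R^-1 * path_term (p0 + i%:Z) (z %/ (p0 + i%:Z))%Z - (2 * `|p0%:~R| * t0)^-1 *
     (cutoff (L0 / (4 * n * h)) * (gam (2 * z) * gam (2 * z + B + i%:Z * cz)))|
  <= (2 * `|p0%:~R| * t0)^-1 * (69 * (c * rho)).
Proof.
move=> iM; have /and3P[] := allIN iM; set p := p0 + i%:Z => i1 i2 i3.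
set q := (z %/ p)%Z in i1 i2 i3 *.
have pN0 : p != 0 by rewrite /p; clear -p0D iM MD D16; lia.
have ir0 : 0 <= i%:R :> R by [].
have irM : i%:R <= M%:R :> R by rewrite ler_nat ltnW.
have pE : (p%:~R : R) = p0%:~R + i%:R by rewrite /p intrD.
have uq := divz_close z pN0; rewrite -/q pE in uq.
have /andP[t1 t2] := i2.
have tE : ((X + p - q)%:~R : R) = X%:~R + (p0%:~R + i%:R) - q%:~R.
  by rewrite intrB intrD pE.
have tn : n <= X%:~R + (p0%:~R + i%:R) - q%:~R <= 2 * n.
  by rewrite -tE /n -natrM !pmulrn !ler_int t1 /=; exact: ltW.
have pn : `|p0%:~R + i%:R| <= n.
  by rewrite -pE -intr_norm /n pmulrn ler_int /p; clear -p0N p0N2 iM; lia.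
have eta0 : 0 <= eta%:R :> R by [].
have [ea eb] := est_ab Qr Mr nr MQr eta0 hr p0Dr p0nr u0N t0N ir0 irM uq tn pn D16r.
have mc := lag_close (_ : 0 < X + p - q); rewrite pE in mc.
have tpos : 0 < X + p - q by clear -t1 t2 i2 n0 D16 NQ Q0n; apply: lt_le_trans t1; rewrite ltz_nat; nia.
have [ec ed] := est_lag Qr Mr nr MQr eta0 hr p0Dr p0nr u0N t0N ir0 irM uq tn pn D16r
  h1r QNr (mc tpos).
rewrite -/rho -/t0 in ea eb ec ed.
have /andP[ta tb] := t0N.
have t00 : 0 < t0 by apply: lt_le_trans ta.
have tt0 : 0 < (X + p - q)%:~R :> R by rewrite ltr0z.
have p00 : 0 < `|p0%:~R| :> R by rewrite normr_gt0 intr_eq0 p0nz.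
have pp0 : 0 < `|p%:~R| :> R by rewrite normr_gt0 intr_eq0.
have -> : `|p|%:~R^-1 * path_term p q = (2 * `|p0%:~R| * t0)^-1 *
   ((`|p0%:~R| / `|p0%:~R + i%:R|) * (t0 / (X%:~R + (p0%:~R + i%:R) - q%:~R)) *
    (cutoff ((lag p q)%:~R / (4 * n * h)) * (gam (2 * p * q) * gam (2 * p * q + lag p q)))).
  rewrite /path_term i1 i2 i3 /= -tE -pE intr_norm.
  rewrite (_ : cut_scale N H = 4 * n * h); last by rewrite /cut_scale !natrM.
  have tt1 : 0 < X%:~R + p%:~R - q%:~R :> R by rewrite -intrD -intrB.
  by field; rewrite !gt_eqF.
rewrite -mulrBr normrM ger0_norm; last by rewrite invr_ge0 !mulr_ge0 // ltW.
rewrite ler_wpM2l //; first by rewrite invr_ge0 !mulr_ge0 // ltW.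
have cr0 : 0 <= c * rho by rewrite mulr_ge0 // (le_trans _ c1).
have r1 : rho <= 1 / 4.
  by rewrite /rho div1r lef_pV2 ?posrE ?exprn_gt0 ?ltr0n //; exact: sqr_ge4.
have rc : rho <= c * rho by rewrite ler_peMl.
apply: le_trans (prod5 _ _ _ _ _ _ _ _) _ => //.
- have := ler_normD (t0 / (X%:~R + (p0%:~R + i%:R) - q%:~R) - 1) 1.
  by rewrite subrK normr1 => /le_trans; apply; exact: ratio_error eb r1.
- by rewrite ger0_norm ?cutoff_ge0 // cutoff_le1.
- by rewrite ger0_norm ?cutoff_ge0 // cutoff_le1.
have l0 := lam0.
have zq : `|(p * q)%:~R - z%:~R| <= n :> R.
  apply: le_trans pn; rewrite -pE -intrB -!intr_norm ler_int.
  by move: (divz_eq z p) (modz_ge0 z pN0) (ltz_mod z pN0); rewrite -/q; clear; lia.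
have eD : `|gam (2 * p * q) - gam (2 * z)| <= 2 * (c * rho).
  apply: le_trans (gam_lipZ _ _) _.
  have -> : (2 * p * q)%:~R - (2 * z)%:~R = 2 * ((p * q)%:~R - z%:~R) :> R.
    by rewrite !intrM; ring.
  rewrite normrM normr_nat mulrCA ler_pM2l //.
  by apply: le_trans lamN; rewrite ler_wpM2l.
have eE : `|gam (2 * p * q + lag p q) - gam (2 * z + B + i%:Z * cz)| <= 52 * (c * rho).
  apply: le_trans (gam_lipZ _ _) _.
  have -> : (2 * p * q + lag p q)%:~R - (2 * z + B + i%:Z * cz)%:~R =
     2 * ((p * q)%:~R - z%:~R) + ((lag p q)%:~R - (L0 + i%:R * cr)) +
     (L0 - B%:~R) + i%:R * (cr - cz%:~R) :> R.
    by rewrite !(intrM, intrD, intrB) -[(i%:Z)%:~R]/(i%:R); ring.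
  have b1 := floor_close1 L0; have b2 := floor_close1 cr; rewrite -/B -/cz in b1 b2.
  have b3 : `|i%:R * (cr - cz%:~R)| <= n.
    rewrite normrM ger0_norm // -[leRHS]mulr1; apply: ler_pM => //.
    apply: le_trans irM _; have Q31 : 1 <= Q%:R ^+ 3 :> R by rewrite exprn_ege1 // ler1n.
    have : M%:R <= D%:R :> R by apply: le_trans MQr; rewrite ler_peMr.
    rewrite nr; have : D%:R <= Q%:R * D%:R :> R by rewrite ler_peMl // ler1n.
    by move=> h1 h2; exact: le_trans h2 h1.
  have hn : h <= n by rewrite ler_nat.
  have n1 : 2 <= n.
    by apply: le_trans QNr; apply: le_trans (sqr_ge4 Qr); rewrite ler_nat.
  apply: (@le_trans _ _ (lam * (28 * n + 24 * h * M%:R ^+ 2 * Q%:R ^+ 4 / n))).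
    rewrite ler_wpM2l //; apply: le_trans (ler_normD _ _) _.
    apply: (@le_trans _ _ (2 * n + (1 + 24 * h + 24 * h * M%:R ^+ 2 * Q%:R ^+ 4 / n)
       + 1 + n)); last exact: lag_error_sum.
    apply: lerD => //; apply: le_trans (ler_normD _ _) _; apply: lerD => //.
    apply: le_trans (ler_normD _ _) _; apply: lerD => //.
    by rewrite normrM normr_nat ler_pM2l.
  have k1 : lam * (24 * h * M%:R ^+ 2 * Q%:R ^+ 4 / n) <= 24 * (c * rho).
    have -> : lam * (24 * h * M%:R ^+ 2 * Q%:R ^+ 4 / n) =
      24 * (lam * (h * M%:R ^+ 2 * Q%:R ^+ 4) / n) by field; rewrite gt_eqF.
    by rewrite ler_pM2l // ler_pdivrMr.
  rewrite mulrDr mulrCA (_ : 52 * (c * rho) = 28 * (c * rho) + 24 * (c * rho)).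
    by rewrite lerD // ler_pM2l.
  by rewrite -mulrDl -natrD.
exact: term_error_sum ea eb ec eD eE rc.
Qed.

(** The sum of [gam] over a progression of step [cz] is small by [ap_sum]: W is small against M
    |cz|, and lam |cz| is small. The constant is 45 = (69 + 21) / 2. *)
Lemma window_sum : `|\sum_(0 <= i < M) `|p0 + i%:Z|%:~R^-1 *
    path_term (p0 + i%:Z) (z %/ (p0 + i%:Z))%Z| <=
  M%:R * (45 * (c * rho)) / (`|p0%:~R| * n).
Proof.
have /andP[ta tb] := t0N.
have t00 : 0 < t0 by apply: lt_le_trans ta.
have p00 : 0 < `|p0%:~R| :> R by rewrite normr_gt0 intr_eq0 p0nz.
set k := (2 * `|p0%:~R| * t0)^-1.
have k0 : 0 <= k by rewrite invr_ge0 !mulr_ge0 // ltW.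
set F := fun i : nat => k * (cutoff (L0 / (4 * n * h)) *
   (gam (2 * z) * gam (2 * z + B + i%:Z * cz))).
have hs : size (index_iota 0 M) = M by rewrite size_iota subn0.
have e1 : `|\sum_(0 <= i < M) `|p0 + i%:Z|%:~R^-1 *
    path_term (p0 + i%:Z) (z %/ (p0 + i%:Z))%Z - \sum_(0 <= i < M) F i| <=
    M%:R * (k * (69 * (c * rho))).
  rewrite -[X in _ <= X%:R * _]hs; apply: ler_dist_sum_const => i.
  by rewrite mem_index_iota => /andP[_ iM]; apply: term_close.
have cr0 : 0 <= c * rho by rewrite mulr_ge0 //; have := c1; lra.
have e2 : `|\sum_(0 <= i < M) F i| <= k * (M%:R * (21 * (c * rho))).
  rewrite -mulr_sumr normrM (ger0_norm k0) ler_wpM2l //.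
  rewrite -mulr_sumr normrM -mulr_sumr normrM mulrA.
  set A := \sum_(_ <= _ < _) _.
  apply: (@le_trans _ _ `|A|).
    rewrite ler_piMl // -normrM; apply: norm_mul_le1 => //.
    by rewrite ger0_norm ?cutoff_ge0 // cutoff_le1.
  have cz0 := cz_neq0.
  have czp : 0 < `|cz|%:~R :> R by rewrite ltr0z normr_gt0.
  have := ap_sum (2 * z + B) M cz0; rewrite -/A mulrC -ler_pdivlMr // => hA.
  apply: le_trans hA _; rewrite mulrDl.
  have -> : M%:R * `|cz|%:~R * (`|cz|%:~R * lam) / `|cz|%:~R = M%:R * (`|cz|%:~R * lam).
    by field; rewrite gt_eqF.
  have a1 : W / `|cz|%:~R <= 4 * (c * rho * M%:R).
    rewrite ler_pdivrMr //.
    have Q30 : 0 < 4 * Q%:R ^+ 3 :> R by rewrite mulr_gt0 // exprn_gt0 //; have := Qr; lra.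
    have : W <= c * rho * (M%:R * h) / (4 * Q%:R ^+ 3) by rewrite ler_pdivlMr.
    move=> hW; apply: le_trans hW _; rewrite ler_pdivrMr //.
    have := cz_low => cl.
    have : c * rho * (M%:R * h) <= c * rho * M%:R * (`|cz|%:~R * (4 * Q%:R ^+ 3)).
      by rewrite -[c * rho * M%:R * _]mulrA ler_wpM2l // ler_wpM2l.
    move=> hh; apply: le_trans hh _.
    have : 0 <= c * rho * M%:R * (`|cz|%:~R * (4 * Q%:R ^+ 3)).
      apply: mulr_ge0; first by apply: mulr_ge0.
      by apply: mulr_ge0; [exact: ltW | rewrite mulr_ge0 ?exprn_ge0].
    lra.
  have a2 : M%:R * (`|cz|%:~R * lam) <= 17 * (c * rho * M%:R).
    have -> : M%:R * (`|cz|%:~R * lam) = `|cz|%:~R * lam * M%:R by ring.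
    have -> : 17 * (c * rho * M%:R) = 17 * (c * rho) * M%:R by ring.
    rewrite ler_wpM2r //.
    apply: (@le_trans _ _ (17 * h * lam)); first by rewrite ler_wpM2r ?lam0 ?cz_high.
    rewrite -mulrA ler_pM2l // mulrC; apply: le_trans lamN.
    by rewrite ler_wpM2l ?lam0 // ler_nat.
  have -> : M%:R * (21 * (c * rho)) = 4 * (c * rho * M%:R) + 17 * (c * rho * M%:R) by ring.
  exact: lerD.
have k1 : k <= (2 * `|p0%:~R| * n)^-1.
  by rewrite lef_pV2 ?posrE ?mulr_gt0 // ler_pM2l ?mulr_gt0.
move: e1 e2; set S := \sum_(_ <= _ < _) _; set S' := \sum_(_ <= _ < _) _ => e1 e2.
have := ler_normD (S - S') S'; rewrite subrK => e3.
apply: (@le_trans _ _ (k * (M%:R * (90 * (c * rho))))).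
  have -> : k * (M%:R * (90 * (c * rho))) =
    M%:R * (k * (69 * (c * rho))) + k * (M%:R * (21 * (c * rho))) by ring.
  lra.
apply: (@le_trans _ _ ((2 * `|p0%:~R| * n)^-1 * (M%:R * (90 * (c * rho))))).
  by rewrite ler_wpM2r // mulr_ge0 // mulr_ge0.
by rewrite le_eqVlt; apply/orP; left; apply/eqP; field; rewrite !gt_eqF.
Qed.

End Window.

(** * Windows near the ends of the ranges of summation *)

Section BoundaryMargins.
Context {R : realFieldType}.
Implicit Types (n d X p u i q a b x y M : R).

Lemma margin_of_near n d a b : 0 < d -> n <= a -> a < 2 * n -> `|b - a| <= d / 2 ->
  d < `|b - n| -> d < `|b - 2 * n| -> n + d < b /\ b < 2 * n - d.
Proof.
move=> d0 a1 a2; rewrite ler_norml => /andP[b1 b2] b3 b4; split.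
  by move: b3; case: (ger0P (b - n)); lra.
by move: b4; case: (ger0P (b - 2 * n)); lra.
Qed.

Lemma in_win_of_margin n d X p u i q : n + d < X + p -> X + p < 2 * n - d ->
  n + d < X - u -> X - u < 2 * n - d -> n + d < X + p - u -> X + p - u < 2 * n - d ->
  `|u - q| <= d / 2 -> 0 <= i -> i * 8 <= d ->
  [&& (n <= X + (p + i)) && (X + (p + i) < 2 * n),
      (n <= X + (p + i) - q) && (X + (p + i) - q < 2 * n) &
      (n <= X - q) && (X - q < 2 * n)].
Proof.
move=> A1 A2 B1 B2 C1 C2; rewrite ler_norml => /andP[v1 v2] i0 i8.
by apply/and3P; split; apply/andP; split; lra.
Qed.

Lemma norm_of_margin n d x u : 0 < d -> n + d < x -> x < 2 * n - d ->
  n + d < x - u -> x - u < 2 * n - d -> `|u| <= n.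
Proof. by move=> d0 h1 h2 h3 h4; rewrite ler_norml; lra. Qed.

Lemma itv_of_margin n d x : 0 < d -> n + d < x -> x < 2 * n - d -> n <= x <= 2 * n.
Proof. by move=> d0 h1 h2; lra. Qed.

Lemma eighthD1 d x y : 16 <= d -> x <= d / 8 -> y <= 1 -> x + y <= d / 4.
Proof. by move=> h1 h2 h3; lra. Qed.

Lemma quarterD1 d x y : 16 <= d -> x <= d / 4 -> y <= 1 -> x + y <= d / 2.
Proof. by move=> h1 h2 h3; lra. Qed.

Lemma quarterDeighth d x y : x * 8 <= d -> y <= d / 4 -> 0 <= d -> x + y <= d / 2.
Proof. by move=> h1 h2 h3; lra. Qed.

End BoundaryMargins.

Section WindowSum.
Context {R : archiRealFieldType}.
Variables (gam : int -> R) (lam W c : R) (N M D H Q eta : nat) (X : int).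
Hypothesis gam1 : forall y, `|gam y| <= 1.
Hypothesis gamL : forall y, `|gam (y + 1) - gam y| <= lam.
Hypothesis gamW : forall y (S : nat), `|\sum_(0 <= s < S) gam (y + s%:Z)| <= W.
Hypotheses (Q2 : (2 <= Q)%N) (M1 : (0 < M)%N) (NQ : N = (Q * D)%N).
Hypotheses (MQ : (M * Q ^ 3 <= D)%N) (D16 : (16 <= D)%N) (HN : (H <= N)%N).
Hypotheses (eta4 : (eta <= 4 * H)%N) (etaQ : (H <= Q * eta)%N).
Hypotheses (HQ : (8 * Q ^ 3 <= H)%N) (QN : (Q ^ 2 <= N)%N).
Let rho : R := Q%:R ^- 2.
Hypotheses (c1 : 1 <= c) (lamN : lam * N%:R <= c * rho).
Hypotheses (lamH : lam * (H%:R * M%:R ^+ 2 * Q%:R ^+ 4) <= c * rho * N%:R).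
Hypotheses (WQ : W * (4 * Q%:R ^+ 3) <= c * rho * (M%:R * H%:R)).
Local Notation Ps := (@path_term R gam N H eta X).
Let n : R := N%:R.
Let Q0n : (0 < Q)%N := leq_trans (isT : (0 < 2)%N) Q2.
Let MD : (M * 8 <= D)%N.
Proof.
apply: leq_trans MQ; rewrite leq_mul2l; apply/orP; right.
by rewrite -[8%N]/(2 ^ 3)%N leq_exp2r.
Qed.
Let QMD : (Q * M * 4 <= D)%N.
Proof.
apply: leq_trans MQ; rewrite mulnAC mulnC leq_mul2l expnS leq_mul2l.
by rewrite -[4%N]/(2 ^ 2)%N leq_exp2r // Q2 !orbT.
Qed.
Let n0 : 0 < n. Proof. by rewrite ltr0n (leq_trans _ QN) // expn_gt0 Q0n. Qed.

Lemma path_term_le p q : `|Ps p q| <= (2 * n)^-1.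
Proof.
rewrite /path_term; case: ifP => [/and3P[_ /andP[h _] _]|_]; last first.
  by rewrite normr0 invr_ge0 mulr_ge0 // ltW.
have tn : n <= (X + p - q)%:~R by rewrite /n pmulrn ler_int.
have t0 : 0 < (X + p - q)%:~R :> R by apply: lt_le_trans tn.
rewrite normrM ger0_norm ?invr_ge0 ?mulr_ge0 ?(ltW t0) //.
rewrite -[leRHS]mulr1; apply: ler_pM => //.
- by rewrite invr_ge0 mulr_ge0 // ltW.
- by rewrite lef_pV2 ?posrE ?mulr_gt0 // ler_pM2l.
apply: norm_mul_le1; first by rewrite ger0_norm ?cutoff_ge0 // cutoff_le1.
exact: norm_mul_le1.
Qed.

Variables (p0 z : int).
Hypotheses (p0D : (2 * D)%N%:Z <= `|p0|) (p0N : - N%:Z <= p0) (p0N2 : p0 + M%:Z <= N%:Z).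
Let far (th : int) := (D%:Z * `|p0| < `|z - th * p0|).
Hypotheses (f1 : far 0) (f2 : far (- p0)) (f3 : far (X - N%:Z)) (f4 : far (X - (2 * N)%N%:Z)).
Hypotheses (f5 : far (X + p0 - N%:Z)) (f6 : far (X + p0 - (2 * N)%N%:Z)).
Hypotheses (g1 : D%:Z < `|X + p0 - N%:Z|) (g2 : D%:Z < `|X + p0 - (2 * N)%N%:Z|).
Let u0 : R := z%:~R / p0%:~R.
Let d : R := D%:R.

Let p0nz : p0 != 0. Proof. by clear -p0D D16; lia. Qed.
Let p0r : (p0%:~R : R) != 0. Proof. by rewrite intr_eq0. Qed.
Let p0r0 : 0 < `|p0%:~R| :> R. Proof. by rewrite normr_gt0. Qed.
Let d0 : 16 <= d. Proof. by rewrite ler_nat. Qed.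
Let p0d : 2 * d <= `|p0%:~R|.
Proof. by rewrite -intr_norm -natrM pmulrn ler_int. Qed.

Lemma far_real (th : int) : far th -> d < `|u0 - th%:~R|.
Proof.
rewrite /far -(ltr_int R) intrM !intr_norm => h.
have -> : u0 - th%:~R = (z - th * p0)%:~R / p0%:~R.
  by rewrite /u0 intrB intrM; field.
by rewrite normf_div ltr_pdivlMr.
Qed.

Lemma INr (x : int) : in_win N x = (n <= x%:~R) && (x%:~R < 2 * n :> R).
Proof. by rewrite /in_win /n -natrM !pmulrn ler_int ltr_int. Qed.

(** The hypotheses [f1] and [f2] bound the slope from below. The others keep the three steps,
    computed from p0 and u0, at distance more than D from the ends N and 2 N of their range. As the
    steps differ from these values by at most D / 2 on the window, either no term satisfies the
    range conditions and the sum is 0, or all terms do and [window_sum] applies. *)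
Lemma window_good : `|\sum_(0 <= i < M) `|p0 + i%:Z|%:~R^-1 *
    Ps (p0 + i%:Z) (z %/ (p0 + i%:Z))%Z| <=
  M%:R * (45 * (c * rho)) / (`|p0%:~R| * n).
Proof.
have rho0 : 0 <= c * rho.
  by rewrite mulr_ge0 ?invr_ge0 ?exprn_ge0 // (le_trans _ c1).
pose ok (i : nat) := [&& in_win N (X + (p0 + i%:Z)),
   in_win N (X + (p0 + i%:Z) - (z %/ (p0 + i%:Z))%Z) & in_win N (X - (z %/ (p0 + i%:Z))%Z)].
case: (boolP (has ok (index_iota 0 M))) => [|hno]; last first.
  rewrite big1_seq ?normr0.
    by apply: divr_ge0; apply: mulr_ge0 => //; apply: mulr_ge0.
  move=> i /andP[_ iM]; rewrite /path_term.
  by move/hasPn : hno => /(_ _ iM) /negbTE; rewrite /ok => ->; rewrite mulr0.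
move=> /hasP[i1]; rewrite mem_index_iota => /andP[_ i1M] /and3P[o1 o2 o3].
have d00 : 0 < d by apply: lt_le_trans d0; rewrite ltr0n.
have dM : M%:R * 8 <= d by rewrite -natrM ler_nat.
have dQM : Q%:R * M%:R * 4 <= d by rewrite -!natrM ler_nat.
have M0 : 1 <= M%:R :> R by rewrite ler1n.
have pfacts (i : nat) : (i < M)%N -> p0 + i%:Z != 0 /\ d <= `|p0%:~R + i%:R| :> R.
  move=> iM; split; first by clear -p0D iM MD D16; lia.
  rewrite -[i%:R]/((i%:Z)%:~R) -intrD -intr_norm /d pmulrn ler_int.
  by clear -p0D iM MD D16; lia.
have nQ : n = Q%:R * d by rewrite /n NQ natrM.
have [pz1 pd1] := pfacts _ i1M.
have p1r : (p0%:~R + i1%:R : R) != 0 by rewrite -normr_gt0 (lt_le_trans d00).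
have i1r : i1%:R <= M%:R :> R by rewrite ler_nat ltnW.
have i1r0 : 0 <= i1%:R :> R by [].
set q1 := (z %/ (p0 + i1%:Z))%Z in o2 o3.
have uq1 : `|z%:~R / (p0%:~R + i1%:R) - q1%:~R| <= 1 :> R.
  by have := divz_close (R := R) z pz1; rewrite intrD.
rewrite !INr !(intrB, intrD) -[(i1%:Z)%:~R]/(i1%:R) in o1 o2 o3.
move: o1 o2 o3 => /andP[o1a o1b] /andP[o2a o2b] /andP[o3a o3b].
set u1 := z%:~R / (p0%:~R + i1%:R) in uq1.
have u1n : `|u1| <= n.
  have : `|q1%:~R| <= n - 1 :> R.
    have : `|q1| <= N%:Z - 1.
      have a1 : N%:Z <= X + (p0 + i1%:Z) by rewrite -(ler_int R) !intrD.
      have a2 : X + (p0 + i1%:Z) < (2 * N)%N%:Z by rewrite -(ltr_int R) !intrD -[((2 * N)%N%:Z)%:~R]/((2*N)%:R) natrM.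
      have a3 : N%:Z <= X + (p0 + i1%:Z) - q1 by rewrite -(ler_int R) !(intrB, intrD).
      have a4 : X + (p0 + i1%:Z) - q1 < (2 * N)%N%:Z.
        by rewrite -(ltr_int R) !(intrB, intrD) -[((2 * N)%N%:Z)%:~R]/((2*N)%:R) natrM.
      by clear -a1 a2 a3 a4; lia.
    by rewrite -(ler_int R) intrB intr_norm.
  by have := ler_normD (u1 - q1%:~R) q1%:~R; rewrite subrK; lra.
have u01 : `|u0 - u1| <= d / 8.
  have -> : u0 - u1 = u1 * i1%:R / p0%:~R by rewrite /u0 /u1; field; rewrite p0r p1r.
  rewrite normf_div ler_pdivrMr // normrM (ger0_norm i1r0).
  apply: (@le_trans _ _ (n * M%:R)); first exact: ler_pM.
  rewrite nQ; apply: (@le_trans _ _ (d / 8 * (2 * d))); last by apply: ler_wpM2l => //; rewrite divr_ge0 // ltW.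
  have -> : Q%:R * d * M%:R = d * (Q%:R * M%:R) by ring.
  have -> : d / 8 * (2 * d) = d * (d / 4) by field.
  by rewrite ler_pM2l // ler_pdivlMr.
have R1 := far_real f1; have R2 := far_real f2; have R3 := far_real f3.
have R4 := far_real f4; have R5 := far_real f5; have R6 := far_real f6.
rewrite subr0 in R1; rewrite mulrNz opprK in R2.
rewrite intrB -[(N%:Z)%:~R]/n in R3.
rewrite intrB -[((2 * N)%N%:Z)%:~R]/((2*N)%:R) natrM -/n in R4.
rewrite intrB intrD -[(N%:Z)%:~R]/n in R5.
rewrite intrB intrD -[((2 * N)%N%:Z)%:~R]/((2*N)%:R) natrM -/n in R6.
have G1 : d < `|X%:~R + p0%:~R - n|.
  by move: g1; rewrite -(ltr_int R) intr_norm intrB intrD.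
have G2 : d < `|X%:~R + p0%:~R - 2 * n|.
  by move: g2; rewrite -(ltr_int R) intr_norm intrB intrD -[((2 * N)%N%:Z)%:~R]/((2*N)%:R) natrM.
have U : `|u0 - q1%:~R| <= d / 4.
  by apply: le_trans (ler_distD u1 _ _) _; exact: eighthD1.
have M8 (i : nat) : (i < M)%N -> i%:R * 8 <= d.
  by move=> iM; apply: le_trans dM; rewrite ler_pM2r // ler_nat ltnW.
have [A1 A2] : n + d < X%:~R + p0%:~R /\ X%:~R + p0%:~R < 2 * n - d.
  apply: (margin_of_near d00 o1a o1b _ G1 G2).
  have -> : X%:~R + p0%:~R - (X%:~R + (p0%:~R + i1%:R)) = - i1%:R :> R by ring.
  rewrite normrN ger0_norm // -[i1%:R]addr0.
  by apply: quarterDeighth; [exact: M8 | rewrite divr_ge0 | exact: ltW].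
have [B1 B2] : n + d < X%:~R - u0 /\ X%:~R - u0 < 2 * n - d.
  apply: (margin_of_near d00 o3a o3b _ _ _).
  - have -> : X%:~R - u0 - (X%:~R - q1%:~R) = - (u0 - q1%:~R) by ring.
    rewrite normrN -[leLHS]add0r.
    by apply: (quarterDeighth _ U (ltW d00)); rewrite mul0r ltW.
  - by rewrite distrC; have -> : n - (X%:~R - u0) = u0 - (X%:~R - n) by ring.
  - by rewrite distrC; have -> : 2 * n - (X%:~R - u0) = u0 - (X%:~R - 2 * n) by ring.
have [C1 C2] : n + d < X%:~R + p0%:~R - u0 /\ X%:~R + p0%:~R - u0 < 2 * n - d.
  apply: (margin_of_near d00 o2a o2b _ _ _).
  - have -> : X%:~R + p0%:~R - u0 - (X%:~R + (p0%:~R + i1%:R) - q1%:~R) =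
       - i1%:R - (u0 - q1%:~R) by ring.
    apply: le_trans (ler_normB _ _) _; rewrite normrN ger0_norm //.
    by apply: (quarterDeighth _ U (ltW d00)); exact: M8.
  - by rewrite distrC; have -> : n - (X%:~R + p0%:~R - u0) = u0 - (X%:~R + p0%:~R - n) by ring.
  - by rewrite distrC; have -> : 2 * n - (X%:~R + p0%:~R - u0) = u0 - (X%:~R + p0%:~R - 2 * n) by ring.
have u0n : `|u0| <= n := norm_of_margin d00 A1 A2 C1 C2.
have t0n : n <= X%:~R + p0%:~R - u0 <= 2 * n := itv_of_margin d00 C1 C2.
apply: (window_sum gam1 gamL gamW Q2 M1 NQ MQ D16 HN eta4 etaQ HQ QN c1 lamN lamH WQ
  p0D p0N p0N2) => //; rewrite ?(ltW R1) ?(ltW R2) //.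
move=> i iM; have [pz pd] := pfacts _ iM.
have p1r' : (p0%:~R + i%:R : R) != 0 by rewrite -normr_gt0 (lt_le_trans d00).
have ir : i%:R <= M%:R :> R by rewrite ler_nat ltnW.
have ir0 : 0 <= i%:R :> R by [].
set q := (z %/ (p0 + i%:Z))%Z.
have uq : `|z%:~R / (p0%:~R + i%:R) - q%:~R| <= 1 :> R.
  by have := divz_close (R := R) z pz; rewrite intrD.
set u := z%:~R / (p0%:~R + i%:R) in uq.
have uu : `|u - u0| <= d / 4.
  have -> : u - u0 = - (u0 * i%:R) / (p0%:~R + i%:R) by rewrite /u0 /u; field; rewrite p0r p1r'.
  rewrite normf_div normrN normrM (ger0_norm ir0) ler_pdivrMr; last exact: lt_le_trans pd.
  apply: (@le_trans _ _ (n * M%:R)); first exact: ler_pM.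
  rewrite nQ; apply: (@le_trans _ _ (d / 4 * d)); last by apply: ler_wpM2l => //; rewrite divr_ge0 // ltW.
  have -> : Q%:R * d * M%:R = d * (Q%:R * M%:R) by ring.
  have -> : d / 4 * d = d * (d / 4) by ring.
  by rewrite ler_pM2l // ler_pdivlMr.
have uq' : `|u0 - q%:~R| <= d / 2.
  by apply: le_trans (ler_distD u _ _) _; rewrite distrC; exact: quarterD1.
rewrite !INr !(intrB, intrD) -[(i%:Z)%:~R]/(i%:R).
exact: in_win_of_margin A1 A2 B1 B2 C1 C2 uq' ir0 (M8 _ iM).
Qed.

End WindowSum.

(** * The sum over all paths from a point *)

Section PathSum.
Context {R : archiRealFieldType}.
Variables (lam W c : R) (N M D H Q eta K : nat).
Hypotheses (Q2 : (2 <= Q)%N) (M1 : (0 < M)%N) (NQ : N = (Q * D)%N).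
Hypotheses (MQ : (M * Q ^ 3 <= D)%N) (D16 : (16 <= D)%N) (HN : (H <= N)%N).
Hypotheses (eta4 : (eta <= 4 * H)%N) (etaQ : (H <= Q * eta)%N).
Hypotheses (HQ : (8 * Q ^ 3 <= H)%N) (QN : (Q ^ 2 <= N)%N) (NK : N = (K * M)%N).
Let rho : R := Q%:R ^- 2.
Hypotheses (c1 : 1 <= c) (lamN : lam * N%:R <= c * rho).
Hypotheses (lamH : lam * (H%:R * M%:R ^+ 2 * Q%:R ^+ 4) <= c * rho * N%:R).
Hypotheses (WQ : W * (4 * Q%:R ^+ 3) <= c * rho * (M%:R * H%:R)).
Let n : R := N%:R.
Let Q0n : (0 < Q)%N := leq_trans (isT : (0 < 2)%N) Q2.
Let MD : (M * 8 <= D)%N.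
Proof.
apply: leq_trans MQ; rewrite leq_mul2l; apply/orP; right.
by rewrite -[8%N]/(2 ^ 3)%N leq_exp2r.
Qed.
Let n0 : 0 < n. Proof. by rewrite ltr0n (leq_trans _ QN) // expn_gt0 Q0n. Qed.
Let Q0 : 0 < Q%:R :> R. Proof. by rewrite ltr0n. Qed.
Let D0 : 0 < D%:R :> R. Proof. by rewrite ltr0n; clear -D16; lia. Qed.
Let M0 : 0 < M%:R :> R. Proof. by rewrite ltr0n. Qed.
Let nQ : n = Q%:R * D%:R. Proof. by rewrite /n NQ natrM. Qed.
Let hsz k : size (index_iota 0 k) = k. Proof. by rewrite size_iota subn0. Qed.

Section FixX.
Variables (gam : int -> R) (X : int).
Hypothesis gam1 : forall y, `|gam y| <= 1.
Hypothesis gamL : forall y, `|gam (y + 1) - gam y| <= lam.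
Hypothesis gamW : forall y (S : nat), `|\sum_(0 <= s < S) gam (y + s%:Z)| <= W.
Local Notation Ps := (@path_term R gam N H eta X).

(** Near 0 the weight 1 / |p0| is too large; near the other two points the step X + p0 is too close
    to an end of its range. *)
Definition near_bad (p0 : int) : bool :=
  [|| `|p0| < (2 * D)%N%:Z, `|p0 - (N%:Z - X)| <= D%:Z |
      `|p0 - ((2 * N)%N%:Z - X)| <= D%:Z].

(** The radii exceed those of [near_bad] by D, in order to cover every point of a window that starts
    at a bad point. The three intervals have at most 14 D + 3 points. *)
Lemma near_bad_count :
  \sum_(p <- zrange (- N%:Z) (2 * N)) [|| `|p - 0| <= (3 * D)%N%:Z,
     `|p - (N%:Z - X)| <= (2 * D)%N%:Z | `|p - ((2 * N)%N%:Z - X)| <= (2 * D)%N%:Z]%R%:R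
  <= 15 * D%:R :> R.
Proof.
have h a b := @count_int_le R _ a b (zrange_uniq (- N%:Z) (2 * N)).
have := h 0 (3 * D)%N; have := h (N%:Z - X) (2 * D)%N.
have := h ((2 * N)%N%:Z - X) (2 * D)%N => h1 h2 h3.
apply: (@le_trans _ _ ((2 * (3 * D) + 1)%:R + (2 * (2 * D) + 1)%:R + (2 * (2 * D) + 1)%:R)).
  apply: le_trans (lerD (lerD h3 h2) h1); rewrite -!big_split /=.
  apply: ler_sum => p _; rewrite -!natrD ler_nat.
  by case: (_ <= _); case: (_ <= _); case: (_ <= _).
by rewrite -!natrD -natrM ler_nat; clear -D16; lia.
Qed.

Definition bad_z (p0 z : int) : bool :=
  [|| `|z - 0 * p0| <= D%:Z * `|p0|, `|z - (- p0) * p0| <= D%:Z * `|p0|,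
      `|z - (X - N%:Z) * p0| <= D%:Z * `|p0|,
      `|z - (X - (2 * N)%N%:Z) * p0| <= D%:Z * `|p0|,
      `|z - (X + p0 - N%:Z) * p0| <= D%:Z * `|p0| |
      `|z - (X + p0 - (2 * N)%N%:Z) * p0| <= D%:Z * `|p0|].

(** The exceptions to [window_good] fill six intervals, each with at most 2 D |p0| + 1 <= 3 D |p0|
    integers. *)
Lemma bad_z_count (p0 : int) (r : seq int) : uniq r -> p0 != 0 ->
  \sum_(z <- r) (bad_z p0 z)%:R <= 18 * (D%:R * `|p0|%:~R) :> R.
Proof.
move=> ur p00; have h a := @count_int_le R _ a (D * `|p0|)%N ur.
rewrite (_ : 18 * (D%:R * `|p0|%:~R) = (18 * (D * `|p0|%N))%:R); last first.
  by rewrite !natrM -abszE.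
have := lerD (lerD (lerD (lerD (lerD (h (0 * p0)) (h (- p0 * p0))) (h ((X - N%:Z) * p0)))
  (h ((X - (2 * N)%N%:Z) * p0))) (h ((X + p0 - N%:Z) * p0))) (h ((X + p0 - (2 * N)%N%:Z) * p0)).
rewrite -!natrD -!big_split /= => hh.
apply: (@le_trans _ _ (\sum_(z <- r) ((`|z - 0 * p0| <= (D * `|p0|)%N%:Z)%R%:R +
   (`|z - - p0 * p0| <= (D * `|p0|)%N%:Z)%R%:R + (`|z - (X - N%:Z) * p0| <= (D * `|p0|)%N%:Z)%R%:R +
   (`|z - (X - (2 * N)%N%:Z) * p0| <= (D * `|p0|)%N%:Z)%R%:R +
   (`|z - (X + p0 - N%:Z) * p0| <= (D * `|p0|)%N%:Z)%R%:R +
   (`|z - (X + p0 - (2 * N)%N%:Z) * p0| <= (D * `|p0|)%N%:Z)%R%:R))).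
  apply: ler_sum => z _; rewrite /bad_z (PoszM D) abszE -!natrD ler_nat.
  by do 6!case: (_ <= _).
apply: le_trans hh _; rewrite ler_nat.
have : (1 <= D * `|p0|)%N by rewrite muln_gt0 absz_gt0 p00 andbT; clear -D16; lia.
by move: (D * `|p0|)%N; clear; lia.
Qed.

Definition window_total (p0 : int) : R := \sum_(0 <= i < M)
  \sum_(q <- zrange (- N%:Z) (2 * N)) Ps (p0 + i%:Z) q.

Lemma window_total_triv p0 : `|window_total p0| <= M%:R.
Proof.
have -> : M%:R = M%:R * ((2 * N)%:R * (2 * n)^-1) :> R.
  by rewrite natrM -/n divff ?mulr1 // mulf_neq0 // gt_eqF.
rewrite -[X in _ <= X%:R * _]hsz; apply: ler_norm_sum_const => i _.
rewrite -[X in _ <= X%:R * _](size_zrange (- N%:Z)); apply: ler_norm_sum_const => q _.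
by apply: path_term_le; [exact: gam1|exact: Q2|exact: QN].
Qed.

(** By [sum_divz] the sum over q becomes a sum over z with weight 1 / |p|, to which [window_good]
    applies for each good z. In 63 = 18 + 45, the first part comes from the trivial bound for the
    bad z and the second from the good ones. *)
Lemma window_total_good p0 : - N%:Z <= p0 -> p0 + M%:Z <= N%:Z -> ~~ near_bad p0 ->
  `|window_total p0| <= 63 * c * M%:R / Q%:R.
Proof.
move=> pN pN2; rewrite !negb_or -leNgt -!ltNge => /and3P[b1 b2 b3].
have pfacts (i : nat) : (i < M)%N -> p0 + i%:Z != 0 /\ `|p0 + i%:Z| <= N%:Z /\
    `|p0| <= 2 * `|p0 + i%:Z|.
  by move=> iM; clear -pN pN2 b1 iM MD D16; lia.
have p0n : p0 != 0 by clear -b1 D16; lia.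
have pr0 : 0 < `|p0|%:~R :> R by rewrite ltr0z normr_gt0.
set rz := zrange (- (N ^ 2)%N%:Z) (2 * N ^ 2).
have -> : window_total p0 = \sum_(z <- rz) \sum_(0 <= i < M) `|p0 + i%:Z|%:~R^-1 *
    Ps (p0 + i%:Z) (z %/ (p0 + i%:Z))%Z.
  rewrite exchange_big /=; apply: eq_big_nat => i /andP[_ iM].
  have [h1 [h2 _]] := pfacts _ iM.
  have pi0 : (`|p0 + i%:Z|%:~R : R) != 0 by rewrite intr_eq0 normr_eq0.
  rewrite -mulr_sumr -(sum_divz h1 h2) ?mulrA ?mulVf ?mul1r // => q.
  rewrite /path_term; case: ifP => [/and3P[a1 a2 a3] _|]; last by rewrite eqxx.
  by move: a1 a2 a3; rewrite /in_win; clear; lia.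
apply: (@le_trans _ _ (\sum_(z <- rz) ((bad_z p0 z)%:R * (M%:R / (`|p0|%:~R * n)) +
   M%:R * (45 * (c * rho)) / (`|p0%:~R| * n)))).
  have crho : 0 <= c * rho.
    by rewrite mulr_ge0 ?invr_ge0 ?exprn_ge0 //; have := c1; lra.
  have k45 : 0 <= M%:R * (45 * (c * rho)) / (`|p0%:~R| * n).
    by apply: divr_ge0; apply: mulr_ge0 => //; apply: mulr_ge0.
  apply: ler_norm_sum_seq => z _.
  case: (boolP (bad_z p0 z)) => hb; last first.
    rewrite mul0r add0r.
    move: hb; rewrite !negb_or -!ltNge => /and5P[f1 f2 f3 f4 /andP[f5 f6]].
    apply: (window_good gam1 gamL gamW Q2 M1 NQ MQ D16 HN eta4 etaQ HQ QN c1 lamN lamH WQ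
       b1 pN pN2 f1 f2 f3 f4 f5 f6).
    - by have -> : X + p0 - N%:Z = p0 - (N%:Z - X) by clear; lia.
    - by have -> : X + p0 - (2 * N)%N%:Z = p0 - ((2 * N)%N%:Z - X) by clear; lia.
  rewrite mul1r -[leLHS]addr0; apply: lerD => //.
  have -> : M%:R / (`|p0|%:~R * n) = M%:R * ((2 / `|p0|%:~R) * (2 * n)^-1) :> R.
    by field; rewrite !gt_eqF.
  rewrite -[X in _ <= X%:R * _]hsz; apply: ler_norm_sum_const => i.
  rewrite mem_index_iota => /andP[_ iM]; have [h1 [h2 h3]] := pfacts _ iM.
  have pi0 : 0 < `|p0 + i%:Z|%:~R :> R by rewrite ltr0z normr_gt0.
  rewrite normrM; apply: ler_pM => //; last by apply: path_term_le; [exact: gam1|exact: Q2|exact: QN].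
  rewrite ger0_norm ?invr_ge0 ?(ltW pi0) // -div1r ler_pdivrMr // mulrAC ler_pdivlMr //.
  by rewrite mul1r -[2]/(2%:~R) -intrM ler_int.
rewrite big_split /= -mulr_suml sumr_const_seq size_zrange -intr_norm.
have hb := bad_z_count (zrange_uniq (- (N ^ 2)%N%:Z) (2 * N ^ 2)) p0n; rewrite -/rz in hb.
apply: (@le_trans _ _ (18 * (D%:R * `|p0|%:~R) * (M%:R / (`|p0|%:~R * n)) +
   (2 * n ^+ 2) * (M%:R * (45 * (c * rho)) / (`|p0|%:~R * n)))).
  apply: lerD; last by rewrite natrM natrX.
  by rewrite ler_wpM2r // divr_ge0 // mulr_ge0 ?ltW.
have e1 : 18 * (D%:R * `|p0|%:~R) * (M%:R / (`|p0|%:~R * n)) = 18 * M%:R / Q%:R.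
  by rewrite nQ; field; rewrite !gt_eqF.
have e2 : (2 * n ^+ 2) * (M%:R * (45 * (c * rho)) / (`|p0|%:~R * n)) =
    90 * c * M%:R * rho * n / `|p0|%:~R by field; rewrite !gt_eqF.
have e3 : 90 * c * M%:R * rho * n / `|p0|%:~R <= 45 * c * M%:R / Q%:R.
  rewrite ler_pdivrMr //.
  have hp : 2 * D%:R <= `|p0|%:~R :> R by rewrite -natrM pmulrn ler_int.
  have -> : 90 * c * M%:R * rho * n = 45 * c * M%:R / Q%:R * (2 * D%:R).
    by rewrite /rho nQ; field; rewrite gt_eqF.
  rewrite ler_wpM2l // divr_ge0 ?(ltW Q0) // !mulr_ge0 //; have := c1; lra.
rewrite e1 e2.
have e4 : 18 * M%:R / Q%:R <= 18 * c * M%:R / Q%:R.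
  rewrite ler_wpM2r ?invr_ge0 ?(ltW Q0) // ler_wpM2r //; have := c1; lra.
have -> : 63 * c * M%:R / Q%:R = 18 * c * M%:R / Q%:R + 45 * c * M%:R / Q%:R by ring.
exact: lerD.
Qed.

(** The range of p is cut into 2 K windows, the bad ones being bounded trivially: 141 = 15 + 2 *
    63. *)
Lemma fixed_shift_sum_le : `|\sum_(p <- zrange (- N%:Z) (2 * N)) \sum_(q <- zrange (- N%:Z) (2 * N)) Ps p q| <=
  141 * c * n / Q%:R.
Proof.
have e2N : (2 * N = 2 * K * M)%N by rewrite NK mulnA.
rewrite sum_zrangeE {1}e2N big_nat_mulr.
have -> : \sum_(0 <= j < 2 * K) \sum_(0 <= s < M)
     \sum_(q <- zrange (- N%:Z) (2 * N)) Ps (- N%:Z + (j * M + s)%N%:Z) q =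
   \sum_(0 <= j < 2 * K) window_total (- N%:Z + (j * M)%N%:Z).
  by apply: eq_bigr => j _; apply: eq_bigr => s _; rewrite PoszD addrA.
apply: (@le_trans _ _ (\sum_(0 <= j < 2 * K)
   ((near_bad (- N%:Z + (j * M)%N%:Z))%:R * M%:R + 63 * c * M%:R / Q%:R))).
  have k0 : 0 <= 63 * c * M%:R / Q%:R.
    rewrite divr_ge0 ?(ltW Q0) // !mulr_ge0 //; have := c1; lra.
  apply: ler_norm_sum_seq => j; rewrite mem_index_iota => /andP[_ jK].
  case: (boolP (near_bad _)) => hb; last first.
    rewrite mul0r add0r; apply: window_total_good => //; first by clear; lia.
    by clear -jK NK M1; nia.
  by rewrite mul1r -[leLHS]addr0; apply: lerD => //; exact: window_total_triv.
rewrite big_split /= sumr_const_seq hsz.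
have a1 : \sum_(0 <= j < 2 * K) (near_bad (- N%:Z + (j * M)%N%:Z))%:R * M%:R <= 15 * D%:R :> R.
  apply: le_trans near_bad_count; rewrite sum_zrangeE {1}e2N big_nat_mulr.
  apply: ler_sum => j _; rewrite mulrC -[X in X%:R * _ <= _]hsz -sumr_const_seq.
  rewrite [leLHS]big_seq [leRHS]big_seq; apply: ler_sum => s; rewrite mem_index_iota => /andP[_ sM].
  rewrite ler_nat PoszD addrA; set p := - _ + _.
  case hb : (near_bad p) => //; move: hb; rewrite /near_bad.
  have sD : (s <= D)%N by clear -sM MD; lia.
  case/or3P => hh; rewrite lt0b; apply/or3P.
  - by apply: Or31; move: hh sD; clear; lia.
  - by apply: Or32; move: hh sD; clear; lia.
  - by apply: Or33; move: hh sD; clear; lia.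
have a2 : (2 * K)%:R * (63 * c * M%:R / Q%:R) = 126 * c * n / Q%:R.
  by rewrite /n NK !natrM; ring.
have a3 : 15 * D%:R <= 15 * c * n / Q%:R.
  have -> : 15 * c * n / Q%:R = 15 * c * D%:R by rewrite nQ; field; rewrite gt_eqF.
  rewrite ler_wpM2r ?(ltW D0) //; have := c1; lra.
have -> : 141 * c * n / Q%:R = 15 * c * n / Q%:R + 126 * c * n / Q%:R by ring.
by rewrite a2; apply: lerD => //; apply: le_trans a1 a3.
Qed.

End FixX.

Context {V : finZmodType}.
Variables (e1 e2 : V) (g : V -> R).
Hypotheses (hg : forall P, `|g P| <= 1)
  (hlip : forall P, `|g (P + e2) - g P| <= lam)
  (hW : forall P (S : nat), `|\sum_(0 <= s < S) g (P + e2 *+ s)| <= W).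

(* In the coordinates [tau = X + p], [t = X + p - q], [t' = X - q] the end
   point of the path depends on [p] and [q] only through its height:
   [tau - t + t' = X] and [tau^2 - t^2 + t'^2 = X^2 + 2 p q]. *)
Lemma path_sum_le P : `|path_sum e1 e2 g N H P eta| <= 423 * c * n ^+ 2 / Q%:R.
Proof.
pose gam X y := g (P + pt e1 e2 (- X) (X ^+ 2 + y)).
have gam1 X y : `|gam X y| <= 1 by apply: hg.
have gamL X y : `|gam X (y + 1) - gam X y| <= lam.
  rewrite /gam (_ : P + pt e1 e2 (- X) (X ^+ 2 + (y + 1)) =
     P + pt e1 e2 (- X) (X ^+ 2 + y) + e2) //.
  by rewrite (addrA (X ^+ 2)) /pt mulrzDr mulr1z !addrA.
have gamW X y (S : nat) : `|\sum_(0 <= s < S) gam X (y + s%:Z)| <= W.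
  rewrite (eq_bigr (fun s => g (P + pt e1 e2 (- X) (X ^+ 2 + y) + e2 *+ s))) // => s _.
  by rewrite /gam (addrA (X ^+ 2)) /pt (mulrzDr _ _ s%:Z) -pmulrn !addrA.
(* The total displacement tau - t + t' lies between 0 and 3 N, whence 423 = 3 * 141. *)
suff -> : path_sum e1 e2 g N H P eta = \sum_(X <- zrange 0 (3 * N))
    \sum_(p <- zrange (- N%:Z) (2 * N)) \sum_(q <- zrange (- N%:Z) (2 * N))
    path_term (gam X) N H eta X p q.
  have -> : 423 * c * n ^+ 2 / Q%:R = (3 * N)%:R * (141 * c * n / Q%:R) :> R.
    by rewrite natrM /n; ring.
  rewrite -[X in _ <= X%:R * _](size_zrange 0); apply: ler_norm_sum_const => X _.
  exact: fixed_shift_sum_le.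
(* Extended by 0 outside the ranges of the three steps, so that each variable can be reindexed over
   a range that does not depend on the others. *)
pose F (tau t t' : int) : R := if [&& in_win N tau, in_win N t & in_win N t'] then
   (2 * t%:~R)^-1 * cut_corr e1 e2 g N H (P + pt e1 e2 (- (tau - t + t')) (tau ^+ 2 - t ^+ 2 + t' ^+ 2))
       `|((2 * eta%:Z * tau * t') %/ t)%Z|%N else 0.
have rn : zrange N%:Z N = [seq t%:Z | t <- index_iota N (2 * N)].
  rewrite /zrange /index_iota (_ : (2 * N - N = N)%N); last by clear; lia.
  by rewrite -{3}(addn0 N) iotaDl -map_comp.
have inN (t : int) : (t \in zrange N%:Z N) = in_win N t.
  by rewrite mem_zrange /in_win; congr (_ && _); rewrite mul2n -addnn PoszD.
have -> : path_sum e1 e2 g N H P eta = \sum_(tau <- zrange N%:Z N) \sum_(t <- zrange N%:Z N)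
    \sum_(t' <- zrange N%:Z N) F tau t t'.
  rewrite rn big_map /path_sum; apply: eq_big_nat => tau htau.
  rewrite big_map; apply: eq_big_nat => t ht.
  rewrite big_map mulr_sumr; apply: eq_big_nat => t' ht'.
  rewrite /F /in_win !lez_nat !ltz_nat htau ht ht' /=; congr (_ * cut_corr _ _ _ _ _ _ _).
    by rewrite /pvec /pdiff ptD; congr (_ + pt _ _ _ _); ring.
  by rewrite -!PoszM divz_nat absz_nat.
have supp (X p q : int) : F (X + p) (X + p - q) (X - q) != 0 ->
   [&& in_win N (X + p), in_win N (X + p - q) & in_win N (X - q)].
  by rewrite /F; case: ifP => // _; rewrite eqxx.
have FPsi (X p q : int) : F (X + p) (X + p - q) (X - q) = path_term (gam X) N H eta X p q.
  rewrite /F /path_term; case: ifP => // /and3P[a1 a2 a3]; congr (_ * _).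
  have m0 : 0 <= lag eta X p q.
    rewrite /lag divz_ge0; last by move: a2; rewrite /in_win; clear; lia.
    by move: a1 a3; rewrite /in_win => /andP[b1 _] /andP[b2 _]; rewrite !mulr_ge0 //; move: b1 b2; clear; lia.
  rewrite /cut_corr /corr -/(lag eta X p q) /gam.
  have -> : (`|lag eta X p q|%N%:R : R) = (lag eta X p q)%:~R by rewrite pmulrn abszE ger0_norm.
  congr (_ * (g (P + pt _ _ _ _) * g _)); [ring | ring |].
  by rewrite -addrA ptD abszE ger0_norm //; congr (P + pt _ _ _ _); ring.
(* First t' is replaced by X, then tau by p = tau - X, and finally t by q = X + p - t. *)
transitivity (\sum_(tau <- zrange N%:Z N) \sum_(t <- zrange N%:Z N)
    \sum_(X <- zrange 0 (3 * N)) F tau t (X - (tau - t))).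
  rewrite !big_seq; apply: eq_bigr => tau; rewrite inN => itau.
  rewrite !big_seq; apply: eq_bigr => t; rewrite inN => it.
  rewrite -(@sum_reindex_int R _ (zrange N%:Z N) (zrange 0 (3 * N)) (fun t' => t' + (tau - t))
     (fun X => F tau t (X - (tau - t)))) ?zrange_uniq //.
  - by apply: eq_bigr => t' _; rewrite addrK.
  - exact: addIr.
  - by move=> t'; rewrite inN => it' _; move: itau it it'; rewrite mem_zrange /in_win; clear; lia.
  move=> X _; rewrite /F; case: ifP => [/and3P[_ _ i3] _|]; last by rewrite eqxx.
  by exists (X - (tau - t)); rewrite ?inN // subrK.
under eq_bigr => tau _ do rewrite exchange_big /=.
rewrite exchange_big /=; apply: eq_bigr => X _.
rewrite -(@sum_reindex_int R _ (zrange (- N%:Z) (2 * N)) (zrange N%:Z N) (fun p => X + p)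
   (fun tau => \sum_(t <- zrange N%:Z N) F tau t (X - (tau - t)))) ?zrange_uniq //.
- apply: eq_bigr => p _.
  rewrite -(@sum_reindex_int R _ (zrange (- N%:Z) (2 * N)) (zrange N%:Z N) (fun q => X + p - q)
     (fun t => F (X + p) t (X - (X + p - t)))) ?zrange_uniq //.
  + by apply: eq_bigr => q _; rewrite -FPsi; congr F; ring.
  + by move=> q q' /addrI /oppr_inj.
  + by move=> q _; rewrite /F inN; case: ifP => [/and3P[]|] //; rewrite eqxx.
  + move=> t; rewrite inN => it; rewrite /F.
    case: ifP => [/and3P[j1 _ j3] _|]; last by rewrite eqxx.
    exists (X + p - t); last by ring.
    by move: j1 j3 it; rewrite mem_zrange /in_win; clear; lia.
- exact: addrI.
- move=> p _; rewrite inN => hn; apply/negPn/negP => hI; move/negP: hn; apply.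
  by rewrite big1 // => t _; rewrite /F (negbTE hI).
move=> tau; rewrite inN => itau hn; exists (tau - X); last by ring.
rewrite mem_zrange; apply/negPn/negP => hI; move/negP: hn; apply; apply/eqP.
apply: big1_seq => t /andP[_]; rewrite inN => it; rewrite /F.
case: ifP => // /and3P[_ _ i3]; exfalso; move/negP: hI; apply.
by move: itau it i3; rewrite /in_win; clear; lia.
Qed.

End PathSum.

(** * The corner form with an oscillating third function *)

Section Smoothing.
Context {R : archiRealFieldType} {V : finZmodType}.
Variables (e1 e2 : V) (f1 f3 g : V -> R) (c : R) (q Q N H : nat).
Hypotheses (hf1 : forall P, `|f1 P| <= 1) (hf3 : forall P, `|f3 P| <= 1).
Hypotheses (hg : forall P, `|g P| <= 1).
Let lam : R := c * Q%:R ^+ 60 / N%:R ^+ 2.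
Let W : R := c * N%:R ^+ 2 / Q%:R ^+ 60.
Hypotheses (hlip : forall P, `|g (P + e2) - g P| <= lam)
  (hW : forall P (S : nat), `|\sum_(0 <= s < S) g (P + e2 *+ s)| <= W).
Hypotheses (q2 : (2 <= q)%N) (Qq : Q = (q ^ 8)%N) (NH : N = (Q ^ 32 * H)%N).
Hypotheses (HQ : (Q ^ 32 <= H)%N) (c1 : 1 <= c).

Let v : R := #|V|%:R.
Let n : R := N%:R.
Let h : R := H%:R.
Let r : R := q%:R.
Let x : R := Q%:R.

Let r2 : 2 <= r. Proof. by rewrite ler_nat. Qed.
Let xE : x = r ^+ 8. Proof. by rewrite /x Qq natrX. Qed.
Let q8 : (8 <= Q)%N.
Proof. by rewrite Qq; apply: (@leq_trans (2 ^ 8)); rewrite ?leq_exp2r. Qed.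
Let x8 : 8 <= x. Proof. by rewrite ler_nat. Qed.
Let x0 : 0 < x. Proof. by apply: lt_le_trans x8. Qed.
Let Q0 : (0 < Q)%N. Proof. by apply: leq_trans q8. Qed.
Let H0 : (0 < H)%N. Proof. by apply: leq_trans HQ; rewrite expn_gt0 Q0. Qed.
Let N0 : (0 < N)%N. Proof. by rewrite NH muln_gt0 expn_gt0 Q0 H0. Qed.
Let h0 : 0 < h. Proof. by rewrite ltr0n. Qed.
Let n0 : 0 < n. Proof. by rewrite ltr0n. Qed.
Let v0 : 0 <= v. Proof. by []. Qed.
Let nE : n = x ^+ 32 * h. Proof. by rewrite /n NH natrM natrX. Qed.
Let hx : x ^+ 32 <= h. Proof. by rewrite -natrX ler_nat. Qed.
Let r0 : 0 < r. Proof. by apply: lt_le_trans r2. Qed.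
Let x1 : 1 <= x. Proof. by apply: le_trans x8; rewrite ler1n. Qed.

Let xpow (i j : nat) : (i <= j)%N -> x ^+ i <= x ^+ j.
Proof. by move=> ij; rewrite ler_weXn2l. Qed.

Let lamE : lam = c * x ^+ 60 / n ^+ 2. Proof. by []. Qed.

Let hn : 0 <= h := ltW h0.
Let nn : 0 <= n := ltW n0.
Let xn : 0 <= x := ltW x0.
Let rn : 0 <= r := ltW r0.

Let nlam : n * lam <= c / x ^+ 4.
Proof.
have -> : n * lam = c / x ^+ 4 * (x ^+ 64 / n) by rewrite lamE; field; rewrite !gt_eqF.
rewrite ler_piMr ?divr_ge0 ?exprn_ge0 ?(ltW x0) //; first by have := c1; lra.
rewrite ler_pdivrMr // mul1r nE (_ : x ^+ 64 = x ^+ 32 * x ^+ 32); last by ring.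
by rewrite ler_wpM2l // exprn_ge0 //.
Qed.

Let cx4 : c / x ^+ 4 <= c / x.
Proof.
apply: ler_wpM2l; first by have := c1; lra.
by rewrite lef_pV2 ?posrE ?exprn_gt0 // -{1}(expr1 x) xpow.
Qed.

Lemma path_sum_small P eta : (eta < 4 * H)%N -> (H <= Q * eta)%N ->
  `|path_sum e1 e2 g N H P eta| <= 423 * c * n ^+ 2 / x.
Proof.
move=> eH Qe; have q2' : (2 <= Q)%N by apply: leq_trans q8.
have c0 : 0 <= c by have := c1; lra.
have NH' : N = (Q * (Q ^ 31 * H))%N by rewrite mulnA -expnS.
have NK' : N = (Q ^ 20 * (Q ^ 12 * H))%N by rewrite mulnA -expnD.
have pw i j : (i <= j)%N -> (Q ^ i <= Q ^ j)%N by move=> ij; rewrite leq_pexp2l.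
rewrite /n /x.
(* With M = Q^12 H the two decisive conditions become Q^24 <= Q^30, for the second order part of the
   lag, and 4 Q^7 <= Q^10, for the cancellation in the progression. *)
apply: (@path_sum_le R lam W c N (Q ^ 12 * H) (Q ^ 31 * H) H Q eta (Q ^ 20)
  q2' _ NH' _ _ _ _ _ _ _ NK' c1 _ _ _ V e1 e2 g hg hlip hW).
- by rewrite muln_gt0 expn_gt0 Q0 H0.
- by rewrite mulnAC -expnD leq_mul2r pw // orbT.
- apply: (@leq_trans (Q ^ 32)); last by rewrite (leq_trans HQ) // leq_pmull // expn_gt0 Q0.
  apply: leq_trans (pw 2%N 32%N isT); rewrite expnS expn1.
  exact: leq_trans (leq_mul q8 q8).
- by rewrite NH leq_pmull // expn_gt0 Q0.
- exact: ltnW.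
- exact: Qe.
- apply: leq_trans HQ; apply: (@leq_trans (Q * Q ^ 3)); first by rewrite leq_mul2r q8 orbT.
  by rewrite -expnS pw.
- rewrite NH; apply: (@leq_trans (Q ^ 32)); first exact: pw.
  by rewrite leq_pmulr.
- rewrite mulrC; apply: le_trans nlam _; rewrite ler_wpM2l //.
  by rewrite lef_pV2 ?posrE ?exprn_gt0 // xpow.
- rewrite natrM natrX -/x -/h -/n.
  have -> : lam * (h * (x ^+ 12 * h) ^+ 2 * x ^+ 4) = c * h * x ^+ 24.
    by rewrite lamE nE; field; rewrite !gt_eqF.
  have -> : c * x ^- 2 * n = c * h * x ^+ 30 by rewrite nE; field; rewrite gt_eqF.
  by rewrite ler_wpM2l ?xpow // mulr_ge0 //.
rewrite natrM natrX -/x -/h.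
have -> : W * (4 * x ^+ 3) = c * h ^+ 2 * x ^+ 7 * 4.
  by rewrite /W -/n -/x nE; field; rewrite gt_eqF.
have -> : c * x ^- 2 * (x ^+ 12 * h * h) = c * h ^+ 2 * x ^+ 7 * x ^+ 3.
  by field; rewrite gt_eqF.
rewrite ler_wpM2l //; first by rewrite !mulr_ge0 ?exprn_ge0 //.
apply: le_trans (_ : x ^+ 1 <= _); last exact: xpow.
by rewrite expr1; apply: le_trans x8; rewrite ler_nat.
Qed.

Lemma path_sum_triv P eta : `|path_sum e1 e2 g N H P eta| <= n ^+ 2.
Proof.
have -> : n ^+ 2 = n * (n * (n^-1 * n)) by rewrite mulVf ?mulr1 ?expr2 // gt_eqF.
rewrite /n -[X in _ <= X%:R * _]size_irange; apply: ler_norm_sum_const => tau _.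
rewrite /n -[X in _ <= X%:R * _]size_irange; apply: ler_norm_sum_const => t.
rewrite mem_index_iota => /andP[tN _].
have t0 : 0 < t%:R :> R by rewrite ltr0n (leq_trans N0).
rewrite normrM ger0_norm ?invr_ge0 ?mulr_ge0 //; apply: ler_pM => //.
- by rewrite invr_ge0 mulr_ge0.
- rewrite lef_pV2 ?posrE ?mulr_gt0 //.
  by apply: le_trans (_ : t%:R <= _); rewrite ?ler_nat // ler_peMl // ler1n.
rewrite -[leRHS]mulr1 -[X in _ <= X%:R * _]size_irange; apply: ler_norm_sum_const => t' _.
exact: cut_corr_le1.
Qed.

Let ncut_lip : n * cut_lip lam N H <= 2 * (c / x).
Proof.
rewrite /cut_lip mulrDr; have -> : n * (cut_scale N H)^-1 = (4 * h)^-1.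
  by rewrite /cut_scale !natrM -/n -/h; field; rewrite !gt_eqF.
have e : (4 * h)^-1 <= c / x.
  apply: (@le_trans _ _ x^-1); last first.
    by rewrite ler_peMl ?invr_ge0 ?(ltW x0).
  rewrite lef_pV2 ?posrE ?mulr_gt0 //; apply: le_trans (_ : h <= _).
    by apply: le_trans hx; rewrite -{1}(expr1 x) xpow.
  by rewrite ler_peMl ?(ltW h0) // ler1n.
have := le_trans nlam cx4; lra.
Qed.

(** The eta below H / Q, for which the slope of the lag may be too small, number at most 2 H / Q and
    are estimated trivially; in the proof 1694 = 4 * 423 + 2. *)
Lemma fiber_energy_bound : fiber_energy e1 e2 g N H <= 1730 * c * v * n ^+ 3 * h / x.
Proof.
have c0 : 0 <= c by have := c1; lra.
apply: le_trans (@fiber_energy_le R V e1 e2 g lam N H hg hlip N0 H0) _.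
have cxn : 0 <= c / x by rewrite divr_ge0 //.
have e1' : \sum_(P : V) \sum_(0 <= eta < 4 * H) `|path_sum e1 e2 g N H P eta| <=
    v * (1694 * c * n ^+ 2 * h / x).
  rewrite /v -size_index_enum; apply: ler_sum_const => P _.
  apply: (@le_trans _ _ (\sum_(0 <= eta < 4 * H)
     ((Q * eta < H)%N%:R * n ^+ 2 + 423 * c * n ^+ 2 / x))).
    have k0 : 0 <= 423 * c * n ^+ 2 / x.
      by rewrite divr_ge0 ?(ltW x0) // !mulr_ge0 // exprn_ge0 //.
    rewrite !big_seq; apply: ler_sum => eta; rewrite mem_index_iota => /andP[_ eH].
    case: ltnP => Qe; last by rewrite mul0r add0r; apply: path_sum_small.
    by rewrite mul1r; apply: le_trans (path_sum_triv _ _) _; rewrite lerDl.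
  rewrite big_split /= sumr_const_seq size_iota subn0 -mulr_suml.
  have -> : \sum_(0 <= eta < 4 * H) (Q * eta < H)%N%:R = \sum_(0 <= eta < 4 * H | (Q * eta < H)%N) (1 : R).
    by rewrite [RHS]big_mkcond; apply: eq_bigr => i _; case: ifP.
  have cnt : \sum_(0 <= eta < 4 * H | (Q * eta < H)%N) (1 : R) <= 2 * h / x.
    apply: (@le_trans _ _ (\sum_(0 <= eta < (H %/ Q).+1) 1)).
      rewrite -big_filter !sumr_const_seq !mulr1 ler_nat.
      apply: uniq_leq_size; first by rewrite filter_uniq // iota_uniq.
      move=> eta; rewrite mem_filter !mem_index_iota => /andP[a _] /=.
      by rewrite ltnS leq_divRL // mulnC ltnW.
    rewrite sumr_const_seq size_iota subn0 mulr1 -natr1 ler_pdivlMr // mulrDl mul1r.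
    have a1 : (H %/ Q)%:R * x <= h by rewrite -natrM ler_nat leq_trunc_div.
    have a2 : x <= h by apply: le_trans hx; rewrite -{1}(expr1 x) xpow.
    lra.
  have a3 : 2 * h / x <= 2 * c * h / x.
    rewrite ler_wpM2r ?invr_ge0 ?(ltW x0) // ler_wpM2r ?(ltW h0) //; have := c1; lra.
  have -> : 1694 * c * n ^+ 2 * h / x = 2 * c * h / x * n ^+ 2 +
     (4 * H)%:R * (423 * c * n ^+ 2 / x) by rewrite natrM -/h; field; rewrite gt_eqF.
  by rewrite lerD2r ler_wpM2r ?exprn_ge0 ?(ltW n0) // (le_trans cnt).
have e2' : 18 * v * n ^+ 4 * h * cut_lip lam N H <= 18 * v * n ^+ 3 * h * (2 * (c / x)).
  have -> : 18 * v * n ^+ 4 * h * cut_lip lam N H = 18 * v * n ^+ 3 * h * (n * cut_lip lam N H) by ring.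
  by rewrite ler_wpM2l // !mulr_ge0 ?exprn_ge0.
have -> : 1730 * c * v * n ^+ 3 * h / x = n * (v * (1694 * c * n ^+ 2 * h / x)) +
    18 * v * n ^+ 3 * h * (2 * (c / x)) by field; rewrite gt_eqF.
by apply: lerD => //; rewrite ler_wpM2l //.
Qed.

Lemma abs_le_of_sqr (a b : R) : 0 <= b -> a ^+ 2 <= b ^+ 2 -> `|a| <= b.
Proof. by move=> b0; rewrite -(real_normK (num_real a)) ler_sqr ?nnegrE. Qed.

(** This serves to replace the square roots of c produced by Cauchy-Schwarz by c itself. *)
Let cc : c <= c ^+ 2. Proof. by rewrite expr2 ler_peMr //; have := c1; lra. Qed.

Lemma cut_corr_energy_bound : cut_corr_energy e1 e2 g N H <= 200 * c * v * n ^+ 2 * h / r ^+ 4.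
Proof.
have c0 : 0 <= c by have := c1; lra.
apply: le_trans (@cut_corr_energy_le R V e1 e2 g lam N H hg hlip N0 H0) _.
have k0 : 0 <= v * n ^+ 2 * h by rewrite !mulr_ge0 ?exprn_ge0.
have a1 : \sum_(P : V) \sum_(0 <= k < 16 * N * H) `|fiber_avg e1 e2 g N H P k| <=
   168 * c * v * n ^+ 2 * h / r ^+ 4.
  apply: le_trans (ler_norm _) _; apply: abs_le_of_sqr.
    by rewrite divr_ge0 ?exprn_ge0 // !mulr_ge0 // exprn_ge0.
  apply: le_trans (fiber_avg_sum_le _ _ _ _ _) _.
  apply: (@le_trans _ _ (16 * v * n * h * (1730 * c * v * n ^+ 3 * h / x))).
    rewrite !natrM -/v -/n -/h (_ : v * (16 * n * h) = 16 * v * n * h); last by ring.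
    by rewrite ler_wpM2l ?fiber_energy_bound // !mulr_ge0.
  have -> : 16 * v * n * h * (1730 * c * v * n ^+ 3 * h / x) =
     16 * (1730 * c * ((v * n ^+ 2 * h) ^+ 2 / r ^+ 8)).
    by rewrite xE; field; rewrite gt_eqF.
  have -> : (168 * c * v * n ^+ 2 * h / r ^+ 4) ^+ 2 =
     16 * (1764 * c ^+ 2 * ((v * n ^+ 2 * h) ^+ 2 / r ^+ 8)) by field; rewrite gt_eqF.
  rewrite ler_pM2l // ler_wpM2r //; first by rewrite divr_ge0 ?exprn_ge0 ?(ltW r0).
  by have := cc; have := c0; lra.
have a2 : 16 * v * n ^+ 3 * h * cut_lip lam N H <= 32 * c * v * n ^+ 2 * h / r ^+ 4.
  have -> : 16 * v * n ^+ 3 * h * cut_lip lam N H = 16 * (v * n ^+ 2 * h) * (n * cut_lip lam N H) by ring.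
  apply: (@le_trans _ _ (16 * (v * n ^+ 2 * h) * (2 * (c / r ^+ 4)))).
    rewrite ler_wpM2l ?mulr_ge0 //; apply: le_trans ncut_lip _.
    rewrite ler_wpM2l // ler_wpM2l // lef_pV2 ?posrE ?exprn_gt0 // xE.
    by rewrite ler_weXn2l //; have := r2; lra.
  by rewrite le_eqVlt; apply/orP; left; apply/eqP; field; rewrite gt_eqF.
have -> : 200 * c * v * n ^+ 2 * h / r ^+ 4 = 168 * c * v * n ^+ 2 * h / r ^+ 4 +
  32 * c * v * n ^+ 2 * h / r ^+ 4 by field; rewrite gt_eqF.
exact: lerD.
Qed.

Lemma corr_sum_bound : corr_sum e1 e2 g N H <= 15 * c * v * n * h / r ^+ 2.
Proof.
have c0 : 0 <= c by have := c1; lra.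
have k0 : 0 <= v * n * h by rewrite !mulr_ge0 //.
apply: le_trans (ler_norm _) _; apply: abs_le_of_sqr.
  by rewrite divr_ge0 ?exprn_ge0 // !mulr_ge0 // exprn_ge0.
apply: le_trans (@corr_sum_le R V e1 e2 g N H N0 H0) _.
apply: (@le_trans _ _ (h * v * (200 * c * v * n ^+ 2 * h / r ^+ 4))).
  by rewrite natrM ler_wpM2l ?cut_corr_energy_bound // mulr_ge0.
have -> : h * v * (200 * c * v * n ^+ 2 * h / r ^+ 4) =
   200 * c * ((v * n * h) ^+ 2 / r ^+ 4) by field; rewrite gt_eqF.
have -> : (15 * c * v * n * h / r ^+ 2) ^+ 2 =
   225 * c ^+ 2 * ((v * n * h) ^+ 2 / r ^+ 4) by field; rewrite gt_eqF.
rewrite ler_wpM2r //; first by rewrite divr_ge0 ?exprn_ge0 ?(ltW r0).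
by have := cc; have := c0; lra.
Qed.

(** The gain 1 / x = r^-8 for [fiber_energy] turns into r^-4 for [cut_corr_energy], r^-2 for
    [corr_sum] and r^-1 for the form. All Lipschitz and boundary errors are of smaller order because
    H^2 is below the scale of [g] and H is below N. *)
Theorem smoothing : `|cform e1 e2 f1 f3 g N| <= 8 * c * v * n / r.
Proof.
have c0 : 0 <= c by have := c1; lra.
have k0 : 0 <= v * n * h by rewrite !mulr_ge0 //.
have b1 : \sum_(0 <= h < H) vdc_bound e1 e2 g lam N H h <= 18 * c * v * n * h / r ^+ 2.
  rewrite /vdc_bound big_split /= -/(corr_sum e1 e2 g N H) sumr_const_seq size_iota subn0.
  have -> : 18 * c * v * n * h / r ^+ 2 = 15 * c * v * n * h / r ^+ 2 +
     3 * c * v * n * h / r ^+ 2 by field; rewrite gt_eqF.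
  apply: lerD; first exact: corr_sum_bound.
  rewrite -/h -/v -/n.
  have -> : h * (v * (2 * h + n * (lam * h ^+ 2))) =
     (v * n * h) * (2 / x ^+ 32 + c / x ^+ 4).
    by rewrite lamE nE; field; rewrite !gt_eqF.
  have -> : 3 * c * v * n * h / r ^+ 2 = (v * n * h) * (3 * (c / r ^+ 2)) by ring.
  rewrite ler_wpM2l //.
  have s1 : x ^- 32 <= r ^- 2.
    by rewrite lef_pV2 ?posrE ?exprn_gt0 // xE -exprM ler_weXn2l //; have := r2; lra.
  have s2 : x ^- 4 <= r ^- 2.
    by rewrite lef_pV2 ?posrE ?exprn_gt0 // xE -exprM ler_weXn2l //; have := r2; lra.
  have s3 : c / x ^+ 4 <= c / r ^+ 2 by rewrite ler_wpM2l.
  have s4 : r ^- 2 <= c / r ^+ 2 by rewrite ler_peMl // invr_ge0 exprn_ge0 //.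
  lra.
have b2 : `|cform_avg e1 e2 f1 f3 g N H| <= 6 * c * v * n * h / r.
  apply: abs_le_of_sqr.
    by rewrite divr_ge0 ?(ltW r0) // -!mulrA mulr_ge0 // mulr_ge0 // mulrA.
  apply: le_trans (@cform_avg_le R V e1 e2 f1 f3 g lam N H hf1 hf3 hg hlip) _.
  rewrite natrM -/v -/n -/h.
  apply: (@le_trans _ _ (v * n * (2 * h * (18 * c * v * n * h / r ^+ 2)))).
    by rewrite ler_wpM2l ?mulr_ge0 ?(ltW n0) // ler_wpM2l // mulr_ge0 //.
  have -> : v * n * (2 * h * (18 * c * v * n * h / r ^+ 2)) =
     36 * c * ((v * n * h) ^+ 2 / r ^+ 2) by field; rewrite gt_eqF.
  have -> : (6 * c * v * n * h / r) ^+ 2 =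
     36 * c ^+ 2 * ((v * n * h) ^+ 2 / r ^+ 2) by field; rewrite gt_eqF.
  rewrite ler_wpM2r //; first by rewrite divr_ge0 ?exprn_ge0 ?(ltW r0).
  by have := cc; have := c0; lra.
have b3 := @cform_avg_close R V e1 e2 f1 f3 g N H hf1 hf3 hg.
rewrite -/h -/v in b3.
have b4 : h * `|cform e1 e2 f1 f3 g N| <= 6 * c * v * n * h / r + v * (h * (2 * h)).
  rewrite -{1}(ger0_norm (ltW h0)) -normrM.
  have := ler_normD (h * cform e1 e2 f1 f3 g N - cform_avg e1 e2 f1 f3 g N H) (cform_avg e1 e2 f1 f3 g N H).
  by rewrite subrK; lra.
rewrite -(ler_pM2l h0); apply: le_trans b4 _.
have -> : h * (8 * c * v * n / r) = 6 * c * v * n * h / r + v * h * (2 * (c * n / r)).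
  by field; rewrite gt_eqF.
rewrite lerD2l mulrA ler_wpM2l ?mulr_ge0 ?(ltW h0) // ler_wpM2l //.
rewrite ler_pdivlMr //; apply: (@le_trans _ _ n); last by rewrite ler_peMl //.
rewrite mulrC nE ler_wpM2r ?(ltW h0) // xE -exprM -{1}(expr1 r) ler_weXn2l //.
by have := r2; lra.
Qed.

End Smoothing.

(** * Averages over cells and moving averages *)

Section Cells.
Context {R : archiRealFieldType} {V : finZmodType}.
Variables (e : V) (pos : V -> nat) (m : nat).
Hypothesis hpos : forall P, pos (P + e) = (pos P).+1 %[mod m].
Implicit Types (phi psi u : V -> R) (c : nat).

(** The first point of the cell of length c that contains [P]. Since positions along [e] are
    controlled modulo m only, cells are used for divisors c of m. *)
Definition base c (P : V) : V := P - e *+ (pos P %% c).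
Definition avg c phi (P : V) : R :=
  c%:R^-1 * \sum_(0 <= j < c) phi (base c P + e *+ j).
Definition cell_const c psi :=
  forall B i, (c %| pos B)%N -> (i < c)%N -> psi (B + e *+ i) = psi B.

Let hsz k : size (index_iota 0 k) = k. Proof. by rewrite size_iota subn0. Qed.

Lemma pos_mod c P j : (c %| m)%N -> pos (P + e *+ j) = (pos P + j)%N %[mod c].
Proof.
move=> cm; elim: j => [|j ih]; first by rewrite mulr0n addr0 addn0.
rewrite mulrSr addrA; have := congr1 (modn^~ c) (hpos (P + e *+ j)).
rewrite !modn_dvdm // => ->; by rewrite -addn1 -modnDml ih modnDml addn1 addnS.
Qed.

Lemma pos_base c P : (c %| m)%N -> (c %| pos (base c P))%N.
Proof.
move=> cm; have := pos_mod (base c P) (pos P %% c) cm.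
rewrite /base subrK -/(base c P) => h.
rewrite /dvdn; case: (posnP c) => [c0|c0].
  move: cm h; rewrite c0 dvd0n => /eqP m0; rewrite !modn0.
  by move/eqP; rewrite -{1}(add0n (pos P)) eqn_add2r eq_sym.
have := h; rewrite modnDmr -{1}(add0n (pos P)) => /eqP.
by rewrite eqn_modDr mod0n eq_sym.
Qed.

Lemma base_add c B i : (c %| m)%N -> (c %| pos B)%N -> (i < c)%N ->
  base c (B + e *+ i) = B.
Proof.
move=> cm cB ic; rewrite /base pos_mod // -modnDml (eqP cB) add0n modn_small //.
by rewrite addrK.
Qed.

Lemma baseK c P : P = base c P + e *+ (pos P %% c).
Proof. by rewrite /base subrK. Qed.

Lemma sum_cells c (F : V -> R) : (0 < c)%N -> (c %| m)%N ->
  \sum_(P : V) F P =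
  \sum_(B : V | (c %| pos B)%N) \sum_(0 <= i < c) F (B + e *+ i).
Proof.
move=> c0 cm; rewrite exchange_big /= big_mkord.
rewrite (partition_big (fun P => Ordinal (ltn_pmod (pos P) c0)) xpredT) //=.
apply: eq_bigr => i _; rewrite (reindex_inj (addIr (e *+ i))) /=.
apply: eq_bigl => P; rewrite -val_eqE /= pos_mod // /dvdn.
rewrite -{2}(modn_small (ltn_ord i)) -{2}(add0n (i : nat)) eqn_modDr mod0n.
by [].
Qed.

Lemma card_cells c : (0 < c)%N -> (c %| m)%N ->
  c%:R * \sum_(B : V | (c %| pos B)%N) 1 = #|V|%:R :> R.
Proof.
move=> c0 cm; rewrite -[#|V|]size_index_enum -[RHS]mulr1 -sumr_const_seq.
rewrite (sum_cells _ c0 cm) mulr_sumr; apply: eq_bigr => B _.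
by rewrite sumr_const_seq hsz.
Qed.

Lemma avgE c phi B i : (c %| m)%N -> (c %| pos B)%N -> (i < c)%N ->
  avg c phi (B + e *+ i) = c%:R^-1 * \sum_(0 <= j < c) phi (B + e *+ j).
Proof. by move=> cm cB ic; rewrite /avg base_add. Qed.

Lemma avg_cell_const c phi : (c %| m)%N -> cell_const c (avg c phi).
Proof.
move=> cm B i cB ic; rewrite avgE //.
have c0 : (0 < c)%N by apply: leq_trans ic.
by rewrite -(avgE phi cm cB c0) mulr0n addr0.
Qed.

(** [avg c] is the conditional expectation on the cells, that is, the orthogonal projection onto the
    functions constant on them. *)
Lemma avg_adj c phi psi : (0 < c)%N -> (c %| m)%N -> cell_const c psi ->
  \sum_(P : V) avg c phi P * psi P = \sum_(P : V) phi P * psi P.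
Proof.
move=> c0 cm cc; rewrite !(sum_cells _ c0 cm); apply: eq_bigr => B cB.
rewrite (eq_big_nat _ _ (F2 := fun=> c%:R^-1 * (\sum_(0 <= j < c) phi (B + e *+ j)) * psi B)).
  rewrite sumr_const_seq hsz !mulrA divff ?mul1r ?pnatr_eq0 -?lt0n //.
  by rewrite mulr_suml; apply: eq_big_nat => i /andP[_ ic]; rewrite cc.
by move=> i /andP[_ ic]; rewrite avgE // cc.
Qed.

Lemma avg_ge0 c phi P : (forall P, 0 <= phi P) -> 0 <= avg c phi P.
Proof. by move=> h; rewrite mulr_ge0 ?invr_ge0 //; apply: sumr_ge0. Qed.

Lemma avg_le1 c phi P : (0 < c)%N -> (forall P, phi P <= 1) -> avg c phi P <= 1.
Proof.
move=> c0 h; rewrite /avg mulrC ler_pdivrMr ?ltr0n // mul1r -[leRHS]mulr1.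
by rewrite -[X in _ <= X%:R * _]hsz; apply: ler_sum_const.
Qed.

Lemma cell_const_dvd c c' psi : (0 < c)%N -> (c %| m)%N -> (c' %| c)%N ->
  cell_const c psi -> cell_const c' psi.
Proof.
move=> c0 cm cc' h B i cB ic.
have jc : (pos B %% c < c)%N by rewrite ltn_mod.
have jc' : (c' %| pos B %% c)%N by rewrite /dvdn modn_dvdm.
have lt : (pos B %% c + i < c)%N.
  have /dvdnP[k ek] := cc'; have /dvdnP[l el] := jc'.
  rewrite el ek in jc *; have c'0 : (0 < c')%N by apply: leq_trans ic.
  rewrite ltn_pmul2r // in jc; apply: (@leq_trans (l.+1 * c')%N).
    by rewrite mulSn addnC ltn_add2r.
  by rewrite leq_mul2r jc orbT.
rewrite {1}(baseK c B) {3}(baseK c B) -addrA -mulrnDr.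
by have cb := pos_base B cm; rewrite !h.
Qed.

(** Pythagoras for nested orthogonal projections. *)
Lemma avg_energy c c' phi : (0 < c)%N -> (0 < c')%N -> (c %| m)%N -> (c' %| c)%N ->
  \sum_(P : V) (avg c' phi P - avg c phi P) ^+ 2 =
  \sum_(P : V) avg c' phi P ^+ 2 - \sum_(P : V) avg c phi P ^+ 2.
Proof.
move=> c0 c'0 cm cc'; have c'm := dvdn_trans cc' cm.
have k1 : cell_const c' (avg c phi) := cell_const_dvd c0 cm cc' (avg_cell_const phi cm).
have a1 := avg_adj phi c'0 c'm k1.
have a2 := avg_adj phi c0 cm (avg_cell_const phi cm).
rewrite (eq_bigr (fun P => avg c' phi P ^+ 2 + avg c phi P * avg c phi P -
   2 * (avg c' phi P * avg c phi P))); last by move=> P _; ring.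
rewrite sumrB big_split /= -mulr_sumr a1 -a2.
rewrite (eq_bigr (fun P => avg c phi P ^+ 2) (F1 := fun P => avg c phi P * avg c phi P)) //.
ring.
Qed.

(** Only the last s points of a cell leave it under the shift. *)
Lemma cell_shift c u s : (0 < c)%N -> (c %| m)%N -> cell_const c u -> (s <= c)%N ->
  (forall P P', `|u P - u P'| <= 1) ->
  \sum_(P : V) `|u (P + e *+ s) - u P| <= #|V|%:R * (s%:R / c%:R).
Proof.
move=> c0 cm cc sc u1; rewrite (sum_cells _ c0 cm) -(card_cells c0 cm).
have cR : (c%:R : R) != 0 by rewrite pnatr_eq0 -lt0n.
rewrite mulrC mulrA divfK // mulr_sumr; apply: ler_sum => B cB; rewrite mulr1.
rewrite (big_cat_nat (leq0n _) (leq_subr s c)) /= big_nat big1 ?add0r.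
  have -> : s%:R = (size (index_iota (c - s) c))%:R * 1 :> R.
    by rewrite size_iota subKn // mulr1.
  by apply: ler_sum_const.
move=> i /andP[_ ic]; rewrite -addrA -mulrnDr !cc ?subrr ?normr0 //.
- by move: ic sc; clear; lia.
- by move: ic sc; clear; lia.
Qed.

(** Sums over full cells vanish. The interval is the difference of two intervals that start at the
    base of the first cell, each of which leaves one partial cell. *)
Lemma avg_interval c phi P S : (0 < c)%N -> (c %| m)%N ->
  (forall P, `|phi P - avg c phi P| <= 1) ->
  `|\sum_(0 <= j < S) (phi (P + e *+ j) - avg c phi (P + e *+ j))| <= 2 * c%:R.
Proof.
move=> c0 cm h1; pose psi P := phi P - avg c phi P.
have cR : (c%:R : R) != 0 by rewrite pnatr_eq0 -lt0n.
have z B : (c %| pos B)%N -> \sum_(0 <= i < c) psi (B + e *+ i) = 0.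
  move=> cB; rewrite sumrB; apply/eqP; rewrite subr_eq0; apply/eqP.
  rewrite [RHS](eq_big_nat _ _ (F2 := fun=> c%:R^-1 * \sum_(0 <= j < c) phi (B + e *+ j))).
    by rewrite sumr_const_seq hsz mulrA divff // mul1r.
  by move=> i /andP[_ ic]; rewrite avgE.
pose B0 := base c P; have cB0 : (c %| pos B0)%N by apply: pos_base.
have part k : `|\sum_(0 <= j < k) psi (B0 + e *+ j)| <= c%:R.
  rewrite {1}(divn_eq k c) (big_cat_nat (leq0n _) (leq_addr (k %% c) (k %/ c * c))) /=.
  rewrite big_nat_mulr big1 ?add0r.
    rewrite -{1}(add0n (k %/ c * c)%N) big_addn addKn -[leRHS]mulr1.
    apply: (@le_trans _ _ ((k %% c)%:R * 1)).
      rewrite -[X in _ <= X%:R * _]hsz; apply: ler_norm_sum_const => i _; exact: h1.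
    by rewrite !mulr1 ler_nat ltnW // ltn_mod.
  move=> i _; under eq_bigr do rewrite mulrnDr addrA.
  apply: z; rewrite /dvdn pos_mod // -modnDml (eqP cB0) add0n modnMl //.
have -> : \sum_(0 <= j < S) (phi (P + e *+ j) - avg c phi (P + e *+ j)) =
   \sum_(0 <= j < pos P %% c + S) psi (B0 + e *+ j) - \sum_(0 <= j < pos P %% c) psi (B0 + e *+ j).
  rewrite (big_cat_nat (leq0n _) (leq_addr S (pos P %% c))) /= [RHS]addrC addKr.
  rewrite -{1}(add0n (pos P %% c)%N) big_addn addKn; apply: eq_bigr => j _.
  by rewrite {1 2}(baseK c P) -!addrA -!mulrnDr addnC.
apply: le_trans (ler_normB _ _) _.
have := part (pos P %% c + S)%N; have := part (pos P %% c)%N; lra.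
Qed.

End Cells.

Section MovingAverage.
Context {R : archiRealFieldType} {V : finZmodType}.
Variables (e : V).
Implicit Types (f u : V -> R) (w : nat).

Definition mavg w f (P : V) : R := w%:R^-1 * \sum_(0 <= s < w) f (P + e *+ s).

Let hsz k : size (index_iota 0 k) = k. Proof. by rewrite size_iota subn0. Qed.

Lemma mavgB w f u P : mavg w f P - mavg w u P = mavg w (fun P => f P - u P) P.
Proof. by rewrite /mavg -mulrBr sumrB. Qed.

Lemma mavg_ge0 w f P : (forall P, 0 <= f P) -> 0 <= mavg w f P.
Proof. by move=> h; rewrite mulr_ge0 ?invr_ge0 //; apply: sumr_ge0. Qed.

Lemma mavg_le1 w f P : (0 < w)%N -> (forall P, f P <= 1) -> mavg w f P <= 1.
Proof.
move=> w0 h; rewrite /mavg mulrC ler_pdivrMr ?ltr0n // mul1r -[leRHS]mulr1.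
by rewrite -[X in _ <= X%:R * _]hsz; apply: ler_sum_const.
Qed.

Lemma mavg_lip w f P : (0 < w)%N -> (forall P, `|f P| <= 1) ->
  `|mavg w f (P + e) - mavg w f P| <= 2 / w%:R.
Proof.
move=> w0 h; rewrite /mavg -mulrBr mulrC; apply: norm_div_le; first by rewrite ltr0n.
rewrite divfK ?pnatr_eq0 -?lt0n //.
rewrite (eq_bigr (fun s => f (P + e *+ s.+1))); last by move=> s _; rewrite mulrS addrA.
rewrite -sumrB (GRing.telescope_sumr (fun s => f (P + e *+ s))) //.
by apply: le_trans (ler_normB _ _) _; rewrite (_ : 2 = 1 + 1) //; apply: lerD.
Qed.

Lemma mavg_interval w f P S : (0 < w)%N -> (forall P, `|f P| <= 1) ->
  `|\sum_(0 <= j < S) mavg w f (P + e *+ j) - \sum_(0 <= j < S) f (P + e *+ j)|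
  <= 2 * w%:R.
Proof.
move=> w0 h; have wR : (w%:R : R) != 0 by rewrite pnatr_eq0 -lt0n.
have shift s : `|\sum_(0 <= j < S) f (P + e *+ (j + s)) - \sum_(0 <= j < S) f (P + e *+ j)|
    <= 2 * s%:R.
  elim: s => [|s ih].
    by under eq_bigr do rewrite addn0; rewrite subrr normr0 mulr0.
  apply: le_trans (ler_distD (\sum_(0 <= j < S) f (P + e *+ (j + s))) _ _) _.
  have : `|\sum_(0 <= j < S) f (P + e *+ (j + s.+1)) - \sum_(0 <= j < S) f (P + e *+ (j + s))| <= 2.
    under eq_bigr do rewrite addnS -addSn.
    rewrite -sumrB (GRing.telescope_sumr (fun j => f (P + e *+ (j + s)))) //.
    by apply: le_trans (ler_normB _ _) _; rewrite (_ : 2 = 1 + 1) //; apply: lerD.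
  by move: ih; rewrite -natr1; lra.
have -> : \sum_(0 <= j < S) mavg w f (P + e *+ j) - \sum_(0 <= j < S) f (P + e *+ j) =
   (\sum_(0 <= s < w) (\sum_(0 <= j < S) f (P + e *+ (j + s)) -
      \sum_(0 <= j < S) f (P + e *+ j))) / w%:R.
  rewrite sumrB sumr_const_seq hsz mulrBl mulrAC divff // mul1r; congr (_ - _).
  rewrite /mavg -mulr_sumr mulrC exchange_big /=; congr (_ / _).
  by apply: eq_bigr => s _; apply: eq_bigr => j _; rewrite mulrnDr addrA.
apply: norm_div_le; first by rewrite ltr0n.
rewrite mulrC -[X in _ <= X%:R * _]hsz; apply: ler_norm_sum_const => s.
rewrite mem_index_iota => /andP[_ sw]; apply: le_trans (shift s) _.
by rewrite ler_pM2l // ler_nat ltnW.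
Qed.

Lemma mavg_L1 w f : (0 < w)%N -> \sum_(P : V) `|mavg w f P| <= \sum_(P : V) `|f P|.
Proof.
move=> w0; apply: (@le_trans _ _ (\sum_(P : V) w%:R^-1 * \sum_(0 <= s < w) `|f (P + e *+ s)|)).
  apply: ler_sum => P _; rewrite /mavg normrM ger0_norm ?invr_ge0 //.
  by rewrite ler_wpM2l ?invr_ge0 //; apply: ler_norm_sum.
rewrite -mulr_sumr exchange_big /= mulrC ler_pdivrMr ?ltr0n // mulrC.
rewrite -[X in _ <= X%:R * _]hsz; apply: ler_sum_const => s _.
by rewrite (sum_translate (e *+ s) (fun P => `|f P|)).
Qed.

Variables (pos : V -> nat) (m : nat).
Hypothesis hpos : forall P, pos (P + e) = (pos P).+1 %[mod m].

Lemma mavg_cell c w u : (0 < c)%N -> (0 < w)%N -> (w <= c)%N -> (c %| m)%N ->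
  cell_const e pos c u -> (forall P P', `|u P - u P'| <= 1) ->
  \sum_(P : V) `|mavg w u P - u P| <= #|V|%:R * (w%:R / c%:R).
Proof.
move=> c0 w0 wc cm cc u1.
apply: (@le_trans _ _ (\sum_(P : V) w%:R^-1 * \sum_(0 <= s < w) `|u (P + e *+ s) - u P|)).
  apply: ler_sum => P _.
  have -> : mavg w u P - u P = w%:R^-1 * \sum_(0 <= s < w) (u (P + e *+ s) - u P).
    rewrite sumrB sumr_const_seq hsz mulrBr mulrA mulVf ?mul1r //.
    by rewrite pnatr_eq0 -lt0n.
  rewrite normrM ger0_norm ?invr_ge0 //.
  by rewrite ler_wpM2l ?invr_ge0 //; apply: ler_norm_sum.
rewrite -mulr_sumr exchange_big /= mulrC ler_pdivrMr ?ltr0n // mulrC.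
rewrite -[X in _ <= X%:R * _]hsz; apply: ler_sum_const => s.
rewrite mem_index_iota => /andP[_ sw].
apply: le_trans (cell_shift hpos c0 cm cc _ u1) _; first by apply: ltnW; apply: leq_trans wc.
by rewrite ler_wpM2l // ler_wpM2r ?invr_ge0 // ler_nat ltnW.
Qed.

Lemma mavg_avg c w f P : (0 < c)%N -> (0 < w)%N -> (c %| m)%N ->
  (forall P, `|f P - avg e pos c f P| <= 1) ->
  `|mavg w f P - mavg w (avg e pos c f) P| <= 2 * c%:R / w%:R.
Proof.
move=> c0 w0 cm h; rewrite mavgB /mavg mulrC; apply: norm_div_le; first by rewrite ltr0n.
rewrite divfK ?pnatr_eq0 -?lt0n //; exact: (avg_interval hpos).
Qed.

End MovingAverage.

(** * Perturbation of the corner form *)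

Section FormBounds.
Context {R : archiRealFieldType} {V : finZmodType}.
Variables (e1 e2 : V) (N : nat).
Implicit Types (f g u : V -> R).
Local Notation Form := (@cform R V e1 e2).
Let hsz k : size (index_iota 0 k) = k. Proof. by rewrite size_iota subn0. Qed.

Lemma cformE f1 f3 g : Form f1 f3 g N = \sum_(P : V) \sum_(N <= t < 2 * N)
  f3 P * f1 (P + e1 *+ t) * g (P + e2 *+ (t ^ 2)).
Proof.
apply: eq_bigr => P _; apply: eq_bigr => t _.
by rewrite /pt !mulr0z addr0 add0r -pmulrn -rmorphXn.
Qed.

Lemma sum_exchange_translate (a : nat -> V) (F : V -> R) :
  \sum_(P : V) \sum_(N <= t < 2 * N) F (P + a t) = N%:R * \sum_(P : V) F P.
Proof.
rewrite exchange_big /= -{3}(size_irange N) -sumr_const_seq.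
by apply: eq_bigr => t _; rewrite sum_translate.
Qed.

Lemma cform_vert_L1 f1 f3 g g' : (forall P, `|f1 P| <= 1) -> (forall P, `|f3 P| <= 1) ->
  `|Form f1 f3 g N - Form f1 f3 g' N| <= N%:R * \sum_(P : V) `|g P - g' P|.
Proof.
move=> h1 h3; rewrite !cformE -sumrB.
rewrite -(sum_exchange_translate (fun t => e2 *+ (t ^ 2)) (fun P => `|g P - g' P|)).
apply: ler_norm_sum_seq => P _; rewrite -sumrB; apply: ler_norm_sum_seq => t _.
rewrite -mulrBr normrM ler_piMl //; exact: norm_mul_le1.
Qed.

Lemma cform_horiz_L1 f1 f1' f3 g : (forall P, `|g P| <= 1) -> (forall P, `|f3 P| <= 1) ->
  `|Form f1 f3 g N - Form f1' f3 g N| <= N%:R * \sum_(P : V) `|f1 P - f1' P|.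
Proof.
move=> h1 h3; rewrite !cformE -sumrB.
rewrite -(sum_exchange_translate (fun t => e1 *+ t) (fun P => `|f1 P - f1' P|)).
apply: ler_norm_sum_seq => P _; rewrite -sumrB; apply: ler_norm_sum_seq => t _.
rewrite -mulrBl -mulrBr !normrM -mulrA mulrCA ler_piMr //.
by rewrite -normrM; exact: norm_mul_le1.
Qed.

(** The range of t is cut into K blocks of length M. On a block t^2 varies by at most 4 M N, so that
    the value of [g] is almost constant, while the sum of [f1 - avg] over the block is at most 2 c
    by [avg_interval]. *)
Lemma cform_horiz_avg (pos : V -> nat) m c K M lam f1 f3 g :
  (forall P, pos (P + e1) = (pos P).+1 %[mod m]) ->
  (0 < c)%N -> (c %| m)%N -> N = (K * M)%N ->
  (forall P, `|f3 P| <= 1) -> (forall P, `|g P| <= 1) ->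
  (forall P, `|g (P + e2) - g P| <= lam) ->
  (forall P, `|f1 P - avg e1 pos c f1 P| <= 1) ->
  `|Form f1 f3 g N - Form (avg e1 pos c f1) f3 g N| <=
   #|V|%:R * (K%:R * (2 * c%:R + M%:R * (lam * (M * (4 * N))%:R))).
Proof.
move=> hpos c0 cm NK h3 hg hl hd; rewrite !cformE -sumrB -size_index_enum.
apply: ler_norm_sum_const => P _; rewrite -sumrB.
pose psi P := f1 P - avg e1 pos c f1 P.
rewrite (eq_bigr (fun t => f3 P * (psi (P + e1 *+ t) * g (P + e2 *+ (t ^ 2))))); last first.
  by move=> t _; rewrite -mulrBl -mulrBr mulrA.
rewrite -mulr_sumr normrM; apply: le_trans (ler_wpM2r (normr_ge0 _) (h3 P)) _.
rewrite mul1r -{1}(add0n N) big_addn (_ : 2 * N - N = K * M)%N; last by rewrite -NK; clear; lia.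
rewrite big_nat_mulr -[X in _ <= X%:R * _]hsz; apply: ler_norm_sum_const => j.
rewrite mem_index_iota => /andP[_ jK].
pose t0 := (j * M + N)%N.
rewrite (eq_bigr (fun s => psi (P + e1 *+ t0 + e1 *+ s) * g (P + e2 *+ ((t0 + s) ^ 2)))); last first.
  by move=> s _; rewrite -addrA -mulrnDr addnAC.
have e : \sum_(0 <= s < M) psi (P + e1 *+ t0 + e1 *+ s) * g (P + e2 *+ ((t0 + s) ^ 2)) =
  (\sum_(0 <= s < M) psi (P + e1 *+ t0 + e1 *+ s)) * g (P + e2 *+ (t0 ^ 2)) +
  \sum_(0 <= s < M) psi (P + e1 *+ t0 + e1 *+ s) *
     (g (P + e2 *+ ((t0 + s) ^ 2)) - g (P + e2 *+ (t0 ^ 2))).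
  by rewrite mulr_suml -big_split /=; apply: eq_bigr => s _; ring.
rewrite e; apply: le_trans (ler_normD _ _) _; apply: lerD.
  rewrite normrM -[leRHS]mulr1; apply: ler_pM => //.
  exact: (avg_interval hpos).
rewrite -[X in _ <= X%:R * _]hsz; apply: ler_norm_sum_const => s.
rewrite mem_index_iota => /andP[_ sM]; rewrite normrM.
apply: le_trans (ler_wpM2r (normr_ge0 _) (hd _)) _; rewrite mul1r.
have -> : ((t0 + s) ^ 2 = t0 ^ 2 + s * (2 * t0 + s))%N by rewrite !expnS !expn0; clear; lia.
rewrite mulrnDr addrA; have := lip_iter e1 hl (P + e2 *+ (t0 ^ 2)) (s * (2 * t0 + s)).
rewrite /pt mulr0z add0r -pmulrn => hh; apply: le_trans hh _.
have l0 : 0 <= lam by apply: le_trans (hl 0).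
rewrite ler_wpM2l // ler_nat leq_mul //; first exact: ltnW.
have : (t0 + s < 2 * N)%N by rewrite /t0; clear -jK sM NK; nia.
by rewrite /t0; clear -sM; lia.
Qed.

Lemma cform_shift_close f u1 u2 (s1 s2 : R) :
  (forall P, `|f P| <= 1) -> (forall P, `|u1 P| <= 1) -> (forall P, `|u2 P| <= 1) ->
  (forall t, (N <= t < 2 * N)%N -> \sum_(P : V) `|u1 (P + e1 *+ t) - u1 P| <= s1) ->
  (forall t, (N <= t < 2 * N)%N -> \sum_(P : V) `|u2 (P + e2 *+ (t ^ 2)) - u2 P| <= s2) ->
  `|Form u1 f u2 N - N%:R * \sum_(P : V) f P * u1 P * u2 P| <= N%:R * (s1 + s2).
Proof.
move=> hf h1 h2 k1 k2; rewrite cformE exchange_big /=.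
have -> : N%:R * \sum_(P : V) f P * u1 P * u2 P =
    \sum_(N <= t < 2 * N) \sum_(P : V) f P * u1 P * u2 P.
  by rewrite sumr_const_seq size_irange.
rewrite -[X in _ <= X%:R * _]size_irange; apply: ler_dist_sum_const => t.
rewrite mem_index_iota => ht.
apply: le_trans (lerD (k1 t ht) (k2 t ht)); rewrite -big_split /= -sumrB.
apply: ler_norm_sum_seq => P _.
have -> : f P * u1 (P + e1 *+ t) * u2 (P + e2 *+ (t ^ 2)) - f P * u1 P * u2 P =
  (u1 (P + e1 *+ t) - u1 P) * (f P * u2 (P + e2 *+ (t ^ 2))) +
  (u2 (P + e2 *+ (t ^ 2)) - u2 P) * (f P * u1 P) by ring.
apply: le_trans (ler_normD _ _) _; rewrite !(normrM (_ - _)).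
by apply: lerD; rewrite ler_piMr //; apply: norm_mul_le1.
Qed.

End FormBounds.

(** * Lower bound for the main term and choice of the scale *)

Section MainTerm.
Context {R : archiRealFieldType} {V : finZmodType}.
Variables (e1 e2 : V) (px py : V -> nat) (mx my cx cy : nat) (f : V -> R) (al : R).
Hypotheses (hx : forall P, px (P + e1) = (px P).+1 %[mod mx])
  (hy : forall P, py (P + e2) = (py P).+1 %[mod my]).
Hypotheses (cx0 : (0 < cx)%N) (cy0 : (0 < cy)%N) (cxm : (cx %| mx)%N) (cym : (cy %| my)%N).
Hypotheses (f0 : forall P, 0 <= f P) (f1 : forall P, f P <= 1).
Hypotheses (al0 : 0 <= al) (fal : al * #|V|%:R <= \sum_(P : V) f P).

(** The indicator is constant on cells, so that [f] may be replaced by its average, which is below b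
    where the indicator is 1. *)
Lemma small_avg_mass (e : V) (p : V -> nat) (m c : nat) (b : R) :
  (forall P, p (P + e) = (p P).+1 %[mod m]) -> (0 < c)%N -> (c %| m)%N -> 0 <= b ->
  \sum_(P : V) f P * (avg e p c f P < b)%R%:R <= #|V|%:R * b.
Proof.
move=> hp c0 cm b0; rewrite -(avg_adj hp f (psi := fun P => (avg e p c f P < b)%R%:R) c0 cm).
  rewrite -size_index_enum; apply: ler_sum_const => P _.
  by case: ltP => h; rewrite ?mulr1 ?mulr0 // ltW.
by move=> B i cB ic; rewrite (avg_cell_const hp f cm cB ic).
Qed.

(** With the threshold b = al / 4, at least al |V| / 2 of the mass of [f] lies where both averages
    are at least b, and 1 / 32 = (1 / 2) (1 / 4)^2. *)
Lemma main_term : #|V|%:R * (al ^+ 3 / 32) <=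
  \sum_(P : V) f P * avg e1 px cx f P * avg e2 py cy f P.
Proof.
set b := al / 4; have b0 : 0 <= b by rewrite divr_ge0.
have m1 := small_avg_mass hx cx0 cxm b0; have m2 := small_avg_mass hy cy0 cym b0.
apply: (@le_trans _ _ (\sum_(P : V) b ^+ 2 * (f P - f P * (avg e1 px cx f P < b)%R%:R -
    f P * (avg e2 py cy f P < b)%R%:R))).
  rewrite -mulr_sumr !sumrB.
  have -> : #|V|%:R * (al ^+ 3 / 32) = b ^+ 2 * (#|V|%:R * (al / 2)) :> R.
    by rewrite /b; field.
  rewrite ler_wpM2l ?exprn_ge0 //; move: m1 m2 fal; rewrite /b; lra.
apply: ler_sum => P _.
have a1 : 0 <= avg e1 px cx f P by apply: avg_ge0.
have a2 : 0 <= avg e2 py cy f P by apply: avg_ge0.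
have fP := f0 P; have b2 : 0 <= b ^+ 2 by apply: exprn_ge0.
have rhs0 : 0 <= f P * avg e1 px cx f P * avg e2 py cy f P.
  by apply: mulr_ge0 => //; apply: mulr_ge0.
case: ltP => h1.
  apply: le_trans rhs0; rewrite mulr1 subrr add0r mulrN oppr_le0 mulr_ge0 // mulr_ge0 //.
case: ltP => h2.
  by apply: le_trans rhs0; rewrite mulr1 mulr0 subr0 subrr mulr0.
rewrite !mulr0 !subr0 mulrC -mulrA ler_wpM2l //.
by rewrite expr2; apply: ler_pM.
Qed.

End MainTerm.

(** The increments over two indices sum to s K.+1 + s K - s 1 - s 0 <= 2 B. Two indices are skipped
    in order to have a scale strictly between. *)
Lemma pigeonhole_increment {R : archiRealFieldType} (s : nat -> R) (B : R) (K : nat) :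
  (0 < K)%N -> (forall k, 0 <= s k <= B) ->
  exists2 k, (k < K)%N & s k.+2 - s k <= 2 * B / K%:R.
Proof.
move=> K0 hs; have KR : 0 < K%:R :> R by rewrite ltr0n.
case: (boolP (has (fun k => s k.+2 - s k <= 2 * B / K%:R) (iota 0 K))) => [|hno].
  by move=> /hasP[k]; rewrite mem_iota add0n => /andP[_ kK] h; exists k.
exfalso.
have e : \sum_(0 <= k < K) (s k.+2 - s k) = s K.+1 + s K - s 1%N - s 0%N.
  elim: (K) => [|k ih]; first by rewrite big_geq //; ring.
  by rewrite big_nat_recr //= ih; ring.
have : \sum_(0 <= k < K) (2 * B / K%:R) < \sum_(0 <= k < K) (s k.+2 - s k).
  apply: ltr_sum_nat => // k /andP[_ kK].
  have := hasPn hno k; rewrite mem_iota add0n kK => /(_ isT).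
  by rewrite -ltNge.
rewrite sumr_const_seq size_iota subn0 mulrC divfK ?gt_eqF // e.
have /andP[a1 a2] := hs K.+1; have /andP[a3 a4] := hs K.
have /andP[a5 a6] := hs 1%N; have /andP[a7 a8] := hs 0%N.
lra.
Qed.

(** * Scales and the discrete theorem *)

Section Chain.
Context {R : archiRealFieldType} {V : finZmodType}.
Variables (e1 e2 : V) (E e J nu : nat) (c : R).
Hypotheses (E480 : E = 480%N) (e0 : (0 < e)%N) (nuJ : (512 * (e + J) <= nu)%N).
Hypothesis (hc : 4 * 2 ^+ E <= c).
Variable f : V -> R.
Hypotheses (f0 : forall P, 0 <= f P) (f1 : forall P, f P <= 1).
Let N := (2 ^ nu)%N.
Let v : R := #|V|%:R.
Let G : R := 2 ^+ e.
Local Notation Form := (@cform R V e1 e2).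

(** Thus N^2 / width j = q^480 for q = 2^(e + j), which is the factor Q^60 of [smoothing] with Q =
    q^8. *)
Definition width (j : nat) : nat := (2 ^ (2 * nu - E * (e + j)))%N.

Lemma unit_abs_le1 (u : V -> R) :
  (forall P, 0 <= u P) -> (forall P, u P <= 1) -> forall P, `|u P| <= 1.
Proof. by move=> h0 h1 P; rewrite ger0_norm. Qed.

Lemma unit_dist_le1 (u u' : V -> R) :
  (forall P, 0 <= u P) -> (forall P, u P <= 1) ->
  (forall P, 0 <= u' P) -> (forall P, u' P <= 1) -> forall P P', `|u P - u' P'| <= 1.
Proof.
move=> h0 h1 h0' h1' P P'; rewrite ler_norml.
by have := h0 P; have := h1 P; have := h0' P'; have := h1' P'; lra.
Qed.

Let fn := unit_abs_le1 f0 f1.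

Lemma width_gt0 j : (0 < width j)%N.
Proof. by rewrite expn_gt0. Qed.

Lemma widthS j : (j < J)%N -> width j = (width j.+1 * 2 ^ E)%N.
Proof.
move=> jJ; rewrite /width -expnD; congr (2 ^ _)%N.
have : (E * (e + j.+1) <= 2 * nu)%N.
  by rewrite E480; move: nuJ jJ; clear; lia.
by rewrite addnS mulnS; clear; lia.
Qed.

Lemma width_real j : (j <= J)%N -> N%:R ^+ 2 = (width j)%:R * (2 ^+ (e + j)) ^+ E :> R.
Proof.
move=> jJ; rewrite -exprM -!natrX -natrM /N /width -expnM -expnD.
congr (2 ^ _)%:R; have : (E * (e + j) <= 2 * nu)%N.
  by rewrite E480; move: nuJ jJ; clear; lia.
by rewrite mulnC (mulnC (e + j)%N); clear; lia.
Qed.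

Let c4 : 4 <= c.
Proof.
apply: le_trans hc; rewrite -[leLHS]mulr1 ler_wpM2l // exprn_ege1 //; lra.
Qed.

(** In a difference of two moving averages, the Lipschitz constant is governed by the shorter length
    and the interval sums by the longer one. The ratio 2^E of the two lengths is absorbed by c. *)
Lemma telescope_step j (f3 : V -> R) : (j < J)%N -> (forall P, `|f3 P| <= 1) ->
  `|Form f f3 (mavg e2 (width j.+1) f) N - Form f f3 (mavg e2 (width j) f) N| <=
  8 * c * v * N%:R / 2 ^+ (e + j).
Proof.
move=> jJ h3; pose g P := mavg e2 (width j.+1) f P - mavg e2 (width j) f P.
have -> : Form f f3 (mavg e2 (width j.+1) f) N - Form f f3 (mavg e2 (width j) f) N = Form f f3 g N.
  rewrite /cform -sumrB; apply: eq_bigr => P _; rewrite -sumrB; apply: eq_bigr => t _.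
  by rewrite -mulrBr.
set q := (2 ^ (e + j))%N; set Q := (q ^ 8)%N.
have w0 := width_gt0 j; have w1 := width_gt0 j.+1.
have wR : 0 < (width j)%:R :> R by rewrite ltr0n.
have wR1 : 0 < (width j.+1)%:R :> R by rewrite ltr0n.
have TE : 0 < 2 ^+ E :> R by rewrite exprn_gt0.
have wS : (width j)%:R = (width j.+1)%:R * 2 ^+ E :> R by rewrite widthS // natrM natrX.
have T1 : 1 <= 2 ^+ E :> R by rewrite exprn_ege1 //; lra.
have NW : N%:R ^+ 2 = (width j)%:R * Q%:R ^+ 60 :> R.
  rewrite (width_real (ltnW jJ)) /Q /q !natrX -!exprM; congr (_ * 2 ^+ _).
  by rewrite E480; clear; lia.
have Q0 : 0 < Q%:R ^+ 60 :> R by rewrite exprn_gt0 // ltr0n !expn_gt0.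
have -> : 2 ^+ (e + j) = q%:R :> R by rewrite /q natrX.
have QE : (Q ^ 32 = 2 ^ (256 * (e + j)))%N.
  by rewrite /Q /q -!expnM; congr (2 ^ _)%N; clear; lia.
apply: (@smoothing R V e1 e2 f f3 g c q Q N (2 ^ (nu - 256 * (e + j)))) => //.
- move=> P; apply: (@unit_dist_le1 (mavg e2 (width j.+1) f) (mavg e2 (width j) f)) => P';
  by [apply: mavg_ge0|apply: mavg_le1].
- move=> P; have -> : c * Q%:R ^+ 60 / N%:R ^+ 2 = c / (width j)%:R.
    by rewrite NW; field; rewrite !gt_eqF // ltr0n !expn_gt0.
  have -> : g (P + e2) - g P = (mavg e2 (width j.+1) f (P + e2) - mavg e2 (width j.+1) f P) -
     (mavg e2 (width j) f (P + e2) - mavg e2 (width j) f P) by rewrite /g; ring.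
  apply: le_trans (ler_normB _ _) _.
  apply: le_trans (lerD (mavg_lip e2 P w1 fn) (mavg_lip e2 P w0 fn)) _.
  rewrite ler_pdivlMr // mulrDl divfK ?gt_eqF //.
  have -> : 2 / (width j.+1)%:R * (width j)%:R = 2 * 2 ^+ E :> R.
    by rewrite wS; field; rewrite gt_eqF.
  by move: hc T1; lra.
- move=> P S; have -> : c * N%:R ^+ 2 / Q%:R ^+ 60 = c * (width j)%:R.
    by rewrite NW; field; rewrite gt_eqF // ltr0n !expn_gt0.
  have i1 := mavg_interval e2 P S w1 fn; have i0 := mavg_interval e2 P S w0 fn.
  move: i1 i0; rewrite /g sumrB; set a := \sum_(_ <= _ < _) _.
  set b := \sum_(_ <= _ < _) f _; set d := \sum_(_ <= _ < _) _ => i1 i0.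
  have -> : a - d = (a - b) - (d - b) by ring.
  apply: le_trans (ler_normB _ _) _.
  have : (width j.+1)%:R <= (width j)%:R :> R by rewrite wS ler_peMr // ltW.
  have : 4 * (width j)%:R <= c * (width j)%:R :> R by rewrite ler_wpM2r // ltW.
  move: i1 i0; lra.
- rewrite /q -{1}(expn1 2) leq_exp2l //; by move: e0; clear; lia.
- rewrite QE /N -expnD; congr (2 ^ _)%N; by move: nuJ jJ; clear; lia.
- rewrite QE leq_exp2l //; by move: nuJ jJ; clear; lia.
by move: c4; lra.
Qed.

Lemma telescope (f3 : V -> R) : (forall P, `|f3 P| <= 1) ->
  `|Form f f3 (mavg e2 (width J) f) N - Form f f3 (mavg e2 (width 0) f) N| <=
  16 * c * v * N%:R / G.
Proof.
move=> h3.
have ind j : (j <= J)%N -> `|Form f f3 (mavg e2 (width j) f) N - Form f f3 (mavg e2 (width 0) f) N| <=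
    8 * c * v * N%:R / G * (2 - 2 / 2 ^+ j).
  elim: j => [_|j ih jJ].
    by rewrite subrr normr0 expr0 divr1 subrr mulr0.
  apply: le_trans (ler_distD (Form f f3 (mavg e2 (width j) f) N) _ _) _.
  apply: le_trans (lerD (telescope_step jJ h3) (ih (ltnW jJ))) _.
  rewrite le_eqVlt; apply/orP; left; apply/eqP.
  rewrite exprD exprS /G; field.
  by rewrite ?mulf_neq0 ?expf_neq0 ?pnatr_eq0.
apply: le_trans (ind J (leqnn J)) _.
have G0 : 0 < G by rewrite exprn_gt0.
have -> : 16 * c * v * N%:R / G = 8 * c * v * N%:R / G * 2 by ring.
rewrite ler_wpM2l //.
  by rewrite divr_ge0 ?(ltW G0) // !mulr_ge0 //; move: c4; lra.
by rewrite lerBlDr lerDl divr_ge0 // exprn_ge0.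
Qed.

Variables (px py : V -> nat) (mx my m : nat).
Hypotheses (hx : forall P, px (P + e1) = (px P).+1 %[mod mx])
  (hy : forall P, py (P + e2) = (py P).+1 %[mod my]).
Hypotheses (mE : m = (E.+2 * e)%N) (mnu : (m <= nu)%N).
Hypotheses (dx : (2 ^ (nu + m) %| mx)%N) (dy : (2 ^ (2 * nu + 2 * m) %| my)%N).
Let X1 := avg e1 px (2 ^ (nu - m)) f.
Let X0 := avg e1 px (2 ^ (nu + m)) f.
Let Y1 := avg e2 py (2 ^ (2 * nu - 2 * m)) f.
Let Y0 := avg e2 py (2 ^ (2 * nu + 2 * m)) f.

Lemma pow2_gt0 k : (0 < 2 ^ k)%N. Proof. by rewrite expn_gt0. Qed.

(** The value m = (E + 2) e separates three lengths. The vertical average of [f] over [width 0] =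
    N^2 / G^E hardly changes while t runs through a block of length N / G^(E + 1), and cells of
    length N / G^(E + 2) are short compared to such a block. In the other direction, averages over
    cells of length N G^(E + 2), respectively N^2 G^(2 E + 4), are almost invariant under the shifts
    t e1 and t^2 e2. The errors add up to 16 c + 19 <= 35 c, in units of |V| N / G. *)
Lemma cform_main : `|Form f f f N - N%:R * \sum_(P : V) f P * X0 P * Y0 P| <=
  N%:R * (\sum_(P : V) `|f P - mavg e2 (width J) f P| + \sum_(P : V) `|X1 P - X0 P| +
    \sum_(P : V) `|Y1 P - Y0 P| + v * (35 * c / G)).
Proof.
have dx1 : (2 ^ (nu - m) %| mx)%N.
  by apply: dvdn_trans dx; apply: dvdn_exp2l; clear; lia.
have dy1 : (2 ^ (2 * nu - 2 * m) %| my)%N.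
  by apply: dvdn_trans dy; apply: dvdn_exp2l; clear; lia.
have p0 := pow2_gt0.
have X10 P : 0 <= X1 P by apply: avg_ge0.
have X11 P : X1 P <= 1 by apply: avg_le1.
have X00 P : 0 <= X0 P by apply: avg_ge0.
have X01 P : X0 P <= 1 by apply: avg_le1.
have Y10 P : 0 <= Y1 P by apply: avg_ge0.
have Y11 P : Y1 P <= 1 by apply: avg_le1.
have Y00 P : 0 <= Y0 P by apply: avg_ge0.
have Y01 P : Y0 P <= 1 by apply: avg_le1.
have X1n := unit_abs_le1 X10 X11; have X0n := unit_abs_le1 X00 X01.
have Y1n := unit_abs_le1 Y10 Y11; have Y0n := unit_abs_le1 Y00 Y01.
have w00 := width_gt0 0.
set F2 := mavg e2 (width 0) f.
have F20 P : 0 <= F2 P by apply: mavg_ge0.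
have F21 P : F2 P <= 1 by apply: mavg_le1.
have F2n := unit_abs_le1 F20 F21.
have G2 : 2 <= G by rewrite /G -{1}(expr1 2) ler_weXn2l // ?ler1n //.
have G0 : 0 < G by lra.
pose GE := G ^+ E.
have GE1 : 1 <= GE by rewrite /GE exprn_ege1 //; lra.
have n0 : 0 < N%:R :> R by rewrite ltr0n expn_gt0.
set n : R := N%:R; set w : R := (width 0)%:R.
have w0 : 0 < w by rewrite ltr0n.
have nw : n ^+ 2 = w * GE by rewrite /n (width_real (leq0n J)) addn0.
pose M1 := (2 ^ (nu - E.+1 * e))%N; pose K1 := (2 ^ (E.+1 * e))%N.
have me : (E.+1 * e <= nu)%N by apply: leq_trans mnu; rewrite mE leq_mul2r leqnSn orbT.
have NKM : N = (K1 * M1)%N by rewrite /K1 /M1 -expnD; congr (2 ^ _)%N; move: me; clear; lia.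
have K1r : K1%:R = G * GE :> R.
  by rewrite /K1 natrX mulnC exprM exprS.
have nKM : n = G * GE * M1%:R by rewrite /n NKM natrM K1r.
have m1r : n = G ^+ 2 * GE * (2 ^ (nu - m))%:R :> R.
  rewrite /n /N; have -> : nu = (E.+2 * e + (nu - m))%N by move: mnu; rewrite mE; clear; lia.
  by rewrite expnD natrM !natrX (mulnC E.+2) exprM; congr (_ * 2 ^+ _); 
    [rewrite -exprD|rewrite mE; clear; lia].
have cx0 : (2 ^ (nu + m))%:R = n * (G ^+ 2 * GE) :> R.
  by rewrite expnD natrM -/N -/n mE !natrX (mulnC E.+2) exprM -exprD.
have cy1 : n ^+ 2 = (G ^+ 2 * GE) ^+ 2 * (2 ^ (2 * nu - 2 * m))%:R :> R.
  rewrite {1}m1r exprMn -natrX -expnM; congr (_ * (2 ^ _)%:R); clear; lia.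
have cy0 : (2 ^ (2 * nu + 2 * m))%:R = n ^+ 2 * (G ^+ 2 * GE) ^+ 2 :> R.
  rewrite -exprMn -cx0 -natrX -expnM; congr (2 ^ _)%:R; clear; lia.
have A1 : 0 < G ^+ 2 * GE by rewrite mulr_gt0 ?exprn_gt0 //; lra.
have GA : G <= G ^+ 2 * GE.
  by rewrite expr2 -mulrA ler_peMr ?(ltW G0) //; rewrite mulr_ege1 //; lra.
have A2 : G ^+ 2 * GE <= (G ^+ 2 * GE) ^+ 2.
  by rewrite expr2 ler_peMr ?(ltW A1) //; apply: le_trans GA; lra.
have M0 : 0 < M1%:R :> R by rewrite ltr0n expn_gt0.
have GE0 : 0 < GE by lra.
have vn : 0 <= v by [].
(* Eight replacements: [st1] and [st2] smooth the vertical function, [st3] and [st4] turn the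
   horizontal function into [X0], [st5] to [st7] turn the vertical one into [Y0], and [st8] removes
   the shifts. *)
have st1 : `|Form f f f N - Form f f (mavg e2 (width J) f) N| <=
   n * \sum_(P : V) `|f P - mavg e2 (width J) f P| by apply: cform_vert_L1.
have st2 := telescope fn; rewrite -/F2 -/n in st2.
have st3 : `|Form f f F2 N - Form X1 f F2 N| <= v * (10 * n / G).
  have := @cform_horiz_avg R V e1 e2 N px mx (2 ^ (nu - m)) K1 M1 (2 / w) f f F2 hx
     (p0 _) dx1 NKM fn F2n (fun P => mavg_lip e2 P w00 fn)
     (fun P => unit_dist_le1 f0 f1 X10 X11 P P).
  rewrite -/X1 -/v => h; apply: le_trans h _; rewrite ler_wpM2l // !natrM -/n K1r.
  have -> : G * GE * (2 * (2 ^ (nu - m))%:R + M1%:R * (2 / w * (M1%:R * (4 * n)))) =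
     2 * (G * GE * (2 ^ (nu - m))%:R) + 8 * ((G * GE * M1%:R) * M1%:R * n) / w :> R.
    by field; rewrite gt_eqF.
  have -> : G * GE * (2 ^ (nu - m))%:R = n / G :> R by rewrite m1r; field; rewrite gt_eqF.
  rewrite -nKM.
  have -> : 8 * (n * M1%:R * n) / w = 8 * (n / G).
    have -> : n * M1%:R * n = n ^+ 2 * M1%:R by ring.
    by rewrite nw nKM; field; rewrite !gt_eqF.
  lra.
have st4 : `|Form X1 f F2 N - Form X0 f F2 N| <= n * \sum_(P : V) `|X1 P - X0 P|.
  exact: cform_horiz_L1.
have st5 : `|Form X0 f F2 N - Form X0 f (mavg e2 (width 0) Y1) N| <= n * (v * (2 / G)).
  apply: le_trans (cform_vert_L1 _ _ _ _ _ _ _) _ => //; rewrite ler_wpM2l ?(ltW n0) //.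
  rewrite /v -size_index_enum; apply: ler_sum_const => P _.
  have h := @mavg_avg R V e2 py my hy (2 ^ (2 * nu - 2 * m)) (width 0) f P (p0 _) w00 dy1
     (fun P' => unit_dist_le1 f0 f1 Y10 Y11 P' P').
  apply: le_trans h _; rewrite -/w ler_pdivrMr //.
  have -> : 2 / G * w = 2 * (w / G) by ring.
  rewrite ler_wpM2l // ler_pdivlMr //.
  have -> : w = n ^+ 2 / GE by rewrite nw; field; rewrite gt_eqF.
  rewrite cy1 ler_pdivlMr //.
  have -> : (2 ^ (2 * nu - 2 * m))%:R * G * GE = (G * GE) * (2 ^ (2 * nu - 2 * m))%:R :> R by ring.
  rewrite ler_wpM2r //; apply: le_trans A2; rewrite ler_wpM2r ?(ltW GE0) //.
  by rewrite expr2 ler_peMr ?(ltW G0) //; lra.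
have st6 : `|Form X0 f (mavg e2 (width 0) Y1) N - Form X0 f (mavg e2 (width 0) Y0) N| <=
    n * \sum_(P : V) `|Y1 P - Y0 P|.
  apply: le_trans (cform_vert_L1 _ _ _ _ _ _ _) _ => //; rewrite ler_wpM2l ?(ltW n0) //.
  under eq_bigr do rewrite mavgB; exact: (mavg_L1 e2 (fun P => Y1 P - Y0 P)).
have wc : (width 0 <= 2 ^ (2 * nu + 2 * m))%N by rewrite leq_exp2l //; clear; lia.
have cY := avg_cell_const hy f dy. have cX := avg_cell_const hx f dx.
have st7 : `|Form X0 f (mavg e2 (width 0) Y0) N - Form X0 f Y0 N| <= n * (v * (1 / G)).
  apply: le_trans (cform_vert_L1 _ _ _ _ _ _ _) _ => //; rewrite ler_wpM2l ?(ltW n0) //.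
  have h := @mavg_cell R V e2 py my hy (2 ^ (2 * nu + 2 * m)) (width 0) Y0 (p0 _) w00 wc dy cY
     (unit_dist_le1 Y00 Y01 Y00 Y01).
  apply: le_trans h _.
  rewrite -/v ler_wpM2l // -/w cy0 nw ler_pdivrMr ?mulr_gt0 ?exprn_gt0 //.
  have -> : 1 / G * (w * GE * (G ^+ 2 * GE) ^+ 2) = w * (G ^+ 3 * GE ^+ 3).
    by field; rewrite gt_eqF.
  rewrite ler_peMr ?(ltW w0) // mulr_ege1 // exprn_ege1 //; lra.
have st8 : `|Form X0 f Y0 N - n * \sum_(P : V) f P * X0 P * Y0 P| <=
    n * (v * (2 / G) + v * (4 / G)).
  apply: cform_shift_close => // t /andP[_ tN].
    have tr : t%:R <= 2 * n by rewrite /n -natrM ler_nat ltnW.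
    apply: le_trans (cell_shift hx (p0 _) dx cX _ _) _.
    - apply: leq_trans (ltnW tN) _; rewrite -expnS leq_exp2l //.
      by rewrite mE; move: e0; clear; lia.
    - by apply: unit_dist_le1.
    rewrite -/v ler_wpM2l // cx0 ler_pdivrMr ?mulr_gt0 //.
    apply: le_trans tr _; have -> : 2 / G * (n * (G ^+ 2 * GE)) = 2 * n * (G * GE).
      by field; rewrite gt_eqF.
    by rewrite ler_peMr ?mulr_ge0 ?(ltW n0) // mulr_ege1 //; lra.
  have tr : (t ^ 2)%:R <= 4 * n ^+ 2 :> R.
    have -> : 4 * n ^+ 2 = ((2 * N) ^ 2)%:R by rewrite natrX natrM -/n; ring.
    by rewrite ler_nat leq_exp2r // ltnW.
  apply: le_trans (cell_shift hy (p0 _) dy cY _ _) _.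
  - apply: (@leq_trans ((2 * N) ^ 2)); first by rewrite leq_exp2r // ltnW.
    rewrite -expnS -expnM leq_exp2l // mE; move: e0; clear; lia.
  - by apply: unit_dist_le1.
  rewrite -/v ler_wpM2l // cy0 ler_pdivrMr ?mulr_gt0 ?exprn_gt0 //.
  apply: le_trans tr _.
  have -> : 4 / G * (n ^+ 2 * (G ^+ 2 * GE) ^+ 2) = 4 * n ^+ 2 * (G ^+ 3 * GE ^+ 2).
    by field; rewrite gt_eqF.
  rewrite ler_peMr ?mulr_ge0 ?exprn_ge0 ?(ltW n0) // mulr_ege1 // exprn_ege1 //; lra.
have tri (a0 a1 a2 a3 a4 a5 a6 a7 a8 : R) : `|a0 - a8| <= `|a0 - a1| + `|a1 - a2| +
    `|a2 - a3| + `|a3 - a4| + `|a4 - a5| + `|a5 - a6| + `|a6 - a7| + `|a7 - a8|.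
  apply: le_trans (ler_distD a7 _ _) _; rewrite lerD2r.
  apply: le_trans (ler_distD a6 _ _) _; rewrite lerD2r.
  apply: le_trans (ler_distD a5 _ _) _; rewrite lerD2r.
  apply: le_trans (ler_distD a4 _ _) _; rewrite lerD2r.
  apply: le_trans (ler_distD a3 _ _) _; rewrite lerD2r.
  apply: le_trans (ler_distD a2 _ _) _; rewrite lerD2r.
  exact: ler_distD.
apply: le_trans (tri _ _ _ _ _ _ _ _ _) _.
apply: le_trans (lerD (lerD (lerD (lerD (lerD (lerD (lerD st1 st2) st3) st4) st5) st6) st7) st8) _.
have G1 : 0 <= v * n / G by rewrite divr_ge0 ?mulr_ge0 ?(ltW n0) ?(ltW G0).
have cG : 4 * (v * n / G) <= c * (v * n / G) by rewrite ler_wpM2r.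
have -> : n * (\sum_(P : V) `|f P - mavg e2 (width J) f P| + \sum_(P : V) `|X1 P - X0 P| +
    \sum_(P : V) `|Y1 P - Y0 P| + v * (35 * c / G)) =
   n * \sum_(P : V) `|f P - mavg e2 (width J) f P| + n * \sum_(P : V) `|X1 P - X0 P| +
   n * \sum_(P : V) `|Y1 P - Y0 P| + 35 * (c * (v * n / G)) by ring.
have -> : 16 * c * v * n / G = 16 * (c * (v * n / G)) by ring.
have -> : v * (10 * n / G) = 10 * (v * n / G) by ring.
have -> : n * (v * (2 / G)) = 2 * (v * n / G) by ring.
have -> : n * (v * (1 / G)) = v * n / G by ring.
have -> : n * (v * (2 / G) + v * (4 / G)) = 6 * (v * n / G) by ring.
lra.
Qed.

End Chain.

Section DiscreteCorner.
Context {R : archiRealFieldType} {V : finZmodType}.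
Variables (e1 e2 : V) (px py : V -> nat) (n E e K j0 : nat) (c z d al : R) (f u : V -> R).
Let m := (E.+2 * e)%N.
Let v : R := #|V|%:R.
Hypotheses (E480 : E = 480%N) (e0 : (0 < e)%N) (K0 : (0 < K)%N).
Hypothesis (hc : 4 * 2 ^+ E <= c).
Hypotheses (hx : forall P, px (P + e1) = (px P).+1 %[mod 2 ^ n.+1])
  (hy : forall P, py (P + e2) = (py P).+1 %[mod 2 ^ (2 * n).+1]).
Hypothesis (nbig : (m * K.+2 + 512 * (2 * e + j0) <= n)%N).
Hypotheses (f0 : forall P, 0 <= f P) (f1 : forall P, f P <= 1).
Hypotheses (al0 : 0 <= al) (fal : al * v <= \sum_(P : V) f P).
Hypotheses (u0 : forall P, 0 <= u P) (u1 : forall P, u P <= 1).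
Hypotheses (uc : cell_const e2 py (2 ^ (2 * n - j0)) u).
Hypotheses (fu : \sum_(P : V) `|f P - u P| <= d * v).
Hypotheses (z0 : 0 <= z) (zK : 4 <= z ^+ 2 * K%:R).
Hypothesis (err : 2 * d + 1 / 2 ^+ e + 2 * z + 35 * c / 2 ^+ e < al ^+ 3 / 32).

Let v0 : 0 < v.
Proof. by rewrite ltr0n; apply/card_gt0P; exists 0. Qed.

Lemma L1_of_L2 (g : V -> R) : \sum_(P : V) g P ^+ 2 <= 4 * v / K%:R ->
  \sum_(P : V) `|g P| <= z * v.
Proof.
move=> h; have KR : 0 < K%:R :> R by rewrite ltr0n.
apply: le_trans (ler_norm _) _; apply: abs_le_of_sqr; first by rewrite mulr_ge0 // ltW.
apply: le_trans (sqr_sum_le _ _) _; rewrite size_index_enum -/v.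
rewrite (eq_bigr (fun P => g P ^+ 2)); last by move=> P _; rewrite real_normK ?num_real.
apply: (@le_trans _ _ (v * (4 * v / K%:R))); first by rewrite ler_wpM2l // ltW.
rewrite (_ : v * (4 * v / K%:R) = v ^+ 2 * (4 / K%:R)); last by ring.
rewrite exprMn mulrC ler_wpM2r ?exprn_ge0 ?(ltW v0) //.
by rewrite ler_pdivrMr.
Qed.

(** [u] is constant on cells much longer than w and is hardly changed by the moving average; [f] is
    close to [u] in L^1, and moving averages contract L^1. This is where the telescoping starts. *)
Lemma mavg_close w : (0 < w)%N -> (w * 2 ^ e <= 2 ^ (2 * n - j0))%N ->
  \sum_(P : V) `|f P - mavg e2 w f P| <= v * (2 * d + 1 / 2 ^+ e).
Proof.
move=> w0 wle; set cc := (2 ^ (2 * n - j0))%N in wle *.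
have cc0 : (0 < cc)%N by rewrite expn_gt0.
have ccm : (cc %| 2 ^ (2 * n).+1)%N by apply: dvdn_exp2l; clear; lia.
have wc : (w <= cc)%N by apply: leq_trans wle; rewrite leq_pmulr // expn_gt0.
have a1 := @mavg_cell R V e2 py _ hy cc w u cc0 w0 wc ccm uc (unit_dist_le1 u0 u1 u0 u1).
have a2 : \sum_(P : V) `|mavg e2 w u P - mavg e2 w f P| <= d * v.
  under eq_bigr do rewrite mavgB.
  apply: le_trans (mavg_L1 e2 (fun P => u P - f P) w0) _.
  by under eq_bigr do rewrite distrC.
have a3 : w%:R / cc%:R <= 1 / 2 ^+ e :> R.
  rewrite ler_pdivrMr ?ltr0n // mulrAC mul1r ler_pdivlMr ?exprn_gt0 //.
  by rewrite -natrX -natrM ler_nat.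
apply: (@le_trans _ _ (\sum_(P : V) (`|f P - u P| + `|mavg e2 w u P - u P| +
   `|mavg e2 w u P - mavg e2 w f P|))).
  apply: ler_sum => P _; have := ler_distD (mavg e2 w u P) (f P) (mavg e2 w f P).
  by have := ler_distD (u P) (f P) (mavg e2 w u P); rewrite (distrC (u P)); lra.
rewrite !big_split /=; rewrite -/v in a1.
have a4 : v * (w%:R / cc%:R) <= v * (1 / 2 ^+ e) by rewrite ler_wpM2l // ltW.
by move: fu a1 a2 a4; lra.
Qed.

Theorem discrete_corner : exists k P t, [/\ (k < K)%N,
  (2 ^ (n - m * k.+1) <= t < 2 * 2 ^ (n - m * k.+1))%N,
  f P != 0, f (P + e1 *+ t) != 0 & f (P + e2 *+ (t ^ 2)) != 0].
Proof.
pose X k := avg e1 px (2 ^ (n - m * k)) f.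
pose Y k := avg e2 py (2 ^ (2 * (n - m * k))) f.
have p0 k : (0 < 2 ^ k)%N by rewrite expn_gt0.
have dX k : (2 ^ (n - m * k) %| 2 ^ n.+1)%N by apply: dvdn_exp2l; clear; lia.
have dY k : (2 ^ (2 * (n - m * k)) %| 2 ^ (2 * n).+1)%N by apply: dvdn_exp2l; clear; lia.
pose s k := \sum_(P : V) X k P ^+ 2 + \sum_(P : V) Y k P ^+ 2.
have sq1 (g : V -> R) : (forall P, 0 <= g P) -> (forall P, g P <= 1) ->
    0 <= \sum_(P : V) g P ^+ 2 <= v.
  move=> g0 g1; apply/andP; split; first by apply: sumr_ge0 => P _; rewrite sqr_ge0.
  rewrite -[leRHS]mulr1 /v -size_index_enum; apply: ler_sum_const => P _.
  by rewrite exprn_ile1.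
have X0 k P : 0 <= X k P by apply: avg_ge0.
have X1 k P : X k P <= 1 by apply: avg_le1.
have Y0 k P : 0 <= Y k P by apply: avg_ge0.
have Y1 k P : Y k P <= 1 by apply: avg_le1.
have hs k : 0 <= s k <= 2 * v.
  by have /andP[? ?] := sq1 _ (X0 k) (X1 k); have /andP[? ?] := sq1 _ (Y0 k) (Y1 k); rewrite /s; lra.
have [k kK sk] := pigeonhole_increment K0 hs.
have mk : (m * k.+2 <= n)%N.
  apply: leq_trans nbig; apply: leq_trans (leq_addr _ _); rewrite leq_mul2l; apply/orP; right.
  by rewrite !ltnS ltnW.
have mK : (m * k.+2 + 512 * (2 * e + j0) <= n)%N.
  apply: leq_trans nbig; rewrite leq_add2r leq_mul2l; apply/orP; right.
  by rewrite !ltnS ltnW.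
have eX : \sum_(P : V) (X k.+2 P - X k P) ^+ 2 =
    \sum_(P : V) X k.+2 P ^+ 2 - \sum_(P : V) X k P ^+ 2.
  by apply: (avg_energy hx) => //; apply: dvdn_exp2l; rewrite !mulnS; clear; lia.
have eY : \sum_(P : V) (Y k.+2 P - Y k P) ^+ 2 =
    \sum_(P : V) Y k.+2 P ^+ 2 - \sum_(P : V) Y k P ^+ 2.
  by apply: (avg_energy hy) => //; apply: dvdn_exp2l; rewrite !mulnS; clear; lia.
have eX0 : 0 <= \sum_(P : V) (X k.+2 P - X k P) ^+ 2 by apply: sumr_ge0 => P _; rewrite sqr_ge0.
have eY0 : 0 <= \sum_(P : V) (Y k.+2 P - Y k P) ^+ 2 by apply: sumr_ge0 => P _; rewrite sqr_ge0.
have sk' : s k.+2 - s k <= 4 * v / K%:R by move: sk; rewrite mulrA; lra.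
have bX : \sum_(P : V) `|X k.+2 P - X k P| <= z * v.
  by apply: L1_of_L2; move: sk'; rewrite /s; lra.
have bY : \sum_(P : V) `|Y k.+2 P - Y k P| <= z * v.
  by apply: L1_of_L2; move: sk'; rewrite /s; lra.
(* N = 2^nu is the middle one of the three scales k, k + 1, k + 2. The averages at k and k + 2
   belong to N 2^m and N / 2^m. *)
set nu := (n - m * k.+1)%N.
have nuE : (nu + m * k.+1 = n)%N by rewrite /nu subnK //; apply: leq_trans mk; rewrite leq_mul2l leqnSn orbT.
have mS : (m * k.+2 = m * k.+1 + m)%N by rewrite mulnS addnC.
have mS1 : (m * k.+1 = m * k + m)%N by rewrite mulnS addnC.
have mnu : (m <= nu)%N by move: mk nuE; rewrite mS; clear; lia.
have nuJ : (512 * (e + (e + j0)) <= nu)%N by move: mK nuE; rewrite mS; clear; lia.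
have XE : X k.+2 = avg e1 px (2 ^ (nu - m)) f.
  by rewrite /X; congr (avg _ _ (2 ^ _) _); move: nuE mS; clear; lia.
have XE0 : X k = avg e1 px (2 ^ (nu + m)) f.
  by rewrite /X; congr (avg _ _ (2 ^ _) _); move: nuE mS1; clear; lia.
have YE : Y k.+2 = avg e2 py (2 ^ (2 * nu - 2 * m)) f.
  by rewrite /Y; congr (avg _ _ (2 ^ _) _); move: nuE mS; clear; lia.
have YE0 : Y k = avg e2 py (2 ^ (2 * nu + 2 * m)) f.
  by rewrite /Y; congr (avg _ _ (2 ^ _) _); move: nuE mS1; clear; lia.
have dx : (2 ^ (nu + m) %| 2 ^ n.+1)%N by apply: dvdn_exp2l; move: nuE mS1; clear; lia.
have dy : (2 ^ (2 * nu + 2 * m) %| 2 ^ (2 * n).+1)%N by apply: dvdn_exp2l; move: nuE mS1; clear; lia.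
(* After e + j0 steps the averaging length is below 2^(2 n - j0 - e), as [mavg_close] requires. *)
have ch := @cform_main R V e1 e2 E e (e + j0) nu c E480 e0 nuJ hc f f0 f1 px py _ _ m hx hy
  (erefl m) mnu dx dy.
rewrite -XE -XE0 -YE -YE0 -/v in ch.
have mc : \sum_(P : V) `|f P - mavg e2 (width E e nu (e + j0)) f P| <= v * (2 * d + 1 / 2 ^+ e).
  apply: mavg_close; first exact: width_gt0.
  rewrite /width -expnD leq_exp2l //; move: nuE nuJ; rewrite E480; clear; lia.
have mt := @main_term R V e1 e2 px py _ _ _ _ f al hx hy (p0 (nu + m)%N)
  (p0 (2 * nu + 2 * m)%N) dx dy f0 al0 fal.
rewrite -XE0 -YE0 -/v in mt.
have n0 : 0 < (2 ^ nu)%:R :> R by rewrite ltr0n expn_gt0.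
move: ch mt; set L := cform _ _ _ _ _ _; set Z := \sum_(P : V) f P * _ * _ => ch mt.
have Lpos : L != 0.
  apply/eqP => L0; move: ch; rewrite L0 sub0r normrN normrM (ger0_norm (ltW n0)) ler_pM2l //.
  move=> ch; have := ler_norm Z.
  have : v * (2 * d + 1 / 2 ^+ e + 2 * z + 35 * c / 2 ^+ e) < v * (al ^+ 3 / 32).
    by rewrite ltr_pM2l.
  move: ch mt mc bX bY; lra.
case: (boolP [exists P : V, has (fun t => f P * f (P + e1 *+ t) * f (P + e2 *+ (t ^ 2)) != 0)
    (index_iota (2 ^ nu) (2 * 2 ^ nu))]).
  move=> /existsP[P /hasP[t]]; rewrite mem_index_iota => ht.
  rewrite !mulf_eq0 !negb_or => /andP[/andP[h1 h2] h3].
  by exists k, P, t.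
move=> /existsPn hno; exfalso; move/eqP: Lpos; apply.
rewrite /L cformE big1 // => P _; apply: big1_seq => t /andP[_ ht].
by have /hasPn /(_ t ht) := hno P; rewrite negbK => /eqP.
Qed.

End DiscreteCorner.

(* Needed for the product of two [finZmodType]s to be inferred as one. *)
HB.instance Definition _ (U W : finZmodType) := Finite.on (U * W)%type.

(** * The grid inside a finite cyclic product *)

Section Grid.
Context {R : archiRealFieldType}.
Variables (n : nat).
Let A := (2 ^ n)%N.
(** The group has twice the side of the grid in both directions, so that a corner found in the grid
    cannot wrap around. The density drops by the factor 4 that appears in the hypotheses below. *)
Let gx := 'Z_(2 ^ n.+1).
Let gy := 'Z_(2 ^ (2 * n).+1).
Let V : finZmodType := (gx * gy)%type.
Let ex : V := (1, 0).
Let ey : V := (0, 1).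

Lemma pow_gt1 k : (1 < 2 ^ k.+1)%N.
Proof. by rewrite -{1}(expn0 2) ltn_exp2l. Qed.

Lemma ZpS k : (Zp_trunc (2 ^ k.+1)).+2 = (2 ^ k.+1)%N.
Proof. by rewrite Zp_cast // pow_gt1. Qed.

Lemma val_addn k (x : 'Z_(2 ^ k.+1)) (t : nat) :
  (x + t%:R) = (((x : nat) + t) %% 2 ^ k.+1)%N :> nat.
Proof. by rewrite /= Zp_nat /= modnDmr; congr (_ %% _)%N; exact: ZpS. Qed.

Lemma card_grid : #|V| = (4 * A ^ 3)%N.
Proof.
rewrite card_prod !card_ord !ZpS /A -!expnM !expnS.
rewrite (_ : n * 3 = n + 2 * n)%N; last by clear; lia.
by rewrite expnD; move: (2 ^ n)%N (2 ^ (2 * n))%N => ? ?; clear; lia.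
Qed.

Lemma pair_mulrn (x : gx) (y : gy) k : ((x, y) : V) *+ k = (x *+ k, y *+ k).
Proof. by elim: k => // k ih; rewrite !mulrS ih. Qed.

Lemma fst_ex (P : V) t : (P + ex *+ t).1 = ((P.1 + t) %% 2 ^ n.+1)%N :> nat.
Proof. by rewrite /ex pair_mulrn /= -val_addn. Qed.

Lemma snd_ex (P : V) t : (P + ex *+ t).2 = P.2.
Proof. by rewrite /ex pair_mulrn /= mul0rn addr0. Qed.

Lemma fst_ey (P : V) t : (P + ey *+ t).1 = P.1.
Proof. by rewrite /ey pair_mulrn /= mul0rn addr0. Qed.

Lemma snd_ey (P : V) t : (P + ey *+ t).2 = ((P.2 + t) %% 2 ^ (2 * n).+1)%N :> nat.
Proof. by rewrite /ey pair_mulrn /= -val_addn. Qed.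

Lemma sum_Zp k (G : nat -> R) :
  \sum_(x : 'Z_(2 ^ k.+1)) G x = \sum_(0 <= i < 2 ^ k.+1) G i.
Proof. by rewrite -(big_mkord xpredT G) ZpS. Qed.

Definition in_grid (P : V) : bool := (P.1 < A)%N && (P.2 < A ^ 2)%N.

Lemma A2E : (A ^ 2 = 2 ^ (2 * n))%N.
Proof. by rewrite /A -expnM mulnC. Qed.

Lemma sum_grid (G : nat -> nat -> R) :
  \sum_(P : V) (if in_grid P then G P.1 P.2 else 0) =
  \sum_(0 <= i < A) \sum_(0 <= j < A ^ 2) G i j.
Proof.
pose G' i j : R := if (i < A)%N && (j < A ^ 2)%N then G i j else 0.
rewrite -(pair_bigA _ (fun (x : gx) (y : gy) => G' x y)) /=.
under eq_bigr => x _ do rewrite (sum_Zp _ (G' x)).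
rewrite (sum_Zp _ (fun i => \sum_(0 <= j < 2 ^ (2 * n).+1) G' i j)).
have cut k B (H : nat -> R) : (B <= k)%N -> (forall i, (B <= i)%N -> H i = 0) ->
    \sum_(0 <= i < k) H i = \sum_(0 <= i < B) H i.
  move=> Bk h0; rewrite (big_cat_nat (leq0n _) Bk) /= [X in _ + X]big1_seq ?addr0 // => i.
  by rewrite mem_index_iota => /andP[_ /andP[/h0]].
rewrite (cut _ A); last 2 first.
- by rewrite /A leq_exp2l.
- by move=> i Ai; rewrite big1 // => j _; rewrite /G' ltnNge Ai.
apply: eq_big_nat => i /andP[_ iA].
rewrite (cut _ (A ^ 2)%N); last 2 first.
- by rewrite A2E leq_exp2l.
- by move=> j Aj; rewrite /G' iA ltnNge Aj.
by apply: eq_big_nat => j /andP[_ jA]; rewrite /G' iA jA.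
Qed.

Variables (E e K j0 : nat) (c z d al : R) (F U : nat -> nat -> bool).
Let m := (E.+2 * e)%N.
Hypotheses (E480 : E = 480%N) (e0 : (0 < e)%N) (K0 : (0 < K)%N).
Hypothesis (hc : 4 * 2 ^+ E <= c).
Hypothesis (nbig : (m * K.+2 + 512 * (2 * e + j0) <= n)%N).
Hypotheses (al0 : 0 <= al)
  (Fal : 4 * al * A%:R ^+ 3 <= \sum_(0 <= i < A) \sum_(0 <= j < A ^ 2) (F i j)%:R).
Hypothesis (Uc : forall i B l, (2 ^ (2 * n - j0) %| B)%N -> (l < 2 ^ (2 * n - j0))%N ->
  U i (B + l)%N = U i B).
Hypotheses (FU : \sum_(0 <= i < A) \sum_(0 <= j < A ^ 2) (F i j != U i j)%:R
  <= 4 * d * A%:R ^+ 3).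
Hypotheses (z0 : 0 <= z) (zK : 4 <= z ^+ 2 * K%:R).
Hypothesis (err : 2 * d + 1 / 2 ^+ e + 2 * z + 35 * c / 2 ^+ e < al ^+ 3 / 32).

Theorem grid_corner : exists i j t, [/\ (2 ^ (n - m * K) <= t)%N,
  (i + t < A)%N, (j + t ^ 2 < A ^ 2)%N & [&& F i j, F (i + t)%N j & F i (j + t ^ 2)%N]].
Proof.
pose f (P : V) : R := if in_grid P then (F P.1 P.2)%:R else 0.
pose u (P : V) : R := if in_grid P then (U P.1 P.2)%:R else 0.
have b01 (b : bool) : 0 <= (b%:R : R) <= 1 by case: b; rewrite ?ler01 ?lexx.
have f0 P : 0 <= f P by rewrite /f; case: ifP => // _; have /andP[] := b01 (F P.1 P.2).
have f1 P : f P <= 1 by rewrite /f; case: ifP => // _; have /andP[] := b01 (F P.1 P.2).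
have u0 P : 0 <= u P by rewrite /u; case: ifP => // _; have /andP[] := b01 (U P.1 P.2).
have u1 P : u P <= 1 by rewrite /u; case: ifP => // _; have /andP[] := b01 (U P.1 P.2).
pose px (P : V) : nat := P.1. pose py (P : V) : nat := P.2.
have hx P : px (P + ex) = (px P).+1 %[mod 2 ^ n.+1].
  by rewrite /px -[ex]mulr1n fst_ex modn_mod addn1.
have hy P : py (P + ey) = (py P).+1 %[mod 2 ^ (2 * n).+1].
  by rewrite /py -[ey]mulr1n snd_ey modn_mod addn1.
have lt1 (P : V) : (P.1 < 2 ^ n.+1)%N by apply: leq_trans (ltn_ord P.1) _; rewrite ZpS.
have lt2 (P : V) : (P.2 < 2 ^ (2 * n).+1)%N by apply: leq_trans (ltn_ord P.2) _; rewrite ZpS.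
have cv : #|V|%:R = 4 * A%:R ^+ 3 :> R by rewrite card_grid natrM natrX.
have fal : al * #|V|%:R <= \sum_(P : V) f P.
  by rewrite cv (sum_grid (fun i j => (F i j)%:R)); move: Fal; lra.
have fu : \sum_(P : V) `|f P - u P| <= d * #|V|%:R.
  rewrite cv (eq_bigr (fun P => if in_grid P then (F P.1 P.2 != U P.1 P.2)%:R else 0)).
    by rewrite (sum_grid (fun i j => (F i j != U i j)%:R)); move: FU; lra.
  move=> P _; rewrite /f /u; case: ifP => _; last by rewrite subrr normr0.
  by case: (F _ _); case: (U _ _); rewrite ?subrr ?normr0 ?subr0 ?sub0r ?normrN ?normr1.
have uc : cell_const ey py (2 ^ (2 * n - j0)) u.
  move=> B l cB lc; rewrite /u /in_grid fst_ey.
  set cc := (2 ^ (2 * n - j0))%N in cB lc *.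
  have cm : (cc %| 2 ^ (2 * n).+1)%N by apply: dvdn_exp2l; clear; lia.
  have cA : (cc %| A ^ 2)%N by rewrite A2E; apply: dvdn_exp2l; clear; lia.
  (* A cell lies on one side of every multiple of its length, in particular of A^2 and of the
     modulus. *)
  have nowrap M : (cc %| M)%N -> (B.2 + l < M)%N = (B.2 < M)%N.
    move=> cM; apply/idP/idP; first by apply: leq_ltn_trans; rewrite leq_addr.
    move: cB cM; rewrite /py => /dvdnP[b ->] /dvdnP[k ->] h.
    have c0 : (0 < cc)%N by rewrite expn_gt0.
    rewrite ltn_pmul2r // in h; apply: (@leq_trans (b.+1 * cc)%N).
      by rewrite mulSn addnC ltn_add2r.
    by rewrite leq_mul2r h orbT.
  have e2' : (B + ey *+ l).2 = (B.2 + l)%N :> nat.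
    by rewrite snd_ey modn_small // nowrap.
  by rewrite e2' nowrap // Uc.
have [k [P [t [kK /andP[t1 t2] h1 h2 h3]]]] := @discrete_corner R V ex ey px py n E e K j0 c z d al f u
  E480 e0 K0 hc hx hy nbig f0 f1 al0 fal u0 u1 uc fu z0 zK err.
have mk : (0 < m * k.+1)%N by rewrite muln_gt0 /m muln_gt0 e0.
have mKn : (m * K <= n)%N.
  apply: leq_trans nbig; apply: leq_trans (leq_addr _ _); rewrite leq_mul2l.
  by rewrite !leqW ?orbT.
have tA : (t < A)%N.
  apply: leq_trans t2 _; rewrite -expnS leq_exp2l //.
  have : (m * k.+1 <= n)%N by apply: leq_trans mKn; rewrite leq_mul2l kK orbT.
  by move: mk; clear; lia.
have nz (P' : V) : f P' != 0 -> [/\ (P'.1 < A)%N, (P'.2 < A ^ 2)%N & F P'.1 P'.2].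
  rewrite /f /in_grid; case: ifP => [/andP[a b]|]; last by rewrite eqxx.
  by case: (F _ _) => //; rewrite eqxx.
have [i1 i2 i3] := nz _ h1.
have v2 : (P + ex *+ t).1 = (P.1 + t)%N :> nat.
  rewrite fst_ex modn_small //; apply: (@leq_trans (2 * A)); last by rewrite expnS.
  by move: (P.1 : nat) i1 tA => p; clear; lia.
have v3 : (P + ey *+ (t ^ 2)).2 = (P.2 + t ^ 2)%N :> nat.
  rewrite snd_ey modn_small //; apply: (@leq_trans (2 * A ^ 2)); last by rewrite A2E -expnS.
  have : (t ^ 2 < A ^ 2)%N by rewrite ltn_exp2r.
  by move: (P.2 : nat) (t ^ 2)%N (A ^ 2)%N i2 => p; clear; lia.
have [j1 j2 j3] := nz _ h2; have [k1 k2 k3] := nz _ h3.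
rewrite v2 snd_ex in j1 j3; rewrite v3 fst_ey in k2 k3.
exists P.1, P.2, t; split => //; last by apply/and3P.
apply: leq_trans t1; rewrite leq_exp2l // leq_sub2l // leq_mul2l kK orbT //.
Qed.

End Grid.

Require Import Defs.
From mathcomp Require Import all_classical all_reals all_analysis.
From mathcomp Require Import measurable_realfun.

Import numFieldNormedType.Exports.
Local Open Scope classical_set_scope.
Local Open Scope ring_scope.

(** * From measurable sets to grids *)

Section PlaneMeasure.
Variable R : realType.
Local Notation RM := (measurableTypeR R).
Local Notation plane := (RM * RM)%type.
Local Notation leb := (@lebesgue_measure R).
Local Notation mu := (borel_plane_measure R).

Lemma lebesgue_measure_shift (a : R) (A : set RM) : measurable A ->
  leb ((fun x : RM => x + a : RM) @^-1` A) = leb A.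
Proof.
move=> mA.
have mf : measurable_fun [set: RM] (fun x : RM => x + a : RM).
  exact: measurable_funD.
rewrite -[LHS]/(pushforward leb (fun x : RM => x + a : RM) A).
apply/esym/lebesgue_measure_unique => //= _ [[b c]] _ <-.
rewrite /pushforward /=.
have -> : (fun x : R => x + a) @^-1` `]b, c]%classic = `]b - a, c - a]%classic.
  by apply/seteqP; split=> x /=; rewrite !in_itv/= ltrBlDr lerBrDr.
rewrite !lebesgue_measure_itv/= !lte_fin ltrD2r.
by case: ifP => // _; rewrite -!EFinB; congr (_%:E); ring.
Qed.

Definition shift (v p : R * R) : R * R := (p.1 + v.1, p.2 + v.2).

Lemma measurable_shift (v : R * R) :
  measurable_fun [set: plane] (shift v : plane -> plane).
Proof.
apply/measurable_fun_pairP; split=> /=.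
  by apply: (@measurable_funD _ _ R); [exact: measurable_fst|exact: measurable_cst].
by apply: (@measurable_funD _ _ R); [exact: measurable_snd|exact: measurable_cst].
Qed.

Lemma measurable_preimage_shift (v : R * R) (X : set plane) :
  measurable X -> measurable ((shift v : plane -> plane) @^-1` X).
Proof. by move=> mX; rewrite -[X in measurable X]setTI; exact: measurable_shift. Qed.

Lemma plane_measureX (A B : set RM) : measurable A -> measurable B ->
  mu (A `*` B) = (leb A * leb B)%E.
Proof. exact: product_measure1E. Qed.

Lemma plane_measure_shift (v : R * R) (X : set plane) : measurable X ->
  mu ((shift v : plane -> plane) @^-1` X) = mu X.
Proof.
move=> mX; apply/esym.
have mf := measurable_shift v.
rewrite -[RHS]/(pushforward mu (shift v : plane -> plane) X).
apply: product_measure_unique => // A B mA mB.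
rewrite /pushforward.
change (mu (((fun x : RM => x + v.1 : RM) @^-1` A) `*`
  ((fun x : RM => x + v.2 : RM) @^-1` B)) = (leb A * leb B)%E).
rewrite plane_measureX ?lebesgue_measure_shift//.
  by rewrite -[X in measurable X]setTI; apply: measurable_funD.
by rewrite -[X in measurable X]setTI; apply: measurable_funD.
Qed.

End PlaneMeasure.
Lemma exists_pow2V_le (R : archiRealFieldType) (d : R) : 0 < d -> exists j, (2 ^+ j)^-1 <= d.
Proof.
move=> d0; exists (Num.trunc d^-1).+1.
rewrite -[leRHS]invrK lef_pV2 ?posrE ?exprn_gt0 ?invr_gt0//.
apply: (@le_trans _ _ (Num.trunc d^-1).+1%:R); first by rewrite ltW// truncnS_gt.
have : ((Num.trunc d^-1).+1 <= 2 ^ (Num.trunc d^-1).+1)%N by apply: ltnW; exact: ltn_expl.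
by rewrite -(ler_nat R) natrX.
Qed.

(** * Borel subsets of E and their vertical dyadic approximation *)

Section DyadicApproximation.
Variable R : realType.
Local Notation RM := (measurableTypeR R).
Local Notation plane := (RM * RM)%type.
Local Notation leb := (@lebesgue_measure R).
Local Notation mu := (borel_plane_measure R).

Definition half_open_square : set (R * R) := `[0, 1[ `*` `[0, 1[.
Local Notation Sq := half_open_square.

Lemma plane_measure_square (a b : bool) :
  mu ([set` Interval (BLeft (0 : R)) (BSide a 1)] `*`
      [set` Interval (BLeft 0) (BSide b 1)]) = 1%E.
Proof.
rewrite plane_measureX; [|exact: measurable_itv|exact: measurable_itv].
rewrite !lebesgue_measure_itv/= lte_fin ltr01.
by rewrite -!EFinB -EFinM subr0 mulr1.
Qed.

Lemma measurable_half_open_square : measurable (Sq : set plane).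
Proof. by apply: measurableX; exact: measurable_itv. Qed.

Lemma half_open_square_measure : mu Sq = 1%E.
Proof. exact: (plane_measure_square true true). Qed.

Lemma unit_square_measure : mu unit_square = 1%E.
Proof. exact: (plane_measure_square false false). Qed.

Lemma half_open_square_sub : Sq `<=` unit_square.
Proof.
move=> [x y] [/=]; rewrite !in_itv/= => /andP[x0 /ltW x1] /andP[y0 /ltW y1].
by split; rewrite /= in_itv/= ?x0 ?x1 ?y0 ?y1.
Qed.

Lemma outer_measure_boundary : (mu^*)%mu (unit_square `\` Sq : set plane) = 0%E.
Proof.
have mS := measurable_half_open_square.
have mU : measurable (unit_square : set plane).
  by apply: measurableX; exact: measurable_itv.
have hU : (mu unit_square < +oo)%E by rewrite unit_square_measure ltry.
rewrite measurable_mu_extE; last exact: measurableD.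
have -> : mu (unit_square `\` Sq) = (mu unit_square - mu Sq)%E.
  rewrite (measureD mU mS hU); congr (_ - mu _)%E.
  by apply: setIidr; exact: half_open_square_sub.
by rewrite unit_square_measure half_open_square_measure subee.
Qed.

(** The Caratheodory condition, tested on the half-open square, bounds the outer measure of the part
    of the square outside [E]. A countable measurable cover of that part has total measure below 1 -
    eps / 2, and its complement in the square lies in [E]. *)
Lemma inner_approximation (E : set (R * R)) (eps : R) : 0 < eps ->
  E `<=` unit_square -> plane_lebesgue_measurable E ->
  (eps%:E <= plane_lebesgue_measure E)%E ->
  exists E0 : set plane, [/\ measurable E0, E0 `<=` E, E0 `<=` Sq &
    ((eps / 2)%:E < mu E0)%E].
Proof.
move=> eps0 ES mE hE.
have mS := measurable_half_open_square.
have hS : (mu^*)%mu (Sq : set plane) = 1%E.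
  by rewrite measurable_mu_extE// half_open_square_measure.
have := mE (Sq : set plane).
change ((mu^*)%mu (Sq : set plane) = ((mu^*)%mu (Sq `&` E) + (mu^*)%mu (Sq `&` ~` E))%E -> 
  exists E0 : set plane, [/\ measurable E0, E0 `<=` E, E0 `<=` Sq &
    ((eps / 2)%:E < mu E0)%E]).
rewrite hS => spl.
have hE' : (eps%:E <= (mu^*)%mu (Sq `&` E : set plane))%E.
  apply: le_trans hE _; rewrite /plane_lebesgue_measure /completed_measure_extension.
  rewrite -[leRHS]adde0 -outer_measure_boundary.
  apply: (le_trans _ (outer_measureU2 _ _ _)).
  apply: le_mu_ext => p Ep.
  have [Sp|nSp] := pselect (Sq p); first by left.
  by right; split => //; exact: ES.
have hC : ((mu^*)%mu (Sq `&` ~` E : set plane) < (1 - eps / 2)%:E)%E.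
  have := mu_ext_ge0 (measure_ge0 mu) (Sq `&` ~` E).
  have := mu_ext_ge0 (measure_ge0 mu) (Sq `&` E).
  move: spl hE'; case: ((mu^*)%mu _) => [u| |]; case: ((mu^*)%mu _) => [w| |] //=.
  by rewrite -EFinD => -[h1]; rewrite !lee_fin lte_fin => h2 h3 h4; lra.
have [_ [A [mA covA] <-] hA] := ereal_inf_lt hC.
pose B := \bigcup_k A k.
have mB : measurable B by exact: bigcup_measurable.
have muB : (mu B < (1 - eps / 2)%:E)%E.
  by apply: le_lt_trans hA; apply: measure_sigma_subadditive.
exists (Sq `\` B); split.
- exact: measurableD.
- move=> p [Sp nBp]; apply: contrapT => nEp; apply: nBp; exact: covA.
- by move=> p [].
have : (mu (Sq `&` B) <= mu B)%E.
  by apply: le_measure; rewrite ?inE//; exact: measurableI.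
have hSf : (mu Sq < +oo)%E by rewrite half_open_square_measure ltry.
have -> : mu (Sq `\` B) = (mu Sq - mu (Sq `&` B))%E by exact: measureD.
rewrite half_open_square_measure => h1.
have := le_lt_trans h1 muB.
have := measure_ge0 mu (Sq `&` B).
case: (mu (Sq `&` B)) => [u| |]//=; last by rewrite addey ?ltry.
by rewrite -EFinB !lte_fin => _ h2; lra.
Qed.

(** Off the exceptional set [D], the columns of [E] in the square are unions of dyadic intervals of
    length 2^-j. Nothing is asked of the dependence on x, so that sets defined by x alone need no
    exceptional set. *)
Definition dyadic_invariant (j : nat) (D E : set (R * R)) :=
  forall x y y' : R, Sq (x, y) -> Sq (x, y') -> ~ D (x, y) -> ~ D (x, y') ->
  Num.floor (2 ^+ j * y) = Num.floor (2 ^+ j * y') -> E (x, y) -> E (x, y').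

Lemma floor_dyadic_le (j j' : nat) (y y' : R) : (j <= j')%N ->
  Num.floor (2 ^+ j' * y) = Num.floor (2 ^+ j' * y') ->
  Num.floor (2 ^+ j * y) = Num.floor (2 ^+ j * y').
Proof.
move=> jj'.
wlog suff le : y y' / Num.floor (2 ^+ j' * y) = Num.floor (2 ^+ j' * y') ->
    (Num.floor (2 ^+ j * y) <= Num.floor (2 ^+ j * y')).
  by move=> h; apply/eqP; rewrite eq_le !le//.
move=> h; rewrite floor_ge_int.
have p0 : (0 : R) < 2 ^+ (j' - j) by rewrite exprn_gt0.
have pE : 2 ^+ j' = 2 ^+ (j' - j) * 2 ^+ j :> R by rewrite -exprD subnK.
rewrite -(ler_pM2l p0) mulrA -pE -[2 ^+ (j' - j)]/((2 : R) ^+ (j' - j)).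
have -> : (2 : R) ^+ (j' - j) * (Num.floor (2 ^+ j * y))%:~R =
   (2 ^+ (j' - j) * Num.floor (2 ^+ j * y))%:~R by rewrite rmorphM/= rmorphXn.
rewrite -floor_ge_int -h floor_ge_int rmorphM/= rmorphXn pE -mulrA ler_pM2l//.
exact: floor_le.
Qed.

Definition dyadic_approximable (E : set plane) :=
  measurable E /\ forall d : R, 0 < d -> exists j D,
    [/\ measurable (D : set plane), (mu D <= d%:E)%E & dyadic_invariant j D E].

Lemma dyadic_invariantW j j' D D' E : (j <= j')%N -> D `<=` D' ->
  dyadic_invariant j D E -> dyadic_invariant j' D' E.
Proof.
move=> jj' DD' h x y y' S1 S2 D1 D2 f; apply: h => //.
- by move/DD'.
- by move/DD'.
- exact: floor_dyadic_le f.
Qed.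

Lemma dyadic_approximable0 : dyadic_approximable set0.
Proof.
split=> // d d0; exists 0%N, set0; split => //.
by rewrite measure0 lee_fin ltW.
Qed.

Lemma dyadic_approximableC E : dyadic_approximable E -> dyadic_approximable (~` E).
Proof.
move=> [mE h]; split; first exact: measurableC.
move=> d /h [j [D [mD dD inv]]]; exists j, D; split=> // x y y' S1 S2 D1 D2 f nE.
by move=> Exy'; apply: nE; exact: inv Exy'.
Qed.

Lemma dyadic_approximableU A B : dyadic_approximable A -> dyadic_approximable B ->
  dyadic_approximable (A `|` B).
Proof.
move=> [mA hA] [mB hB]; split; first exact: measurableU.
move=> d d0; have d2 : 0 < d / 2 by rewrite divr_gt0.
have [j1 [D1 [mD1 dD1 inv1]]] := hA _ d2.
have [j2 [D2 [mD2 dD2 inv2]]] := hB _ d2.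
exists (maxn j1 j2), (D1 `|` D2); split; first exact: measurableU.
  apply: (le_trans (@measureU2 _ _ _ mu _ _ mD1 mD2)).
  by rewrite [d]splitr EFinD leeD.
move=> x y y' S1 S2 nD nD' f [Exy|Exy]; [left|right].
  apply: (dyadic_invariantW (leq_maxl j1 j2) (@subsetUl _ D1 D2) inv1) f Exy => //.
by apply: (dyadic_invariantW (leq_maxr j1 j2) (@subsetUr _ D1 D2) inv2) f Exy.
Qed.

(** The union is approximated by a finite one. The remainders [T n], cut down to the square in order
    to have finite measure, decrease to the empty set, and one of small measure is added to the
    exceptional set. *)
Lemma dyadic_approximable_bigcup (F : (set plane)^nat) :
  (forall k, dyadic_approximable (F k)) -> dyadic_approximable (\bigcup_k F k).
Proof.
move=> hF.
have mF k : measurable (F k) by have [] := hF k.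
have mU : measurable (\bigcup_k F k) by exact: bigcup_measurable.
split=> // d d0; have d2 : 0 < d / 2 by rewrite divr_gt0.
pose P n := \big[setU/set0]_(k < n) F k.
have hP n : dyadic_approximable (P n).
  rewrite /P; elim: n => [|n IH]; first by rewrite big_ord0; exact: dyadic_approximable0.
  by rewrite big_ord_recr/=; exact: dyadic_approximableU.
pose T n : set plane := Sq `&` ((\bigcup_k F k) `\` P n).
have mP n : measurable (P n) by have [] := hP n.
have mT n : measurable (T n).
  by apply: measurableI; [exact: measurable_half_open_square|exact: measurableD].
have T0 : \bigcap_n T n = set0.
  apply/seteqP; split=> // p h; have [_ [[k _ Fk] _]] := h 0%N I.
  have [_ [_]] := h k.+1 I; apply.
  by rewrite /P -bigcup_mkord; exists k => /=.
have cT : mu \o T @ \oo --> 0%E.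
  rewrite -(measure0 mu) -T0; apply: nonincreasing_cvg_mu => //.
  - apply: (@le_lt_trans _ _ (mu Sq)).
      by apply: le_measure; rewrite ?inE//; [exact: measurable_half_open_square|move=> p []].
    by rewrite half_open_square_measure ltry.
  - by rewrite T0.
  - move=> m n mn; apply/subsetPset => p [Sp [Up nP]]; split=> //; split=> //.
    by move=> Pp; apply: nP; move: Pp; rewrite /P -!bigcup_mkord => -[k /= km Fk];
      exists k => //=; exact: leq_trans mn.
have [N _ hN] : \forall n \near \oo, (mu (T n) < (d / 2)%:E)%E.
  have nb : nbhs (0%E : \bar R) [set y | (y < (d / 2)%:E)%E].
    exact: (@nbhs_open_ereal_lt R 0 (fun=> d / 2) d2).
  exact: (cT _ nb).
have [_ /(_ _ d2) [j [D [mD dD inv]]]] := hP N.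
exists j, (D `|` T N); split; first exact: measurableU.
  apply: (le_trans (@measureU2 _ _ _ mu _ _ mD (mT N))).
  by rewrite [d]splitr EFinD leeD// ltW//; exact: (hN N (leqnn N)).
move=> x y y' S1 S2 nD nD' f Uy.
suff : P N (x, y') by rewrite /P -bigcup_mkord => -[k _ Fk]; exists k.
apply: inv f _ => //; [by move=> h; apply: nD; left|by move=> h; apply: nD'; left|].
by apply: contrapT => nP; apply: nD; right.
Qed.

Lemma dyadic_approximable_fst (A : set RM) : measurable A ->
  dyadic_approximable (fst @^-1` A).
Proof.
move=> mA; split.
  by rewrite -[X in measurable X]setTI; exact: measurable_fst.
by move=> d d0; exists 0%N, set0; split => //; rewrite measure0 lee_fin ltW.
Qed.

(** The exceptional set is the strip over the dyadic interval that contains a: all other dyadic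
    intervals lie on one side of a. *)
Lemma dyadic_approximable_ray (a : R) :
  dyadic_approximable (snd @^-1` (`]a, +oo[ : set RM)).
Proof.
split.
  by rewrite -[X in measurable X]setTI; apply: measurable_snd => //; exact: measurable_itv.
move=> d d0.
have [j hj] := exists_pow2V_le d0.
pose m : R := (Num.floor (2 ^+ j * a))%:~R.
have p0 : (0 : R) < 2 ^+ j by rewrite exprn_gt0.
exists j, (`[0, 1[ `*` `[m / 2 ^+ j, (m + 1) / 2 ^+ j[); split.
- by apply: measurableX; exact: measurable_itv.
- rewrite plane_measureX; [|exact: measurable_itv|exact: measurable_itv].
  rewrite !lebesgue_measure_itv/= lte_fin ltr01 lte_fin ltr_pM2r ?invr_gt0//.
  rewrite ltrDl ltr01 -!EFinB -EFinM lee_fin subr0 mul1r -mulrBl.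
  by rewrite addrAC subrr add0r mul1r.
move=> x y y' [/= xS _] _ nD _ f; rewrite !in_itv/= !andbT => ay.
rewrite ltNge; apply/negP => y'a; apply: nD; split => //=.
have fm : Num.floor (2 ^+ j * y) = Num.floor (2 ^+ j * a).
  apply/eqP; rewrite eq_le {1}f !le_floor//; rewrite ler_pM2l//; exact: ltW.
rewrite in_itv/= ler_pdivrMr// ltr_pdivlMr// /m -fm ![y * _]mulrC floor_le/=.
by have /andP[_] := floor_itv (2 ^+ j * y); rewrite intrD.
Qed.

(** The approximable sets form a sigma-algebra. The product sigma-algebra is generated by cylinders
    over the two coordinates, and those over the second coordinate are reduced to rays. *)
Lemma measurable_dyadic_approximable (E : set plane) :
  measurable E -> dyadic_approximable E.
Proof.
have sa : sigma_algebra setT dyadic_approximable.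
  split.
  - exact: dyadic_approximable0.
  - by move=> A hA; rewrite setTD; exact: dyadic_approximableC.
  - exact: dyadic_approximable_bigcup.
move: E; apply: smallest_sub => // X [] [B mB <-]; rewrite setTI.
  exact: dyadic_approximable_fst.
move: B mB.
have <- : (@RGenOInfty.G R).-sigma.-measurable = (@measurable _ RM).
  by rewrite -RGenOInfty.measurableE.
apply: smallest_sub.
  split.
  - by rewrite /= preimage_set0; exact: dyadic_approximable0.
  - move=> A hA; rewrite /= setTD preimage_setC; exact: dyadic_approximableC.
  - by move=> A hA; rewrite /= preimage_bigcup; exact: dyadic_approximable_bigcup.
by move=> _ [a ->]; exact: dyadic_approximable_ray.
Qed.

End DyadicApproximation.
Lemma measure_bigcup_finType d (T : measurableType d) (R : realType)
    (m : {measure set T -> \bar R}) (I : finType) (F : I -> set T) :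
  (forall i, measurable (F i)) -> trivIset setT F ->
  (m (\bigcup_i F i) = \sum_i m (F i))%E.
Proof.
move=> mF tF; rewrite measure_fin_bigcup//; last exact: finite_finset.
rewrite (@fsbigE _ _ _ _ _ (index_enum I)) ?index_enum_uniq//.
  by apply: eq_bigl => i; rewrite in_setT.
by move=> i _; rewrite mem_index_enum.
Qed.

(** * Averaging over the offset of the grid *)

Section RandomOffset.
Variable R : realType.
Local Notation RM := (measurableTypeR R).
Local Notation plane := (RM * RM)%type.
Local Notation mu := (borel_plane_measure R).
Variables (I : finType) (v : I -> R * R) (Q : set plane).
Hypothesis mQ : measurable Q.

Definition translate (w : R * R) (X : set plane) : set plane :=
  (shift (- w.1, - w.2) : plane -> plane) @^-1` X.

Lemma measurable_translate w : measurable (translate w Q).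
Proof. exact: measurable_preimage_shift. Qed.

(** By translation invariance the offsets in [Q] that send the i-th grid point into [X] have the
    measure of the part of [X] in the i-th translated cell. *)
Lemma integral_count_translates (X : set plane) : measurable X ->
  (\int[mu]_(p in Q) (\sum_i (\1_X (shift (v i) p))%:E) =
   \sum_i mu (X `&` translate (v i) Q))%E.
Proof.
move=> mX.
have mi i : measurable ((shift (v i) : plane -> plane) @^-1` X).
  exact: measurable_preimage_shift.
rewrite (ge0_integral_sum mu mQ); last 2 first.
- move=> i; apply: measurableT_comp => //.
  rewrite (_ : (fun x => _) = \1_((shift (v i) : plane -> plane) @^-1` X)).
    by apply: measurable_indic.
  by apply/funext => p; rewrite !indicE.
- by move=> i p _; rewrite lee_fin.
apply: eq_bigr => i _.
rewrite (eq_integral (fun p => (\1_((shift (v i) : plane -> plane) @^-1` X) p)%:E)); last first.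
  by move=> p _; rewrite !indicE.
rewrite integral_indic//.
rewrite -(@plane_measure_shift _ (v i) (X `&` translate (v i) Q)); last first.
  by apply: measurableI => //; exact: measurable_translate.
congr (mu _); rewrite preimage_setI; congr (_ `&` _).
apply/seteqP; split=> -[x y]; rewrite /translate /shift /=.
  by rewrite !addrK.
by rewrite !addrK.
Qed.

Hypothesis tQ : trivIset setT (fun i => translate (v i) Q).

(* Integrate the assumed inequality over [Q]. *)
Lemma offset_average (X D : set plane) (c k q : R) : measurable X -> measurable D ->
  X `<=` \bigcup_i translate (v i) Q -> mu Q = q%:E -> 0 <= c -> 0 <= k ->
  (forall p, Q p -> \sum_i (\1_X (shift (v i) p)) <=
     c + k * \sum_i (\1_D (shift (v i) p)) :> R) ->
  (mu X <= (c * q)%:E + k%:E * mu D)%E.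
Proof.
move=> mX mD cov hq c0 k0 h.
have mt i : measurable (translate (v i) Q) by exact: measurable_translate.
have mone (Y : set plane) : measurable Y ->
    measurable_fun Q (fun p : plane => \sum_i (\1_Y (shift (v i) p))%:E)%E.
  move=> mY; apply: emeasurable_sum => i.
  apply: measurableT_comp => //.
  rewrite (_ : (fun x => _) = \1_((shift (v i) : plane -> plane) @^-1` Y)).
    by apply: measurable_indic; exact: measurable_preimage_shift.
  by apply/funext => p; rewrite !indicE.
have s1 : (mu X <= \int[mu]_(p in Q) (\sum_i (\1_X (shift (v i) p))%:E))%E.
  rewrite integral_count_translates//.
  rewrite {1}(_ : X = \bigcup_i (X `&` translate (v i) Q)); last first.
    by rewrite -setI_bigcupr setIidl.
  rewrite measure_bigcup_finType//.
  - by move=> i; exact: measurableI.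
  - exact: trivIset_setIl.
have s2 : (\int[mu]_(p in Q) (\sum_i (\1_D (shift (v i) p))%:E) <= mu D)%E.
  rewrite integral_count_translates// -measure_bigcup_finType//; last 2 first.
  - by move=> i; exact: measurableI.
  - exact: trivIset_setIl.
  apply: le_measure; rewrite ?inE//; last by move=> p [i _ []].
  by apply: fin_bigcup_measurable; [exact: finite_finset|move=> i _; exact: measurableI].
apply: (le_trans s1).
apply: (@le_trans _ _ (\int[mu]_(p in Q) (c%:E + k%:E * \sum_i (\1_D (shift (v i) p))%:E))%E).
  apply: ge0_le_integral => //.
  - by move=> p _; apply: sume_ge0 => i _; rewrite lee_fin.
  - exact: mone.
  - by apply: emeasurable_funD => //; apply: emeasurable_funM => //; exact: mone.
  by move=> p Qp; rewrite !sumEFin -EFinM -EFinD lee_fin; exact: h.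
rewrite ge0_integralD//; last 2 first.
- by move=> p _; apply: mule_ge0 => //; apply: sume_ge0 => i _; rewrite lee_fin.
- by apply: emeasurable_funM => //; exact: mone.
rewrite integral_cst// hq -EFinM ge0_integralZl//; last 2 first.
- exact: mone.
- by move=> p _; apply: sume_ge0 => i _; rewrite lee_fin.
by apply: leeD2l; apply: lee_wpmul2l.
Qed.

End RandomOffset.

(** * Choice of the parameters *)

Section Numerics.
Variable R : realType.

Lemma pow2_approx (eps : R) : 0 < eps -> eps < 1 ->
  exists i, (2 ^+ i)^-1 <= eps /\ 2 ^+ i <= 2 / eps.
Proof.
move=> e0 e1.
have ex := exists_pow2V_le e0.
case: (ex_minnP ex) => -[|i] hi mi.
  exists 0%N; split=> //; rewrite expr0 ler_pdivlMr// mul1r.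
  by apply/ltW/(lt_trans e1); rewrite ltr1n.
exists i.+1; split=> //.
have : eps < (2 ^+ i)^-1.
  by rewrite ltNge; apply/negP => /mi; rewrite ltnn.
move=> h; rewrite exprS ler_pdivlMr// -mulrA ler_piMr//.
by rewrite mulrC -ler_pdivlMr ?exprn_gt0// mul1r ltW.
Qed.

(** One exponential is to spare, as already 2^m <= exp(m) <= exp(B). *)
Lemma expR_pow2_lt (m : nat) (B : R) : m%:R <= B ->
  expR (- expR B) < (2 ^+ m)^-1.
Proof.
move=> mB; rewrite expRN ltf_pV2 ?posrE ?exprn_gt0 ?expR_gt0//.
apply: (@le_lt_trans _ _ (expR m%:R)).
  rewrite -[m%:R]mulr1 expRM_natl lerXn2r ?nnegrE ?expR_ge0//.
  by apply: le_trans (expR_ge1Dx 1); rewrite -natr1.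
rewrite ltr_expR (le_lt_trans mB)//.
by apply: lt_le_trans (expR_ge1Dx B); rewrite ltrDr.
Qed.

(* With [2 ^- i] comparable to [eps], take [e = 3 i + E + 29], [K = 2 ^ (6 i + 44)]
   and [d = z = 2 ^- (3 i + 21)]. *)
Lemma parameters (E : nat) : exists C : R, 0 < C /\
  forall eps : R, 0 < eps -> eps < 1 / 2 -> exists e K (d z : R),
  [/\ [/\ (0 < e)%N, (0 < K)%N, 0 < d & 0 <= z], 4 <= z ^+ 2 * K%:R,
    2 * d + 1 / 2 ^+ e + 2 * z + 35 * (4 * 2 ^+ E) / 2 ^+ e < (eps / 16) ^+ 3 / 32 &
    expR (- expR (eps `^ (- C))) < (2 ^+ (E.+2 * e * K))^-1].
Proof.
(* Here 7 i = i + 6 i: the factor linear in i is O(2^i), and K is O(2^(6 i)). *)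
have [P hP] : exists P, forall i, (E.+2 * (3 * i + E + 29) * 2 ^ (6 * i + 44) <= 2 ^ P * 2 ^ (7 * i))%N.
  have [p hp] : exists p, p = (E.+2 * (E + 32) * 2 ^ 44)%N by eexists.
  exists p => i.
  have h1 : (3 * i + E + 29 <= (E + 32) * 2 ^ i)%N.
    have := ltn_expl i (isT : (1 < 2)%N); nia.
  apply: (@leq_trans (E.+2 * ((E + 32) * 2 ^ i) * 2 ^ (6 * i + 44))%N).
    by rewrite leq_mul2r leq_mul2l h1 !orbT.
  have -> : (E.+2 * ((E + 32) * 2 ^ i) * 2 ^ (6 * i + 44) = p * 2 ^ (7 * i))%N.
    rewrite hp expnD (_ : (7 * i = i + 6 * i)%N); last by rewrite -mulSn.
    by rewrite expnD; move: (2 ^ 44)%N (2 ^ i)%N (2 ^ (6 * i))%N => a b c'; ring.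
  by rewrite leq_mul2r ltnW ?orbT// ltn_expl.
(* Since eps < 1 / 2, 2^P <= eps^-P and 2^(7 i) <= (2 / eps)^7 <= eps^-14. *)
exists (P + 14)%:R; split; first by rewrite ltr0n addnS.
move=> eps eps0 eps2.
have eps1 : eps < 1 by lra.
have [i [hi1 hi2]] := pow2_approx eps0 eps1.
pose a : R := (2 ^+ i)^-1.
have a0 : 0 < a by rewrite invr_gt0 exprn_gt0.
have w0 : (0 : R) < 2 ^+ E by rewrite exprn_gt0.
exists (3 * i + E + 29)%N, (2 ^ (6 * i + 44))%N, (a ^+ 3 / 2 ^+ 21), (a ^+ 3 / 2 ^+ 21).
have pa k : (2 : R) ^+ (k * i) = a ^- k.
  by rewrite /a exprVn invrK mulnC exprM.
have a30 : 0 < a ^+ 3 by rewrite exprn_gt0.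
have ae : a ^+ 3 <= eps ^+ 3 by rewrite lerXn2r ?nnegrE// ltW.
have d0 : 0 < a ^+ 3 / 2 ^+ 21 :> R by rewrite divr_gt0// exprn_gt0.
split.
- split=> //; last exact: ltW.
    by rewrite addnS.
  by rewrite expn_gt0.
- have -> : (2 ^ (6 * i + 44))%:R = a ^- 6 * 2 ^+ 44 :> R by rewrite natrX exprD pa.
  have -> : (2 : R) ^+ 44 = 4 * (2 ^+ 21) ^+ 2.
    by rewrite -[44%N]/(2 + 21 * 2)%N exprD exprM; congr (_ * _); ring.
  have p21 : (2 : R) ^+ 21 != 0 by rewrite expf_neq0.
  have an0 : a != 0 by rewrite gt_eqF.
  rewrite le_eqVlt; apply/orP; left; apply/eqP; move: p21; move: (2 ^+ 21) => s s0.
  by field; rewrite s0 an0.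
(* The unit is q = a^3 / 2^17. The terms on the left are q / 8, at most q / 4096, again q / 8, and
   140 q / 4096; the right-hand side is at least q. *)
- have -> : (2 : R) ^+ (3 * i + E + 29) = a ^- 3 * 2 ^+ E * (4096 * 2 ^+ 17).
    rewrite 2!exprD pa; congr (_ * _ * _).
    by rewrite -[29%N]/(12 + 17)%N exprD; congr (_ * _); ring.
  have -> : (2 : R) ^+ 21 = 16 * 2 ^+ 17.
    by rewrite -[21%N]/(4 + 17)%N exprD; congr (_ * _); ring.
  have -> : (eps / 16) ^+ 3 / 32 = eps ^+ 3 / 2 ^+ 17.
    have -> : (2 : R) ^+ 17 = 16 ^+ 3 * 32 by ring.
    by field.
  have w1 : 1 <= (2 : R) ^+ E by rewrite exprn_ege1// ler1n.
  have s0 : (0 : R) < 2 ^+ 17 by rewrite exprn_gt0.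
  move: w0 w1 s0 a30 ae a0; move: (2 ^+ E) (2 ^+ 17) => w s w0 w1 s0 a30 ae a0.
  have an0 : a != 0 by rewrite gt_eqF.
  have wn0 : w != 0 by rewrite gt_eqF.
  have sn0 : s != 0 by rewrite gt_eqF.
  have [q qE] : exists q, q = a ^+ 3 / s by eexists.
  have q0 : 0 < q by rewrite qE divr_gt0.
  have h1 : 1 / (a ^- 3 * w * (4096 * s)) = q / 4096 * w^-1.
    by rewrite qE; field; rewrite an0 wn0 sn0.
  have h2 : 35 * (4 * w) / (a ^- 3 * w * (4096 * s)) = 140 * q / 4096.
    by rewrite qE; field; rewrite an0 wn0 sn0.
  have h3 : a ^+ 3 / (16 * s) = q / 16 by rewrite qE; field.
  have h4 : q / 4096 * w^-1 <= q / 4096.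
    apply: ler_piMr; last by rewrite invf_le1.
    by apply: divr_ge0; [exact: ltW|exact: ler0n].
  apply: (@lt_le_trans _ _ q); last by rewrite qE ler_pM2r ?invr_gt0.
  by rewrite h1 h2 h3; clear -h4 q0; move: (q / 4096 * w^-1) h4 => u h4; lra.
- apply: expR_pow2_lt.
  have e1 : 1 <= eps^-1 by rewrite invf_ge1// ltW.
  have e2 : 2 <= eps^-1 by rewrite -(invrK 2) lef_pV2 ?posrE//; lra.
  apply: (@le_trans _ _ ((2 ^ P * 2 ^ (7 * i))%N%:R)).
    by rewrite ler_nat; exact: hP.
  rewrite powRN powR_mulrn; last exact: ltW.
  rewrite natrM !natrX -exprVn exprD.
  apply: ler_pM; rewrite ?exprn_ge0//.
    by rewrite lerXn2r ?nnegrE// (le_trans _ e2).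
  rewrite mulnC exprM -[14%N]/(2 * 7)%N [eps^-1 ^+ (2 * 7)]exprM.
  rewrite lerXn2r ?nnegrE ?exprn_ge0 ?invr_ge0 ?(ltW eps0)//.
  by apply: le_trans hi2 _; rewrite expr2 ler_wpM2r// invr_ge0 ltW.
Qed.

End Numerics.

(** * Sampling a set on a shifted grid *)

Section GridSampling.
Variable R : realType.
Local Notation RM := (measurableTypeR R).
Local Notation plane := (RM * RM)%type.
Local Notation mu := (borel_plane_measure R).
Local Notation Sq := (@half_open_square R).
Variable A : nat.
Hypothesis A0 : (0 < A)%N.

Definition grid_point (p : R * R) (i j : nat) : R * R :=
  (p.1 + i%:R / A%:R, p.2 + j%:R / (A ^ 2)%:R).

Definition grid_cell : set (R * R) := `[0, A%:R^-1[ `*` `[0, (A ^ 2)%:R^-1[.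

Lemma floor_div_uniq (N i : nat) (x : R) : (0 < N)%N ->
  0 <= x - i%:R / N%:R < N%:R^-1 -> Num.floor (x * N%:R) = i.
Proof.
move=> N0 /andP[h1 h2]; have NR : (0 : R) < N%:R by rewrite ltr0n.
apply: floor_def; rewrite intrD -!pmulrn -ler_pdivrMr// -ltr_pdivlMr// mulrDl mul1r.
by apply/andP; split; lra.
Qed.

Lemma grid_point_square p i j : grid_cell p -> (i < A)%N -> (j < A ^ 2)%N ->
  Sq (grid_point p i j).
Proof.
have AR : (0 : R) < A%:R by rewrite ltr0n.
have A2R : (0 : R) < (A ^ 2)%:R by rewrite ltr0n expn_gt0 A0.
have aux (N k : nat) (x : R) : (0 : R) < N%:R -> 0 <= x < N%:R^-1 -> (k < N)%N ->
    0 <= x + k%:R / N%:R < 1.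
  move=> N0 /andP[x0 x1] kN; rewrite addr_ge0 ?divr_ge0// ?ltW//=.
  have : k.+1%:R / N%:R <= 1 :> R by rewrite ler_pdivrMr// mul1r ler_nat.
  by rewrite -natr1 mulrDl mul1r; lra.
case: p => x y [/=]; rewrite !in_itv/= => hx hy iA jA.
by split; rewrite /= in_itv/=; apply: aux.
Qed.

(** If every offset failed, then for each one either [X] is met fewer than (eps / 4) A^3 times, or
    [D] is met more than 4 (delta / eps) A^3 times, and then A^3 bounds the count of [X]. In both
    cases the count of [X] is at most (eps / 4) A^3 plus eps / (4 delta) times the count of [D].
    Averaging over the offsets gives mu X <= eps / 4 + eps / 4, a contradiction. *)
Lemma grid_sampling (X D : set plane) (eps delta : R) : measurable X -> measurable D ->
  X `<=` Sq -> 0 < eps -> 0 < delta -> ((eps / 2)%:E < mu X)%E -> (mu D <= delta%:E)%E ->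
  exists p, [/\ grid_cell p,
   eps / 4 * A%:R ^+ 3 <= \sum_(0 <= i < A) \sum_(0 <= j < A ^ 2) (grid_point p i j \in X)%:R &
   \sum_(0 <= i < A) \sum_(0 <= j < A ^ 2) (grid_point p i j \in D)%:R <=
     4 * (delta / eps) * A%:R ^+ 3].
Proof.
move=> mX mD XS eps0 del0 hX hD; apply: contrapT => none.
have AR : (0 : R) < A%:R by rewrite ltr0n.
have A2 : (0 < A ^ 2)%N by rewrite expn_gt0 A0.
have A2R : (0 : R) < (A ^ 2)%:R by rewrite ltr0n.
pose v (k : 'I_A * 'I_(A ^ 2)) : R * R := (k.1%:R / A%:R, k.2%:R / (A ^ 2)%:R).
have cellE k (p : R * R) : translate (v k) grid_cell p <->
    (0 <= p.1 - k.1%:R / A%:R < A%:R^-1) /\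
    (0 <= p.2 - k.2%:R / (A ^ 2)%:R < (A ^ 2)%:R^-1).
  by rewrite /translate /grid_cell /shift /=; split=> -[]; rewrite /= !in_itv.
have mQ : measurable (grid_cell : set plane).
  by apply: measurableX; exact: measurable_itv.
have tQ : trivIset setT (fun k => translate (v k) grid_cell).
  move=> [k1 k2] [l1 l2] _ _ [p []] /cellE[h1 h2] /cellE[h3 h4].
  apply/eqP; rewrite xpair_eqE; apply/andP; split; rewrite -val_eqE/=.
    by rewrite -eqz_nat -(floor_div_uniq A0 h1) -(floor_div_uniq A0 h3).
  by rewrite -eqz_nat -(floor_div_uniq A2 h2) -(floor_div_uniq A2 h4).
have aux (N : nat) (x : R) : (0 < N)%N -> 0 <= x < 1 ->
    exists k : 'I_N, 0 <= x - k%:R / N%:R < N%:R^-1.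
  move=> N0 /andP[x0 x1]; have NR : (0 : R) < N%:R by rewrite ltr0n.
  have xN0 : 0 <= x * N%:R by rewrite mulr_ge0.
  have kN : (Num.trunc (x * N%:R) < N)%N.
    by rewrite truncn_lt_nat// -[ltRHS]mul1r ltr_pM2r.
  exists (Ordinal kN) => /=; have /andP[h1 h2] := truncn_itv xN0.
  rewrite -natr1 in h2.
  rewrite subr_ge0 ler_pdivrMr// h1/= ltrBlDr -[X in X + _]mul1r -mulrDl ltr_pdivlMr//.
  by rewrite addrC.
have cov : X `<=` \bigcup_k translate (v k) grid_cell.
  move=> [x y] /XS [/=]; rewrite !in_itv/= => hx hy.
  have [i hi] := aux _ _ A0 hx; have [j hj] := aux _ _ A2 hy.
  by exists (i, j) => //; apply/cellE.
have qE : mu grid_cell = ((A%:R ^+ 3)^-1)%:E.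
  rewrite plane_measureX; [|exact: measurable_itv|exact: measurable_itv].
  rewrite !lebesgue_measure_itv/= !lte_fin !invr_gt0 AR A2R -!EFinB -EFinM !subr0.
  by rewrite natrX -invfM -exprS.
have sumE (Y : set plane) (p : R * R) : \sum_k (\1_Y (shift (v k) p)) =
    \sum_(0 <= i < A) \sum_(0 <= j < A ^ 2) (grid_point p i j \in Y)%:R :> R.
  rewrite -(pair_bigA _ (fun i j => \1_Y (shift (v (i, j)) p)))/= big_mkord.
  by apply: eq_bigr => i _; rewrite big_mkord; apply: eq_bigr => j _; rewrite indicE.
have A3 : (0 : R) < A%:R ^+ 3 by rewrite exprn_gt0.
have : (mu X <= (eps / 4 * A%:R ^+ 3 * (A%:R ^+ 3)^-1)%:E +
    (eps / (4 * delta))%:E * mu D)%E.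
  apply: (@offset_average _ _ v _ mQ tQ _ _ _ _ _ mX mD cov qE) => [||p Qp].
  - by rewrite mulr_ge0 ?divr_ge0// ltW.
  - by rewrite divr_ge0 ?mulr_ge0// ltW.
  - rewrite !sumE; set NX := \sum_(_ <= _ < _) _; set ND := \sum_(_ <= _ < _) _.
    have ND0 : 0 <= ND by apply: sumr_ge0 => i _; apply: sumr_ge0 => j _.
    have NXA : NX <= A%:R ^+ 3.
      apply: (@le_trans _ _ (\sum_(0 <= i < A) \sum_(0 <= j < A ^ 2) 1)).
        by apply: ler_sum => i _; apply: ler_sum => j _; case: (_ \in _).
      by rewrite !sumr_const_nat !subn0 -mulrnA -natrX ler_nat mulnC.
    have [hNX|hNX] := ltP NX (eps / 4 * A%:R ^+ 3).
      by apply: (le_trans (ltW hNX)); rewrite lerDl mulr_ge0// divr_ge0 ?mulr_ge0// ltW.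
    have [hND|hND] := leP ND (4 * (delta / eps) * A%:R ^+ 3).
      by case: none; exists p.
    apply: (le_trans NXA); apply: (@le_trans _ _ (eps / (4 * delta) * ND)).
      have -> : A%:R ^+ 3 = eps / (4 * delta) * (4 * (delta / eps) * A%:R ^+ 3) :> R.
        by field; rewrite !gt_eqF.
      by rewrite ler_pM2l ?ltW// divr_gt0 ?mulr_gt0.
    by rewrite lerDr mulr_ge0 ?divr_ge0// ltW.
rewrite mulfK ?gt_eqF//; apply/negP; rewrite -ltNge; apply: le_lt_trans hX.
have -> : (eps / 2)%:E = ((eps / 4)%:E + (eps / (4 * delta))%:E * delta%:E)%E.
  by rewrite -EFinM -EFinD; congr (_%:E); field; rewrite gt_eqF.
by apply: leeD2l; apply: lee_wpmul2l => //; rewrite lee_fin divr_ge0 ?mulr_ge0// ltW.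
Qed.

End GridSampling.

(** An offset below the mesh 1 / N does not push the points k w, ..., k w + w - 1 out of the k-th
    dyadic interval, because the latter consists of exactly w meshes. *)
Lemma floor_block (R : archiRealFieldType) (j N w k l : nat) (y : R) :
  (N = 2 ^ j * w)%N -> 0 <= y -> y < N%:R^-1 -> (l < w)%N ->
  Num.floor (2 ^+ j * (y + (k * w + l)%:R / N%:R)) = k.
Proof.
move=> NE y0 yN lw; have w0 : (0 : R) < w%:R by rewrite ltr0n; lia.
have p0 : (0 : R) < 2 ^+ j by rewrite exprn_gt0.
have NR : N%:R = 2 ^+ j * w%:R :> R by rewrite NE natrM natrX.
have l0 : (0 : R) <= l%:R by rewrite ler0n.
apply: floor_def; rewrite intrD -!pmulrn.
have -> : 2 ^+ j * (y + (k * w + l)%:R / N%:R) = k%:R + (2 ^+ j * y + l%:R / w%:R).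
  by rewrite NR natrD natrM; field; rewrite !gt_eqF.
have h1 : 2 ^+ j * y < w%:R^-1.
  by rewrite -ltr_pdivlMl// -invfM -NR.
have h2 : l.+1%:R / w%:R <= 1 :> R by rewrite ler_pdivrMr// mul1r ler_nat.
have h3 : 0 <= 2 ^+ j * y by rewrite mulr_ge0// ltW.
have h4 : 0 <= l%:R / w%:R :> R by rewrite divr_ge0// ltW.
rewrite -natr1 mulrDl mul1r in h2.
by apply/andP; split; lra.
Qed.

Section CornerInMeasurableSet.
Variable R : realType.
Local Notation RM := (measurableTypeR R).
Local Notation plane := (RM * RM)%type.
Local Notation mu := (borel_plane_measure R).
Local Notation Sq := (@half_open_square R).

Lemma measurable_corner (X : set plane) (eps d z : R) (E e K : nat) :
  E = 480%N -> measurable X -> X `<=` Sq -> 0 < eps -> ((eps / 2)%:E < mu X)%E ->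
  (0 < e)%N -> (0 < K)%N -> 0 < d -> 0 <= z -> 4 <= z ^+ 2 * K%:R ->
  2 * d + 1 / 2 ^+ e + 2 * z + 35 * (4 * 2 ^+ E) / 2 ^+ e < (eps / 16) ^+ 3 / 32 ->
  exists x y t, [/\ X (x, y), X (x + t, y), X (x, y + t ^+ 2) &
    (2 ^+ (E.+2 * e * K))^-1 <= t].
Proof.
move=> E480 mX XS eps0 hX e0 K0 d0 z0 zK err.
have [_ /(_ (d * eps)) []] := measurable_dyadic_approximable mX; first exact: mulr_gt0.
move=> j0 [D [mD hD inv]].
pose m := (E.+2 * e)%N.
(* The grid is as fine as j0 demands, but the bound for the corner is t / A >= 2^(n - m K) / 2^n, in
   which n cancels. *)
pose n := (m * K.+2 + 512 * (2 * e + j0))%N.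
pose A := (2 ^ n)%N.
have A0 : (0 < A)%N by rewrite expn_gt0.
have AR : (0 : R) < A%:R by rewrite ltr0n.
have [p [Qp sX sD]] := grid_sampling A0 mX mD XS eps0 (mulr_gt0 d0 eps0) hX hD.
pose F i j := grid_point A p i j \in X.
(* [U] asks for a non-exceptional point of [X] in the same column and the same dyadic interval. By
   construction it is constant on dyadic intervals, and by the invariance of [X] it agrees with [F]
   off [D]. *)
pose U i j : bool := `[< exists y', [/\ Sq ((grid_point A p i j).1, y'),
  ~ D ((grid_point A p i j).1, y'), X ((grid_point A p i j).1, y') &
  Num.floor (2 ^+ j0 * y') = Num.floor (2 ^+ j0 * (grid_point A p i j).2)] >].
have [] := @grid_corner R n E e K j0 (4 * 2 ^+ E) z d (eps / 16) F U E480 e0 K0 (lexx _)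
  (leqnn _) _ _ _ _ z0 zK err.
- by rewrite divr_ge0// ltW.
- by apply: le_trans sX; rewrite le_eqVlt; apply/orP; left; apply/eqP; field.
- move=> i _ l /dvdnP[k ->] lB; rewrite /U /grid_point /=.
  have jn : (j0 <= 2 * n)%N by rewrite /n; move: (m * _)%N => w; clear; lia.
  have NE : (A ^ 2 = 2 ^ j0 * 2 ^ (2 * n - j0))%N.
    by rewrite /A -expnM -expnD mulnC; congr (_ ^ _)%N; rewrite subnKC.
  have [y0 y1] : 0 <= p.2 /\ p.2 < (A ^ 2)%:R^-1.
    by case: Qp => _ /=; rewrite in_itv/= => /andP[].
  have w0 : (0 < 2 ^ (2 * n - j0))%N by rewrite expn_gt0.
  have fl := floor_block k NE y0 y1 lB.
  by have := floor_block k NE y0 y1 w0; rewrite addn0 fl => ->.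
- apply: le_trans (_ : _ <= 4 * (d * eps / eps) * A%:R ^+ 3) _.
    apply: le_trans sD; apply: ler_sum_nat => i /andP[_ iA].
    apply: ler_sum_nat => j /andP[_ jA]; rewrite ler_nat.
    have Sp := grid_point_square A0 Qp iA jA.
    rewrite /F /U; case: asboolP => [[y' [S' nD' X' f']]|nU].
      case: (boolP (_ \in X)) => //= nX; rewrite lt0b.
      rewrite inE; apply: contrapT => nD; move/negP: nX; apply; rewrite inE.
      exact: (inv _ _ _ S' Sp nD' nD f' X').
    case: (boolP (_ \in X)) => //= Xp; rewrite lt0b inE; apply: contrapT => nD.
    apply: nU; exists (grid_point A p i j).2; split => //.
    by move: Xp; rewrite inE.
  by rewrite mulfK ?gt_eqF.
move=> i [j [t [tK iA jA /and3P[F1 F2 F3]]]].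
move: F1 F2 F3; rewrite /F !inE => F1 F2 F3.
exists (grid_point A p i j).1, (grid_point A p i j).2, (t%:R / A%:R); split=> //.
- by move: F2; rewrite /grid_point /= natrD mulrDl addrA.
- move: F3; rewrite /grid_point /= natrD mulrDl addrA.
  by rewrite expr_div_n -!natrX.
have mK : (m * K <= n)%N.
  by rewrite /n !mulnS addnA; move: (m * K)%N => w; clear; lia.
rewrite ler_pdivlMr//; apply: (@le_trans _ _ (2 ^ (n - m * K))%:R); last by rewrite ler_nat.
by rewrite /A !natrX -[in leLHS](subnK mK) exprD mulrCA mulVf ?mulr1// expf_neq0.
Qed.

End CornerInMeasurableSet.

Theorem theorem4 (R : realType) :
  exists C : R, 0 < C /\
    forall (eps : R) (E : set (R * R)),
      0 < eps -> eps < 1 / 2 ->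
      E `<=` unit_square ->
      plane_lebesgue_measurable E ->
      (eps%:E <= plane_lebesgue_measure E)%E ->
      exists x y t : R,
        [/\ E (x, y), E (x + t, y), E (x, y + t ^+ 2) &
            expR (- expR (eps `^ (- C))) < t].
Proof.
(* The value 480 is kept behind an equation, so that [2 ^+ N] stays symbolic. *)
have [N NE] : exists N, N = 480%N by eexists.
have [C [C0 hC]] := parameters R N.
exists C; split=> // eps E eps0 eps2 ES mE hE.
have [X [mX XE XS hX]] := inner_approximation eps0 ES mE hE.
have [e [K [d [z [[e0 K0 d0 z0] zK err bound]]]]] := hC _ eps0 eps2.
have [x [y [t [h1 h2 h3 ht]]]] := measurable_corner NE mX XS eps0 hX e0 K0 d0 z0 zK err.
exists x, y, t; split; [exact: XE|exact: XE|exact: XE|exact: lt_le_trans ht].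
Qed.
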